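(* Let $a,b$ be computable reals, let $P\subset\mathbb R^n$ be a hyperplane with a computable dense subset of rational points in it, let $H$ be one of the two half-spaces into which $P$ divides $\mathbb R^n$, let $x_0\neq y_0$ be computable points of $H$, and consider the game $\Gamma(a,b,H)$. If $a\le b$, then Evader has an open-loop computable winning strategy. If $a>b$, then Pursuer has a positional computable winning strategy.
   Context: The game $\Gamma(a,b,H)$: Pursuer's position $x(t)$ and Evader's position $y(t)$ move according to $\dot x=u$, $x(0)=x_0$, and $\dot y=v$, $y(0)=y_0$, where the control functions (also called strategies) are taken from $C_P=\{u : |u|\le a\}$ for Pursuer and $C_E=\{v : |v|\le b\}$ for Evader, both classes consisting of computable functions; $|\cdot|$ is the Euclidean norm. Both players move inside $H$. The goal of Pursuer is exact catch, meaning that the position of Pursuer coincides with the position of Evader. A strategy $u\in C_P$ of Pursuer is winning if for all $v\in C_E$ there is a time $t$ (depending on $v$) with $x(t)=y(t)$. A strategy $v\in C_E$ of Evader is winning if for all $u\in C_P$ we have $x(t)\ne y(t)$ for all $t$. A strategy is open-loop if the control depends on no information other than the time $t$ (for a fixed game, including its initial positions). It is positional if the control at time $t$ depends on $t$ and the current state of the system, i.e. the current positions $(x(t),y(t))$. A function $\phi:\mathbb N\to\mathbb Q^m$ represents $z\in\mathbb R^m$ if $|z-\phi(k)|\le 2^{-k}$ for all $k$; $z$ is computable if it has a computable representation. A function $f:X\to\mathbb R^m$, $X\subseteq\mathbb R^k$, is computable if there is an oracle Turing machine which, for every $z\in X$ and given any representation of $z$ as oracle, outputs for each $j$ a point $q_j\in\mathbb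 Q^m$ with $|f(z)-q_j|<2^{-j}$.
   Formalization: The Evader half is stated for n at least 2 only: for n = 1 the hyperplane is a point and the claim fails, since with a = b an Evader standing between that point and Pursuer is trapped and caught. *)

(* Defs.v *)
From mathcomp Require Import all_boot all_order all_algebra.
From mathcomp Require Import all_classical all_reals all_analysis.
From Stdlib Require Import Relation_Operators.

Set Implicit Arguments.
Unset Strict Implicit.
Unset Printing Implicit Defensive.

Import Order.TTheory GRing.Theory Num.Theory numFieldNormedType.Exports.
Local Open Scope classical_set_scope.
Local Open Scope ring_scope.

(** * Oracle Turing machines

   Deterministic multi-tape machines.  Tapes are infinite to the right; a left
   move from cell 0 stays at cell 0.  Besides [work_tapes] private tapes, each
   machine has an input, a query, an answer and an output tape. *)

Inductive letter := One | Minus | Slash | Comma.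

Inductive io_tape := Input | Query | Answer | Output.

Inductive direction := GoLeft | Stay | GoRight.

(* [None] is the blank; [W] is the private part of the tape alphabet. *)
Definition symbol (W : Type) : Type := option (letter + W).

Definition tape (k : nat) : Type := (io_tape + 'I_k)%type.

(* States, symbols and tapes are finite in number, so [delta] is a finite
   transition table. *)
Record machine := Machine {
  state : finType;
  work_letter : finType;
  work_tapes : nat;
  q_start : state;
  q_query : state;
  q_answer : state;
  q_halt : state;
  delta : state -> (tape work_tapes -> symbol work_letter) ->
          state * (tape work_tapes -> symbol work_letter * direction) }.

Record config (M : machine) := Config {
  cur : state M;
  cell : tape (work_tapes M) -> nat -> symbol (work_letter M);
  head : tape (work_tapes M) -> nat }.

Definition move_head (d : direction) (p : nat) : nat :=
  match d with GoLeft => p.-1 | Stay => p | GoRight => p.+1 end.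

(* The word [w] written from cell 0 on, followed by blanks only. *)
Definition word_tape (W : Type) (w : seq letter) : nat -> symbol W :=
  fun i => if onth w i is Some l then Some (inl l) else None.

Definition ordinary_step (M : machine) (c : config M) : config M :=
  let r := delta (cur c) (fun i => cell c i (head c i)) in
  Config r.1
    (fun i p => if p == head c i then (r.2 i).1 else cell c i p)
    (fun i => move_head (r.2 i).2 (head c i)).

Definition query_step (M : machine) (w : seq letter) (c : config M) : config M :=
  Config (q_answer M)
    (fun i => if i is inl Answer then word_tape _ w else cell c i)
    (fun i => if i is inl Answer then 0%N else head c i).

(* In state [q_query], a query tape containing the unary numeral of [k] has the
   word [O k] put on the answer tape; with any other content the machine is
   stuck, hence never halts. *)
Inductive step (M : machine) (O : nat -> seq letter) :
    config M -> config M -> Prop :=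
  | StepOrdinary c :
      cur c <> q_query M -> cur c <> q_halt M -> step O c (ordinary_step c)
  | StepQuery c k :
      cur c = q_query M -> cur c <> q_halt M ->
      cell c (inl Query) =1 word_tape _ (nseq k One) ->
      step O c (query_step (O k) c).

Definition initial (M : machine) (w : seq letter) : config M :=
  Config (q_start M)
    (fun i => if i is inl Input then word_tape _ w else fun=> None)
    (fun=> 0%N).

Definition runs (M : machine) (O : nat -> seq letter) (inp out : seq letter) :
    Prop :=
  exists c : config M,
    [/\ clos_refl_trans _ (@step M O) (initial M inp) c, cur c = q_halt M
      & cell c (inl Output) =1 word_tape _ out].

(* An ordinary Turing machine is one whose oracle carries no information. *)
Definition no_oracle : nat -> seq letter := fun=> [::].

(** * Rational points as words *)

(* The fraction (-1)^s * p / d, with [p] and [d] in unary. *)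
Definition frac_word (s : bool) (p d : nat) : seq letter :=
  nseq s Minus ++ nseq p One ++ Slash :: nseq d One ++ [:: Comma].

(* Canonical name, with every coordinate in lowest terms. *)
Definition encode (m : nat) (q : 'rV[rat]_m) : seq letter :=
  flatten [seq frac_word (q 0 i < 0) `|numq (q 0%R i)|%N `|denq (q 0%R i)|%N
          | i <- enum 'I_m].

(* Outputs need not be in lowest terms. *)
Definition denotes (m : nat) (w : seq letter) (q : 'rV[rat]_m) : Prop :=
  exists (s : 'I_m -> bool) (p d : 'I_m -> nat),
    w = flatten [seq frac_word (s i) (p i) (d i) | i <- enum 'I_m] /\
    forall i, (0 < d i)%N /\ q 0 i = (-1) ^+ s i * (p i)%:R / (d i)%:R.

Definition computable_seq (m : nat) (phi : nat -> 'rV[rat]_m) : Prop :=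
  exists M : machine, forall k, exists w,
    runs M no_oracle (nseq k One) w /\ denotes w (phi k).

Definition computable_set (m : nat) (D : set 'rV[rat]_m) : Prop :=
  exists M : machine, forall q,
    (D q -> runs M no_oracle (encode q) [:: One]) /\
    (~ D q -> runs M no_oracle (encode q) [::]).

(** * Computability over the reals *)

Section RealComputability.
Variable R : realType.

(* The norm carried by ['rV[R]_m] in the library is the maximum norm. *)
Definition enorm (m : nat) (z : 'rV[R]_m) : R :=
  Num.sqrt (\sum_(i < m) z 0 i ^+ 2).

Definition ratpt (m : nat) (q : 'rV[rat]_m) : 'rV[R]_m := map_mx ratr q.

Definition represents (m : nat) (phi : nat -> 'rV[rat]_m) (z : 'rV[R]_m) :
    Prop :=
  forall k, enorm (z - ratpt (phi k)) <= 2 ^- k.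

Definition computable_point (m : nat) (z : 'rV[R]_m) : Prop :=
  exists phi, computable_seq phi /\ represents phi z.

Definition computable_real (r : R) : Prop :=
  computable_point (\row_(i < 1) r).

(* [f] is a function with domain [X]; its values outside [X] are irrelevant. *)
Definition computable_on (k m : nat) (X : set 'rV[R]_k)
    (f : 'rV[R]_k -> 'rV[R]_m) : Prop :=
  exists M : machine, forall z, X z -> forall phi, represents phi z ->
    forall j, exists w q,
      [/\ runs M (fun i => encode (phi i)) (nseq j One) w, denotes w q
        & enorm (f z - ratpt q) < 2 ^- j].

End RealComputability.

(** * The pursuit game *)

Section PursuitGame.
Variables (R : realType) (n : nat).
Local Notation V := 'rV[R]_n.

Definition dot (u v : V) : R := \sum_(i < n) u 0 i * v 0 i.

Definition is_hyperplane (P : set V) : Prop :=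
  exists nu c, nu != 0 /\ P = [set x | dot nu x = c].

(* [H] is one of the sides of [P], with or without the boundary [P].  The other
   side is obtained by negating [nu] and [c]. *)
Definition half_space_of (P H : set V) : Prop :=
  exists nu c, [/\ nu != 0, P = [set x | dot nu x = c]
    & H = [set x | c <= dot nu x] \/ H = [set x | c < dot nu x]].

Definition has_computable_dense_rational_subset (P : set V) : Prop :=
  exists D : set 'rV[rat]_n,
    [/\ computable_set D, [set ratpt R q | q in D] `<=` P
      & P `<=` closure [set ratpt R q | q in D]].

(* The game Gamma(a, b, H) started at (x0, y0). *)
Record game := Game {
  speedP : R;
  speedE : R;
  arena : set V;
  startP : V;
  startE : V }.

(* The time and the positions of Pursuer and Evader. *)
Definition status (t : R) (x y : V) : 'rV[R]_(1 + (n + n)) :=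
  row_mx (\row_(i < 1) t) (row_mx x y).

(* Play is over once the positions coincide, so a control is defined only where
   they differ; a control continuous across coincidence could not even describe
   moving straight towards the opponent. *)
Definition live (G : game) : set 'rV[R]_(1 + (n + n)) :=
  [set z | exists t x y,
     [/\ z = status t x y, 0 <= t, arena G x, arena G y & x <> y]].

Definition times : set 'rV[R]_1 := [set t | 0 <= t 0 0].

(* Positional controls; the open-loop ones are the particular case
   [open_loop] below. *)
Definition strategy := 'rV[R]_(1 + (n + n)) -> V.

Definition control_class (G : game) (c : R) (s : strategy) : Prop :=
  computable_on (live G) s /\ forall z, live G z -> enorm (s z) <= c.

Definition CP (G : game) : strategy -> Prop := control_class G (speedP G).
Definition CE (G : game) : strategy -> Prop := control_class G (speedE G).

Definition open_loop_control (c : R) (w : 'rV[R]_1 -> V) : Prop :=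
  computable_on times w /\ forall t, times t -> enorm (w t) <= c.

Definition lift_control (w : 'rV[R]_1 -> V) : strategy := fun z => w (lsubmx z).

Definition open_loop (G : game) (c : R) (s : strategy) : Prop :=
  exists w, open_loop_control c w /\
    forall z, live G z -> s z = lift_control w z.

(* The motion of one player from [p0] under an open-loop control keeping that
   player in [H].  Both here and in [play], the differential equation holds for
   t > 0 and continuity at 0 makes it hold at 0 for the right derivative. *)
Definition open_loop_motion (H : set V) (w : 'rV[R]_1 -> V) (p0 : V)
    (p : R -> V) : Prop :=
  [/\ p 0 = p0, {within `[0, +oo[, continuous p},
      forall t : R, 0 <= t -> H (p t)
    & forall t : R, 0 < t -> is_derive t (1 : R) p (w (\row_(i < 1) t))].

(* Both players stay in the arena, and obey their strategies until the first
   coincidence; what they do afterwards is irrelevant. *)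
Definition play (G : game) (u v : strategy) (x y : R -> V) : Prop :=
  [/\ x 0 = startP G /\ y 0 = startE G,
      {within `[0, +oo[, continuous x} /\ {within `[0, +oo[, continuous y},
      forall t : R, 0 <= t -> arena G (x t) /\ arena G (y t)
    & forall t : R, 0 < t -> (forall s : R, 0 <= s <= t -> x s <> y s) ->
        is_derive t (1 : R) x (u (status t (x t) (y t))) /\
        is_derive t (1 : R) y (v (status t (x t) (y t)))].

(* Admissibility says that the strategy really
   moves its player inside the arena, whatever open-loop motion the opponent
   chooses there; it excludes winning for lack of any play.  An opponent strategy
   that leaves the arena takes part in no play. *)
Definition admissibleP (G : game) (u : strategy) : Prop :=
  forall w y, open_loop_control (speedE G) w ->
    open_loop_motion (arena G) w (startE G) y ->
    exists x, play G u (lift_control w) x y.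

Definition admissibleE (G : game) (v : strategy) : Prop :=
  forall w x, open_loop_control (speedP G) w ->
    open_loop_motion (arena G) w (startP G) x ->
    exists y, play G (lift_control w) v x y.

Definition winningP (G : game) (u : strategy) : Prop :=
  admissibleP G u /\
  forall v, CE G v -> forall x y, play G u v x y ->
    exists t : R, 0 <= t /\ x t = y t.

Definition winningE (G : game) (v : strategy) : Prop :=
  admissibleE G v /\
  forall u, CP G u -> forall x y, play G u v x y ->
    forall t : R, 0 <= t -> x t <> y t.

End PursuitGame.

(* Main.v *)
(* Evader runs parallel to the hyperplane, with full speed b, in the direction of
   a difference q of two rational points of P chosen so as not to point towards
   Pursuer.  Then |y(t) - x0| > b t >= a t at all times.  The velocity b q / |q| is
   constant, and computable because b is.

   For Pursuer take integers kappa, B, T with kappa <= a B, b B + 1 < kappa and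
   B |y0 - x0| < T.  With z = y - x and Z = max (T - t) 0, the control
   u = kappa Z z / max (Z^2) (B^2 |z|^2) has norm at most kappa / B <= a.  As long
   as B |z| < Z, it is the linear law x' = kappa z / (T - t), and equality
   B |z| = Z cannot be reached, since there (Z^2 - B^2 |z|^2)' would be positive.
   So z vanishes at time T at the latest.  The linear equation is solved by a
   quadrature for any continuous y, and (nu.x - c) / (T - t)^kappa is nondecreasing,
   which keeps Pursuer in H.  As a product of two vectors of norm at most 1, u
   is Lipschitz with constant C / r at scale r = max Z (B |z|), so that an oracle
   machine only has to raise the precision k until C 2^j < 2^k r.

   Machines are obtained by compiling structured programs, whose registers are
   work tapes with the value stored as the position of the head. *)

Require Import Defs.
From mathcomp Require Import all_boot all_order all_algebra.
From mathcomp Require Import all_classical all_reals all_analysis.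
From mathcomp Require Import zify ring lra.
From Stdlib Require Import Relation_Operators Operators_Properties.

Set Implicit Arguments.
Unset Strict Implicit.
Unset Printing Implicit Defensive.

Import Order.TTheory GRing.Theory Num.Theory numFieldNormedType.Exports.

(** * Compiling structured programs *)

(** Winning includes admissibility, and this shapes Pursuer's half. Running straight at Evader gives
    a nonlinear equation, singular at coincidence, to be solved for every continuous opponent; the
    linear law with horizon T has an explicit solution instead. Outside the cone B |z| < Z, which is
    not met before the catch, the formula only serves to make the control bounded and computable on
    all live states. The constants are integers so that they can be written into a program. The
    control is then a rational expression with positive parts: it is evaluated exactly at rational
    approximations, and the one question is which precision suffices. Since its Lipschitz bound
    blows up near coincidence, no precision can be fixed in advance, hence an unbounded search
    through the oracle. Evader's control is constant, but b is given only by some machine, which has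
    to be run inside another one; dividing by |q| then costs an integer square root. All numerals
    are unary, as in the input format, so counters are enough for everything. *)

Section Programs.
Variables (W : finType) (K : nat).
Local Notation tp := (tape K).
Local Notation sym := (symbol W).

Definition reading := tp -> sym.
Definition action := reading -> tp -> sym * direction.

(** A configuration without its state: the program counter takes the place of the state. *)
Record memory := Mem { mcell : tp -> nat -> sym; mhead : tp -> nat }.

Lemma mem_eq m m' : (forall i p, mcell m i p = mcell m' i p) ->
  (forall i, mhead m i = mhead m' i) -> m = m'.
Proof.
case: m m' => [c h] [c' h'] /= ec eh; congr Mem; last exact/funext.
by apply/funext=> i; apply/funext=> p.
Qed.

Definition scan (m : memory) : reading := fun i => mcell m i (mhead m i).

Definition perform (f : action) (m : memory) : memory :=
  Mem (fun i p => if p == mhead m i then (f (scan m) i).1 else mcell m i p)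
      (fun i => move_head (f (scan m) i).2 (mhead m i)).

Definition put_answer (w : seq letter) (m : memory) : memory :=
  Mem (fun i => if i is inl Answer then word_tape _ w else mcell m i)
      (fun i => if i is inl Answer then 0%N else mhead m i).

(** Tests see only the symbols under the heads, so a test costs one transition, like an action. *)
Inductive com :=
  | Act of action
  | Ask
  | Seq of com & com
  | If of (reading -> bool) & com & com
  | While of (reading -> bool) & com.

Variable O : nat -> seq letter.

Inductive exec : com -> memory -> memory -> Prop :=
  | ExecAct f m : exec (Act f) m (perform f m)
  | ExecAsk m k : mcell m (inl Query) =1 word_tape _ (nseq k One) ->
      exec Ask m (put_answer (O k) m)
  | ExecSeq c1 c2 m1 m2 m3 : exec c1 m1 m2 -> exec c2 m2 m3 ->
      exec (Seq c1 c2) m1 m3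
  | ExecIfT (p : reading -> bool) c1 c2 m m' : p (scan m) -> exec c1 m m' ->
      exec (If p c1 c2) m m'
  | ExecIfF (p : reading -> bool) c1 c2 m m' : ~~ p (scan m) -> exec c2 m m' ->
      exec (If p c1 c2) m m'
  | ExecWhileF (p : reading -> bool) c m : ~~ p (scan m) -> exec (While p c) m m
  | ExecWhileT (p : reading -> bool) c m1 m2 m3 : p (scan m1) -> exec c m1 m2 ->
      exec (While p c) m2 m3 -> exec (While p c) m1 m3.

Fixpoint asks (c : com) : nat :=
  match c with
  | Act _ => 0
  | Ask => 1
  | Seq c1 c2 => asks c1 + asks c2
  | If _ c1 c2 => asks c1 + asks c2
  | While _ c1 => asks c1
  end.

(** [IElse p l] falls through to the next instruction when [p] holds and otherwise jumps to the
    address [l]; with [never] it is an unconditional jump. *)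
Inductive instr :=
  | IAct of action
  | IAsk
  | IElse of (reading -> bool) & nat.

Definition is_ask (i : instr) : bool := if i is IAsk then true else false.

Definition never : reading -> bool := fun=> false.

(** Jumps are absolute, so the code has to know the address [b] at which it will be placed. *)
Fixpoint compile (b : nat) (c : com) : seq instr :=
  match c with
  | Act f => [:: IAct f]
  | Ask => [:: IAsk]
  | Seq c1 c2 => let s1 := compile b c1 in s1 ++ compile (b + size s1) c2
  | If p c1 c2 =>
      let s1 := compile b.+1 c1 in
      let s2 := compile (b + (size s1).+2) c2 in
      IElse p (b + (size s1).+2) :: s1 ++
      IElse never (b + (size s1).+2 + size s2) :: s2
  | While p c1 =>
      let s1 := compile b.+1 c1 in
      IElse p (b + (size s1).+2) :: s1 ++ [:: IElse never b]
  end.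

Lemma count_compile b c : count is_ask (compile b c) = asks c.
Proof.
elim: c b => //= [c1 IH1 c2 IH2|p c1 IH1 c2 IH2|p c1 IH1] b;
  by rewrite count_cat /= ?IH1 ?IH2 ?addn0 ?add0n.
Qed.

Variable code : seq instr.

(* The query state of a machine is unique: a program asks from one place. *)
Definition pc_query := find is_ask code.

Definition code_delta (q : 'I_(size code).+1) (r : reading) :
    'I_(size code).+1 * (tp -> sym * direction) :=
  match nth IAsk code q with
  | IAct f => (inord q.+1, f r)
  | IAsk => (q, fun i => (r i, Stay))
  | IElse p l => (inord (if p r then q.+1 else l), fun i => (r i, Stay))
  end.

Definition code_machine : machine :=
  @Machine 'I_(size code).+1 W K ord0 (inord pc_query) (inord pc_query.+1)
    ord_max code_delta.

Definition at_pc (pc : nat) (m : memory) : config code_machine :=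
  @Config code_machine (inord pc) (mcell m) (mhead m).

Local Notation steps := (clos_refl_trans _ (@step code_machine O)).

Lemma inord_neq (N i j : nat) : (i <= N)%N -> (j <= N)%N -> i <> j ->
  inord i <> inord j :> 'I_N.+1.
Proof. by move=> hi hj ne /(congr1 val) /=; rewrite !inordK. Qed.

Lemma inord_end : inord (size code) = ord_max :> 'I_(size code).+1.
Proof. by apply: val_inj; rewrite /= inordK. Qed.

Lemma step_ordinary pc m : (pc < size code)%N -> pc <> pc_query ->
  @step code_machine O (at_pc pc m) (ordinary_step (at_pc pc m)).
Proof.
move=> lt ne; apply: StepOrdinary; rewrite /at_pc /=.
  apply: inord_neq => //; first exact: ltnW.
  exact: find_size.
rewrite -inord_end; apply: inord_neq => //; first exact: ltnW.
by move=> e; rewrite e ltnn in lt.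
Qed.

Lemma step_act pc m f : (pc < size code)%N -> nth IAsk code pc = IAct f ->
  steps (at_pc pc m) (at_pc pc.+1 (perform f m)).
Proof.
move=> lt e; apply: rt_step.
have ne : pc <> pc_query.
  move=> ee; have h : has is_ask code by rewrite has_find -/pc_query -ee.
  by have := nth_find IAsk h; rewrite -/pc_query -ee e.
have -> : at_pc pc.+1 (perform f m) = ordinary_step (at_pc pc m).
  by rewrite /ordinary_step /= /code_delta inordK ?ltnS ?(ltnW lt)// e.
exact: step_ordinary.
Qed.

Lemma step_else pc m p l : (pc < size code)%N -> nth IAsk code pc = IElse p l ->
  steps (at_pc pc m) (at_pc (if p (scan m) then pc.+1 else l) m).
Proof.
move=> lt e; apply: rt_step.
have ne : pc <> pc_query.
  move=> ee; have h : has is_ask code by rewrite has_find -/pc_query -ee.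
  by have := nth_find IAsk h; rewrite -/pc_query -ee e.
have -> : at_pc (if p (scan m) then pc.+1 else l) m =
    ordinary_step (at_pc pc m).
  rewrite /ordinary_step /= /code_delta inordK ?ltnS ?(ltnW lt)// e /=.
  congr Config; apply/funext=> i; apply/funext=> j.
  by case: eqP => // ->.
exact: step_ordinary.
Qed.

Lemma step_ask pc m k : (pc < size code)%N -> pc = pc_query ->
  mcell m (inl Query) =1 word_tape _ (nseq k One) ->
  steps (at_pc pc m) (at_pc pc.+1 (put_answer (O k) m)).
Proof.
move=> lt e q; apply: rt_step.
have -> : at_pc pc.+1 (put_answer (O k) m) = query_step (O k) (at_pc pc m).
  by rewrite /query_step /at_pc e.
apply: StepQuery => //=; first by rewrite e.
rewrite -inord_end; apply: inord_neq => //; first exact: ltnW.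
by move=> ee; rewrite ee ltnn in lt.
Qed.

Definition code_at (b : nat) (s : seq instr) : Prop :=
  exists s1 s2, code = s1 ++ s ++ s2 /\ size s1 = b.

Lemma code_at_catl b s t : code_at b (s ++ t) -> code_at b s.
Proof.
by case=> s1 [s2 [e <-]]; exists s1, (t ++ s2); rewrite e -!catA.
Qed.

Lemma code_at_catr b s t : code_at b (s ++ t) -> code_at (b + size s) t.
Proof.
by case=> s1 [s2 [e <-]]; exists (s1 ++ s), s2; rewrite e size_cat -!catA.
Qed.

Lemma code_at_cons b i s : code_at b (i :: s) ->
  [/\ (b < size code)%N, nth IAsk code b = i & code_at b.+1 s].
Proof.
case=> s1 [s2 [e <-]]; split.
- by rewrite e size_cat /= addnS ltnS leq_addr.
- by rewrite e nth_cat ltnn subnn.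
- by exists (rcons s1 i), s2; rewrite e cat_rcons size_rcons.
Qed.

(** An [IAsk] beyond the first one would raise the count to 2. *)
Lemma nth_ask pc : (count is_ask code <= 1)%N -> (pc < size code)%N ->
  nth IAsk code pc = IAsk -> pc = pc_query.
Proof.
move=> c1 lt e; case: (ltngtP pc pc_query) => // h.
  by have := before_find IAsk h; rewrite e.
have : (1 < count is_ask code)%N; last by rewrite ltnNge c1.
rewrite -(cat_take_drop pc code) count_cat.
rewrite (drop_nth IAsk lt) e /= addnA addn1 addSn ltnS.
apply: leq_trans (leq_addr _ _); rewrite -has_count.
apply/(has_nthP IAsk); exists pc_query; first by rewrite size_take lt.
by rewrite nth_take // nth_find // has_find; apply: ltn_trans lt.
Qed.

(** The induction is on the derivation of [exec] and not on the command: an iterated [While] jumps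
    back to its own address [b] and runs the same code again. *)
Lemma exec_steps c m m' : exec c m m' -> (count is_ask code <= 1)%N ->
  forall b, code_at b (compile b c) ->
  steps (at_pc b m) (at_pc (b + size (compile b c)) m').
Proof.
move=> + c1; elim=> {c m m'} /=.
- by move=> f m b /code_at_cons[lt e _]; rewrite addn1; exact: step_act.
- move=> m k q b /code_at_cons[lt e _]; rewrite addn1.
  by apply: step_ask => //; exact: nth_ask.
- move=> c1' c2 m1 m2 m3 _ IH1 _ IH2 b h; rewrite size_cat addnA.
  by apply: rt_trans (IH1 _ (code_at_catl h)) (IH2 _ (code_at_catr h)).
- move=> p c1' c2 m m' pm _ IH b /code_at_cons[lt e h].
  rewrite size_cat /= !addnS; have := step_else m lt e; rewrite pm => st.
  have /code_at_cons[lt2 e2 _] := code_at_catr h.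
  apply: rt_trans st _; apply: rt_trans (IH _ (code_at_catl h)) _.
  have := step_else m' lt2 e2; rewrite /never /= !addnS addnA.
  by rewrite ?addSn ?addnS.
- move=> p c1' c2 m m' pm _ IH b /code_at_cons[lt e h].
  rewrite size_cat /=; have := step_else m lt e; rewrite (negPf pm) => st.
  have /code_at_cons[lt2 e2 h2] := code_at_catr h.
  apply: rt_trans st _; have := IH (b + (size (compile b.+1 c1')).+2)%N.
  rewrite !addnS !addSn in h2 *; rewrite addnA => IH'; apply: IH'.
  exact: h2.
- move=> p c m pm b /code_at_cons[lt e h].
  have := step_else m lt e; rewrite (negPf pm) size_cat /=.
  by rewrite addn1 !addnS.
- move=> p c m1 m2 m3 pm _ IH1 _ IH2 b hh; have := hh.
  move=> /code_at_cons[lt e h].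
  have := step_else m1 lt e; rewrite pm => st.
  apply: rt_trans st _; apply: rt_trans (IH1 _ (code_at_catl h)) _.
  have /code_at_cons[lt2 e2 _] := code_at_catr h.
  by apply: rt_trans (step_else m2 lt2 e2) _; rewrite /never /=; exact: IH2.
Qed.

End Programs.

Arguments Ask {W K}.

Definition init_memory W K (w : seq letter) : memory W K :=
  Mem (fun i => if i is inl Input then word_tape _ w else fun=> None)
      (fun=> 0%N).

Lemma exec_runs W K (O : nat -> seq letter) (c : com W K) inp out m :
  (asks c <= 1)%N -> exec O c (init_memory W K inp) m ->
  mcell m (inl Output) =1 word_tape _ out ->
  runs (code_machine (compile 0 c)) O inp out.
Proof.
move=> c1 ex ho; exists (at_pc (compile 0 c) (size (compile 0 c)) m).
split=> //; last by rewrite /at_pc /= inord_end.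
have -> : initial (code_machine (compile 0 c)) inp =
    at_pc (compile 0 c) 0 (init_memory W K inp).
  by rewrite /initial /at_pc /=; congr Config; apply: val_inj; rewrite /= inordK.
apply: (exec_steps ex) => //; first by rewrite count_compile.
by exists [::], [::]; rewrite cats0.
Qed.

(** * Counter programs *)

(** Subtraction is truncated, which provides tests and signs: [1 - (1 - x)] is 1 for positive [x]
    and 0 otherwise. *)
Inductive nexpr :=
  | NVar of nat
  | NConst of nat
  | NAdd of nexpr & nexpr
  | NSub of nexpr & nexpr
  | NMul of nexpr & nexpr.

Fixpoint nval (rho : nat -> nat) (e : nexpr) : nat :=
  match e with
  | NVar r => rho r
  | NConst c => c
  | NAdd e1 e2 => nval rho e1 + nval rho e2
  | NSub e1 e2 => nval rho e1 - nval rho e2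
  | NMul e1 e2 => nval rho e1 * nval rho e2
  end.

Fixpoint vars_below (t : nat) (e : nexpr) : bool :=
  match e with
  | NVar r => (r < t)%N
  | NConst _ => true
  | NAdd e1 e2 | NSub e1 e2 | NMul e1 e2 => vars_below t e1 && vars_below t e2
  end.

(* A bound on the number of scratch registers needed by the evaluation. *)
Fixpoint scratch (e : nexpr) : nat :=
  match e with
  | NVar _ | NConst _ => 2
  | NAdd e1 e2 | NSub e1 e2 | NMul e1 e2 => (scratch e1 + scratch e2 + 4)%N
  end.

Definition upd (rho : nat -> nat) (r v : nat) : nat -> nat :=
  fun i => if i == r then v else rho i.

Lemma nval_ext t rho rho' e : vars_below t e ->
  (forall r, (r < t)%N -> rho r = rho' r) -> nval rho e = nval rho' e.
Proof.
move=> + h; elim: e => [r|//|||] //=; first exact: h.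
all: by move=> e1 IH1 e2 IH2 /andP[/IH1-> /IH2->].
Qed.

Lemma vars_below_leq t t' e : (t <= t')%N -> vars_below t e -> vars_below t' e.
Proof.
move=> h; elim: e => [r|//|||] //=; first by move=> /leq_trans; apply.
all: by move=> e1 IH1 e2 IH2 /andP[/IH1-> /IH2->].
Qed.

Definition dirs (ups downs : seq nat) : nat -> direction :=
  fun i => if i \in downs then GoLeft else if i \in ups then GoRight else Stay.

Definition shift_head (d : direction) (k x : nat) : nat :=
  match d with GoLeft => x - k | Stay => x | GoRight => x + k end.

Lemma shift_head0 d x : shift_head d 0 x = x.
Proof. by case: d => /=; lia. Qed.

Lemma shift_headS d k x : shift_head d k (move_head d x) = shift_head d k.+1 x.
Proof. by case: d => /=; lia. Qed.

Ltac regs := let i := fresh "i" in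
  try (apply/funext=> i); rewrite /upd /dirs ?inE /=;
  repeat (case: eqP => ? //=; subst => //=); try lia.

(** Tapes are compared by classical equality, [io_tape] being declared without a boolean one. *)
Definition tset (K : nat) (T : Type) (f : tape K -> T) (i : tape K) (v : T) :
    tape K -> T :=
  fun j => if `[< j = i >] then v else f j.

Lemma tset_eq K T (f : tape K -> T) i v : tset f i v i = v.
Proof. by rewrite /tset; case: asboolP. Qed.

Lemma tset_neq K T (f : tape K -> T) i v j : j <> i -> tset f i v j = f j.
Proof. by rewrite /tset; case: asboolP. Qed.

Lemma tset_tset K T (f : tape K -> T) i v v' :
  tset (tset f i v) i v' = tset f i v'.
Proof. by apply/funext=> j; rewrite /tset; case: asboolP. Qed.

Lemma tset_id K T (f : tape K -> T) i v : f i = v -> tset f i v = f.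
Proof. by move=> <-; apply/funext=> j; rewrite /tset; case: asboolP => [->|]. Qed.

Lemma tset_comm K T (f : tape K -> T) i j v v' : i <> j ->
  tset (tset f i v) j v' = tset (tset f j v') i v.
Proof.
by move=> ne; apply/funext=> k; rewrite /tset; do 2!case: asboolP => // ?; subst.
Qed.

Lemma onth_drop (w : seq letter) p : onth w p = ohead (drop p w).
Proof. by elim: w p => [|x w IH] [|p] //=. Qed.

Lemma drop_cons (w : seq letter) p x s : drop p w = x :: s -> drop p.+1 w = s.
Proof. by move=> e; rewrite -addn1 addnC -drop_drop e /= drop0. Qed.

Lemma drop_cat_size (w s t : seq letter) p : drop p w = s ++ t ->
  drop (p + size s) w = t.
Proof. by move=> e; rewrite addnC -drop_drop e drop_size_cat. Qed.

Definition frac := (bool * nat * nat)%type.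

Definition frac_words (l : seq frac) : seq letter :=
  flatten [seq frac_word x.1.1 x.1.2 x.2 | x <- l].

Fixpoint load (r : nat) (l : seq frac) (rho : nat -> nat) : nat -> nat :=
  if l is x :: l' then
    load r.+3 l' (upd (upd (upd rho r x.1.1) r.+1 x.1.2) r.+2 x.2)
  else rho.

Lemma load_out r l rho i : (i < r)%N || (r + 3 * size l <= i)%N ->
  load r l rho i = rho i.
Proof.
elim: l r rho => //= x l IH r rho h; rewrite IH; last by lia.
by regs.
Qed.

Lemma load_ext r l rho rho' :
  (forall i, (i < r)%N || (r + 3 * size l <= i)%N -> rho i = rho' i) ->
  load r l rho = load r l rho'.
Proof.
elim: l r rho rho' => [|x l IH] r rho rho' h /=.
  by apply/funext=> i; apply: h; rewrite /=; lia.
apply: IH => i hi; rewrite /upd; do 3!case: eqP => // ?.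
by apply: h; rewrite /=; lia.
Qed.

Lemma load_nth r l rho i x0 (x := nth x0 l i) : (i < size l)%N ->
  [/\ load r l rho (r + 3 * i) = x.1.1, load r l rho (r + 3 * i).+1 = x.1.2
    & load r l rho (r + 3 * i).+2 = x.2].
Proof.
rewrite {}/x; elim: l r rho i => // y l IH r rho [|i] /= lt.
  by rewrite muln0 addn0 !load_out; first (by split; regs); lia.
have -> : (r + 3 * i.+1 = r.+3 + 3 * i)%N by lia.
exact: IH.
Qed.

(* The rational number (P - N) / D. *)
Record rexpr := RExpr { rP : nexpr; rN : nexpr; rD : nexpr }.

(** One of the two truncated differences vanishes, so their sum is the absolute value of the
    numerator. *)
Definition rfrac (rho : nat -> nat) (x : rexpr) : frac :=
  let p := nval rho (rP x) in let n := nval rho (rN x) in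
  ((p < n)%N, (p - n + (n - p))%N, nval rho (rD x)).

Definition rvars (t : nat) (x : rexpr) : bool :=
  [&& vars_below t (rP x), vars_below t (rN x) & vars_below t (rD x)].

Definition rscratch (x : rexpr) : nat :=
  (scratch (rP x) + scratch (rN x) + scratch (rD x) + scratch (rN x)
   + scratch (rP x) + 24)%N.

(** The registers in round [k] of a search with input [j]. Precisions are stored as powers of 2,
    which makes the stopping test polynomial in the registers. *)
Definition env (j k : nat) (l : seq frac) : nat -> nat :=
  load 4 l (upd (upd (fun=> 0%N) 1 (2 ^ j)) 2 (2 ^ k)).

Lemma env12 j k l : env j k l 1 = (2 ^ j)%N /\ env j k l 2 = (2 ^ k)%N.
Proof. by rewrite /env !load_out. Qed.

Section Counters.
Variables (W : finType) (K Rn : nat) (O : nat -> seq letter).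
Hypothesis RnK : (Rn <= K)%N.
Local Notation tp := (tape K).
Local Notation sym := (symbol W).
Local Notation com := (com W K).
Local Notation exec := (exec O).

(* The work tapes below [Rn] are counters: cell 0 is marked, all other cells are
   blank, and the value of the counter is the position of the head. *)
Definition marker : sym := Some (inl One).

Definition register (i : tp) : option nat :=
  if i is inr j then if (j < Rn)%N then Some (j : nat) else None else None.

(** [C] and [H] are ignored on register tapes, so both may be updated without regard to the
    counters. *)
Definition conc (rho : nat -> nat) (C : tp -> nat -> sym) (H : tp -> nat) :
    memory W K :=
  Mem (fun i p => if register i is Some _ then if p == 0%N then marker else None
                  else C i p)
      (fun i => if register i is Some r then rho r else H i).

Lemma conc_eq rho rho' C C' H H' : (forall r, (r < Rn)%N -> rho r = rho' r) ->
  (forall i, register i = None -> C i =1 C' i) ->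
  (forall i, register i = None -> H i = H' i) -> conc rho C H = conc rho' C' H'.
Proof.
move=> er ec eh; apply: mem_eq => /= [i p|i].
  by case E: (register i) => //; exact: ec.
case E: (register i) => [r|]; last exact: eh.
by apply: er; move: E; case: i => //= j; case: ifP => // h [<-].
Qed.

Definition go (g : reading W K -> nat -> direction) (o : action W K) :
    action W K :=
  fun rd i => if register i is Some r then (rd i, g rd r) else o rd i.

Lemma exec_go g o rho C H (rd := scan (conc rho C H)) :
  exec (Act (go g o)) (conc rho C H)
    (conc (fun r => move_head (g rd r) (rho r))
       (fun i p => if p == H i then (o rd i).1 else C i p)
       (fun i => move_head (o rd i).2 (H i))).
Proof.
set m' := (m' in exec _ _ m').
have -> : m' = perform (go g o) (conc rho C H).
  apply: mem_eq => [i p|i] /=; rewrite /go -/rd; case E: (register i) => [r|] //=.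
  by rewrite /rd /scan /= E; case: (p =P rho r) => // ->.
exact: ExecAct.
Qed.

Definition idle : action W K := fun rd i => (rd i, Stay).

Definition nudge (g : nat -> direction) : com := Act (go (fun=> g) idle).

Lemma exec_nudge g rho C H : exec (nudge g) (conc rho C H)
  (conc (fun r => move_head (g r) (rho r)) C H).
Proof.
have := exec_go (fun=> g) idle rho C H; congr exec; apply: conc_eq => //= i E p.
by rewrite /scan /= E; case: eqP => // ->.
Qed.

Definition skip : com := nudge (fun=> Stay).

Lemma exec_skip rho C H : exec skip (conc rho C H) (conc rho C H).
Proof. exact: exec_nudge. Qed.

Definition on_tape (tau : tp) (f : sym -> sym * direction) : action W K :=
  fun rd i => if `[< i = tau >] then f (rd i) else (rd i, Stay).

Definition walk (g : nat -> direction) (tau : tp) (d : direction) : com :=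
  Act (go (fun=> g) (on_tape tau (fun s => (s, d)))).

Lemma exec_walk g tau d rho C H : exec (walk g tau d) (conc rho C H)
  (conc (fun r => move_head (g r) (rho r)) C
        (tset H tau (move_head d (H tau)))).
Proof.
have := exec_go (fun=> g) (on_tape tau (fun s => (s, d))) rho C H.
congr exec; apply: conc_eq => //= i E.
  move=> p; rewrite /on_tape /scan /= E.
  by case: asboolP => _ /=; case: eqP => // ->.
by rewrite /on_tape /tset; case: asboolP => // ->.
Qed.

Definition write (g : nat -> direction) (tau : tp) (s : sym) (d : direction) :
    com :=
  Act (go (fun=> g) (on_tape tau (fun=> (s, d)))).

Lemma exec_write g tau s d rho C H : exec (write g tau s d) (conc rho C H)
  (conc (fun r => move_head (g r) (rho r))
        (tset C tau (fun p => if p == H tau then s else C tau p))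
        (tset H tau (move_head d (H tau)))).
Proof.
have := exec_go (fun=> g) (on_tape tau (fun=> (s, d))) rho C H.
congr exec; apply: conc_eq => //= i E.
  move=> p; rewrite /on_tape /scan /= E /tset.
  by case: asboolP => [->|_] //=; case: eqP => // ->.
by rewrite /on_tape /tset; case: asboolP => // ->.
Qed.

Definition nonzero (r : nat) : reading W K -> bool :=
  fun rd => if insub r is Some j then
    if rd (inr j) is Some (inl One) then false else true else false.

Lemma nonzeroE r rho C H : (r < Rn)%N ->
  nonzero r (scan (conc rho C H)) = (rho r != 0%N).
Proof.
move=> lt; rewrite /nonzero /scan /= insubT; first exact: leq_trans RnK.
by move=> h /=; rewrite lt; case: eqP.
Qed.

(** All heads move in the same transition: draining [r] adds its value to each counter of [ups] and
    subtracts it from each counter of [downs]. Clearing, copying, addition and truncated subtraction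
    are all instances. *)
Definition xfer (ups downs : seq nat) (r : nat) : com :=
  While (nonzero r) (nudge (dirs ups downs)).

Lemma exec_xfer ups downs r rho C H : (r < Rn)%N -> r \in downs ->
  exec (xfer ups downs r) (conc rho C H)
    (conc (fun i => shift_head (dirs ups downs i) (rho r) (rho i)) C H).
Proof.
move=> lt hr; have [n en] : exists n, n = rho r by exists (rho r).
elim: n rho en => [|n IH] rho en; rewrite -en.
  have -> : (fun i => shift_head (dirs ups downs i) 0 (rho i)) = rho.
    by apply/funext=> i; rewrite shift_head0.
  by apply: ExecWhileF; rewrite nonzeroE // -en.
apply: ExecWhileT; [by rewrite nonzeroE // -en|exact: exec_nudge|].
set rho' := fun r0 => _.
have e' : n = rho' r by rewrite /rho' /dirs hr -en.
have := IH _ e'; rewrite -e'; congr exec; congr conc.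
by apply/funext=> i; rewrite /rho' shift_headS.
Qed.

(** Reading a counter destroys it, so a variable is drained into [t] and [t.+1] and restored from
    [t.+1]. A product does the same with [t.+2], backed up in [t.+3], once for each unit of
    [t.+1]. *)
Fixpoint ev (e : nexpr) (t : nat) : com :=
  match e with
  | NVar r => Seq (xfer [:: t; t.+1] [:: r] r) (xfer [:: r] [:: t.+1] t.+1)
  | NConst c => iter c (Seq (nudge (dirs [:: t] [::]))) skip
  | NAdd e1 e2 => Seq (ev e1 t) (Seq (ev e2 t.+1) (xfer [:: t] [:: t.+1] t.+1))
  | NSub e1 e2 =>
      Seq (ev e1 t) (Seq (ev e2 t.+1) (xfer [::] [:: t; t.+1] t.+1))
  | NMul e1 e2 =>
      Seq (ev e1 t.+1) (Seq (ev e2 t.+2) (Seq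
        (While (nonzero t.+1) (Seq (nudge (dirs [::] [:: t.+1]))
          (Seq (xfer [:: t; t.+3] [:: t.+2] t.+2)
               (xfer [:: t.+2] [:: t.+3] t.+3))))
        (xfer [::] [:: t.+2] t.+2)))
  end.

Lemma asks_ev e t : asks (ev e t) = 0%N.
Proof.
elim: e t => [r|c|e1 IH1 e2 IH2|e1 IH1 e2 IH2|e1 IH1 e2 IH2] t //=.
  by elim: c.
all: by rewrite IH1 IH2.
Qed.

Lemma exec_const c t rho C H : exec (iter c (Seq (nudge (dirs [:: t] [::]))) skip)
  (conc rho C H) (conc (upd rho t (rho t + c)%N) C H).
Proof.
elim: c rho => [|c IH] rho /=.
  have -> : upd rho t (rho t + 0)%N = rho by regs.
  exact: exec_skip.
apply: ExecSeq; first exact: exec_nudge.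
set rho' := fun r0 => _.
have -> : upd rho t (rho t + c.+1)%N = upd rho' t (rho' t + c)%N.
  by rewrite /rho'; regs.
exact: IH.
Qed.

Lemma exec_mul t rho C H : (t.+3 < Rn)%N -> rho t.+3 = 0%N ->
  exec (While (nonzero t.+1) (Seq (nudge (dirs [::] [:: t.+1]))
          (Seq (xfer [:: t; t.+3] [:: t.+2] t.+2)
               (xfer [:: t.+2] [:: t.+3] t.+3))))
    (conc rho C H)
    (conc (upd (upd rho t.+1 0) t (rho t + rho t.+1 * rho t.+2)%N) C H).
Proof.
move=> lt; have [n en] : exists n, n = rho t.+1 by exists (rho t.+1).
have lt1 : (t.+1 < Rn)%N by lia.
have lt2 : (t.+2 < Rn)%N by lia.
elim: n rho en => [|n IH] rho en z.
  rewrite -en mul0n addn0.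
  have -> : upd (upd rho t.+1 0) t (rho t) = rho by regs.
  by apply: ExecWhileF; rewrite nonzeroE // -en.
apply: ExecWhileT; first by rewrite nonzeroE // -en.
  apply: ExecSeq; first exact: exec_nudge.
  apply: ExecSeq; first by apply: exec_xfer => //; rewrite inE.
  by apply: exec_xfer => //; rewrite inE.
set rho' := fun r0 => _.
(* The net effect of one round: [t.+2] has been added to [t] and restored, and [t.+3] is empty
   again. *)
have e t0 : rho' t0 = if t0 == t.+1 then n else
    if t0 == t then (rho t + rho t.+2)%N else rho t0.
  rewrite /rho' /dirs !inE /= !eqxx /=.
  rewrite !(eq_sym t.+3) !(eq_sym t.+2) /=.
  repeat (case: eqP => ? //=; subst => //=); rewrite ?z -?en /=; lia.
clearbody rho'.
have -> : upd (upd rho t.+1 0) t (rho t + rho t.+1 * rho t.+2)%N =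
    upd (upd rho' t.+1 0) t (rho' t + rho' t.+1 * rho' t.+2)%N.
  by apply/funext=> i; rewrite /upd !e -en; regs; rewrite mulSn; lia.
by apply: IH; rewrite !e; regs.
Qed.

(** The invariant behind the recursion is that all scratch registers from [t] on are empty before,
    and all those above [t] after. *)
Lemma exec_ev e t rho C H : vars_below t e -> (t + scratch e <= Rn)%N ->
  (forall r, (t <= r)%N -> rho r = 0%N) ->
  exec (ev e t) (conc rho C H) (conc (upd rho t (nval rho e)) C H).
Proof.
elim: e t rho => [r|c|e1 IH1 e2 IH2|e1 IH1 e2 IH2|e1 IH1 e2 IH2] t rho /=.
- move=> rt le z; have zt := z t (leqnn _); have zt1 := z t.+1 (leqnSn _).
  apply: ExecSeq; first by apply: exec_xfer; [lia|rewrite inE].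
  set rho' := fun i => _.
  have -> : upd rho t (rho r) =
      fun i => shift_head (dirs [:: r] [:: t.+1] i) (rho' t.+1) (rho' i).
    by rewrite /rho'; regs.
  by apply: exec_xfer; [lia|rewrite inE].
- move=> _ le z; have {2}-> : c = (rho t + c)%N by rewrite z.
  exact: exec_const.
- move=> /andP[v1 v2] le z; apply: ExecSeq; first by apply: IH1 => //; lia.
  have z' r : (t < r)%N -> upd rho t (nval rho e1) r = 0%N.
    by move=> h; have := z r (ltnW h); regs.
  apply: ExecSeq.
    by apply: IH2 => //; [exact: vars_below_leq v2|lia].
  rewrite -[nval _ e2](@nval_ext t rho _) // => [|r rt]; last by regs.
  set rho' := upd (upd _ _ _) _ _.
  have -> : upd rho t (nval rho e1 + nval rho e2)%N =
      fun i => shift_head (dirs [:: t] [:: t.+1] i) (rho' t.+1) (rho' i).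
    by have z1 := z t.+1 (leqnSn _); rewrite /rho'; regs.
  by apply: exec_xfer; [lia|rewrite inE].
- move=> /andP[v1 v2] le z; apply: ExecSeq; first by apply: IH1 => //; lia.
  have z' r : (t < r)%N -> upd rho t (nval rho e1) r = 0%N.
    by move=> h; have := z r (ltnW h); regs.
  apply: ExecSeq.
    by apply: IH2 => //; [exact: vars_below_leq v2|lia].
  rewrite -[nval _ e2](@nval_ext t rho _) // => [|r rt]; last by regs.
  set rho' := upd (upd _ _ _) _ _.
  have -> : upd rho t (nval rho e1 - nval rho e2)%N =
      fun i => shift_head (dirs [::] [:: t; t.+1] i) (rho' t.+1) (rho' i).
    by have z1 := z t.+1 (leqnSn _); rewrite /rho'; regs.
  by apply: exec_xfer; [lia|rewrite !inE eqxx orbT].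
- move=> /andP[v1 v2] le z; apply: ExecSeq.
    apply: IH1; [exact: vars_below_leq v1|lia|].
    by move=> r h; apply: z; exact: ltnW.
  apply: ExecSeq.
    apply: IH2; [by apply: vars_below_leq v2; lia|lia|].
    by move=> r h; have := z r (ltnW (ltnW h)); regs.
  rewrite -[nval _ e2](@nval_ext t rho _) // => [|r rt]; last by regs.
  have z0 := z t (leqnn _); have z1 := z t.+1 (leqnSn _).
  have z2 : rho t.+2 = 0%N by apply: z; lia.
  have z3 : rho t.+3 = 0%N by apply: z; lia.
  apply: ExecSeq; first by apply: exec_mul; [lia|regs].
  set rho' := upd (upd _ _ _) _ _.
  have -> : upd rho t (nval rho e1 * nval rho e2)%N =
      fun i => shift_head (dirs [::] [:: t.+2] i) (rho' t.+2) (rho' i).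
    by rewrite /rho'; regs.
  by apply: exec_xfer; [lia|rewrite inE].
Qed.

(** The value is complete in [t] before [r] is cleared, so [e] may mention [r] itself. *)
Definition assign (t r : nat) (e : nexpr) : com :=
  Seq (ev e t) (Seq (xfer [::] [:: r] r) (xfer [:: r] [:: t] t)).

Lemma asks_assign t r e : asks (assign t r e) = 0%N.
Proof. by rewrite /= asks_ev. Qed.

Lemma exec_assign t r e rho C H : (r < t)%N -> vars_below t e ->
  (t + scratch e <= Rn)%N -> (forall r, (t <= r)%N -> rho r = 0%N) ->
  exec (assign t r e) (conc rho C H) (conc (upd rho r (nval rho e)) C H).
Proof.
move=> rt v le z; have s0 : (0 < scratch e)%N by case: (e) => *; rewrite /=; lia.
have z0 := z t (leqnn _).
apply: ExecSeq; first exact: exec_ev.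
apply: ExecSeq; first by apply: exec_xfer; [lia|rewrite inE].
set rho' := fun i => _.
have -> : upd rho r (nval rho e) =
    fun i => shift_head (dirs [:: r] [:: t] i) (rho' t) (rho' i).
  by rewrite /rho'; regs.
by apply: exec_xfer; [lia|rewrite inE].
Qed.

(** * Reading and writing fractions *)

Definition reads (tau : tp) (l : letter) : reading W K -> bool :=
  fun rd => `[< rd tau = Some (inl l) >].

Lemma readsE tau l rho C H w : register tau = None -> C tau = word_tape W w ->
  reads tau l (scan (conc rho C H)) = `[< ohead (drop (H tau) w) = Some l >].
Proof.
move=> tN cw; rewrite /reads /scan /= tN cw /word_tape onth_drop.
by case: ohead => [x|]; apply: asbool_equiv_eq; split=> // -[->].
Qed.

Definition scan_word (r : nat) (tau : tp) (l : letter) : com :=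
  While (reads tau l) (walk (dirs [:: r] [::]) tau GoRight).

Lemma exec_scan_word r tau l n s w rho C H : register tau = None ->
  C tau = word_tape W w -> drop (H tau) w = nseq n l ++ s -> ohead s <> Some l ->
  exec (scan_word r tau l) (conc rho C H)
    (conc (upd rho r (rho r + n)%N) C (tset H tau (H tau + n)%N)).
Proof.
move=> tN cw + hs; elim: n rho H => [|n IH] rho H e.
  rewrite !addn0 tset_id //; have -> : upd rho r (rho r) = rho by regs.
  apply: ExecWhileF; rewrite (readsE _ _ _ tN cw) e /=.
  by case: asboolP.
apply: ExecWhileT (exec_walk _ _ _ _ _ _) _.
  by rewrite (readsE _ _ _ tN cw) e /=; case: asboolP.
set rho' := fun r0 => _.
have := IH rho' (tset H tau (H tau).+1) _.
rewrite tset_tset tset_eq addSnnS; move=> /(_ (drop_cons e)).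
have -> // : upd rho' r (rho' r + n)%N = upd rho r (rho r + n.+1)%N.
by rewrite /rho'; regs.
Qed.

(** The counters are cleared first because, in a search, they still hold the previous answer. The
    two bare [walk] steps skip [Slash] and [Comma]. *)
Definition parse_frac (tau : tp) (r : nat) : com :=
  Seq (xfer [::] [:: r] r) (Seq (xfer [::] [:: r.+1] r.+1)
  (Seq (xfer [::] [:: r.+2] r.+2) (Seq (scan_word r tau Minus)
  (Seq (scan_word r.+1 tau One) (Seq (walk (dirs [::] [::]) tau GoRight)
  (Seq (scan_word r.+2 tau One) (walk (dirs [::] [::]) tau GoRight))))))).

Lemma exec_parse_frac tau r (s : bool) p d w rest rho C H :
  register tau = None -> (r.+2 < Rn)%N -> C tau = word_tape W w ->
  drop (H tau) w = frac_word s p d ++ rest ->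
  exec (parse_frac tau r) (conc rho C H)
    (conc (upd (upd (upd rho r s) r.+1 p) r.+2 d) C
          (tset H tau (H tau + size (frac_word s p d))%N)).
Proof.
move=> tN lt cw e.
do 3![apply: ExecSeq; first by apply: exec_xfer; [lia|rewrite inE]].
set rho1 := fun i => _.
have r1 i : rho1 i = if (i == r) || (i == r.+1) || (i == r.+2) then 0%N else rho i.
  by rewrite /rho1; regs.
clearbody rho1.
have e1 : drop (H tau) w =
    nseq s Minus ++ (nseq p One ++ Slash :: nseq d One ++ [:: Comma] ++ rest).
  by rewrite e /frac_word -!catA /= -!catA.
apply: ExecSeq; first by apply: (exec_scan_word _ _ tN cw e1); case: (p).
have e2 := drop_cat_size e1.
rewrite size_nseq in e2.
apply: ExecSeq; first by apply: (exec_scan_word _ _ tN cw); rewrite ?tset_eq;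
  [exact: e2|].
rewrite tset_tset tset_eq; have e3 := drop_cat_size e2; rewrite size_nseq in e3.
apply: ExecSeq; first exact: exec_walk.
rewrite tset_tset tset_eq /=; have e4 := drop_cons e3.
apply: ExecSeq; first by apply: (exec_scan_word _ _ tN cw); rewrite ?tset_eq;
  [exact: e4|].
rewrite tset_tset tset_eq; set rho2 := upd _ _ _.
have -> : upd (upd (upd rho r s) r.+1 p) r.+2 d =
    fun i => move_head (dirs [::] [::] i) (rho2 i).
  apply/funext=> i; rewrite /rho2 /upd !r1 /dirs !inE /= !eqxx /= !orbT.
  by repeat (case: eqP => ? //=; subst => //=); lia.
have -> : tset H tau (H tau + size (frac_word s p d))%N =
    tset (tset H tau (H tau + s + p).+1) tau (H tau + s + p + d).+2.
  rewrite tset_tset; congr tset.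
  by rewrite /frac_word !size_cat /= !size_cat !size_nseq /=; lia.
have := exec_walk (dirs [::] [::]) tau GoRight rho2 C
   (tset H tau ((H tau + s + p).+1 + d)%N).
by rewrite !tset_tset tset_eq /= addSn.
Qed.

Fixpoint parse_fracs (tau : tp) (r m : nat) : com :=
  if m is m'.+1 then Seq (parse_frac tau r) (parse_fracs tau r.+3 m') else skip.

Lemma asks_parse_fracs tau r m : asks (parse_fracs tau r m) = 0%N.
Proof. by elim: m r => //= m IH r; rewrite IH. Qed.

Lemma exec_parse_fracs tau r l w rest rho C H : register tau = None ->
  (r + 3 * size l <= Rn)%N -> C tau = word_tape W w ->
  drop (H tau) w = frac_words l ++ rest ->
  exec (parse_fracs tau r (size l)) (conc rho C H)
    (conc (load r l rho) C (tset H tau (H tau + size (frac_words l))%N)).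
Proof.
move=> tN + cw; elim: l r rho H => [|x l IH] r rho H lt e.
  by rewrite addn0 tset_id //; exact: exec_skip.
rewrite /frac_words /= -catA in e; rewrite /= in lt.
apply: ExecSeq; first by apply: (exec_parse_frac _ tN _ cw e); lia.
have := IH r.+3 _ (tset H tau (H tau + size (frac_word x.1.1 x.1.2 x.2))%N).
rewrite tset_tset tset_eq /= /frac_words /= size_cat addnA; apply; first lia.
by rewrite (drop_cat_size e).
Qed.

Definition emit (r : nat) (tau : tp) (l : letter) : com :=
  While (nonzero r) (write (dirs [::] [:: r]) tau (Some (inl l)) GoRight).

Lemma word_tape_rcons w l : (fun p => if p == size w then Some (inl l) else
  word_tape W w p) = word_tape W (rcons w l).
Proof.
apply/funext=> p; rewrite /word_tape.
elim: w p => [|x w IH] [|p] //=; first by case: p.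
by rewrite -IH.
Qed.

Lemma exec_write_word g tau l rho C H w : 
  exec (write g tau (Some (inl l)) GoRight)
    (conc rho (tset C tau (word_tape W w)) (tset H tau (size w)))
    (conc (fun r => move_head (g r) (rho r))
      (tset C tau (word_tape W (rcons w l))) (tset H tau (size (rcons w l)))).
Proof.
have := exec_write g tau (Some (inl l)) GoRight rho (tset C tau (word_tape W w))
  (tset H tau (size w)).
by rewrite !tset_tset !tset_eq size_rcons word_tape_rcons.
Qed.

Lemma exec_emit r tau l rho C H w : (r < Rn)%N ->
  exec (emit r tau l)
    (conc rho (tset C tau (word_tape W w)) (tset H tau (size w)))
    (conc (upd rho r 0) (tset C tau (word_tape W (w ++ nseq (rho r) l)))
          (tset H tau (size (w ++ nseq (rho r) l)))).
Proof.
move=> lt; have [n en] : exists n, n = rho r by exists (rho r).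
elim: n rho w en => [|n IH] rho w en; rewrite -en.
  have -> : upd rho r 0 = rho by regs.
  by rewrite cats0; apply: ExecWhileF; rewrite nonzeroE // -en.
apply: ExecWhileT; [by rewrite nonzeroE // -en|exact: exec_write_word|].
set rho' := fun r0 => _.
have e' : n = rho' r by rewrite /rho' /dirs /= inE eqxx -en.
have := IH _ (rcons w l) e'; rewrite -e' cat_rcons /=.
have -> // : upd rho' r 0 = upd rho r 0 by rewrite /rho'; regs.
Qed.

(** The first value assigned is the sign bit, 1 exactly if [p < n]. One register serves for all
    three parts, since [emit] empties it. *)
Definition emit_frac (r : nat) (x : rexpr) : com :=
  let out := inl Output in
  let: RExpr p n d := x in
  Seq (assign r.+1 r (NSub (NConst 1) (NSub (NConst 1) (NSub n p))))
  (Seq (emit r out Minus)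
  (Seq (assign r.+1 r (NAdd (NSub p n) (NSub n p)))
  (Seq (emit r out One)
  (Seq (write (dirs [::] [::]) out (Some (inl Slash)) GoRight)
  (Seq (assign r.+1 r d)
  (Seq (emit r out One)
       (write (dirs [::] [::]) out (Some (inl Comma)) GoRight))))))).

Lemma asks_emit_frac r x : asks (emit_frac r x) = 0%N.
Proof. by case: x => p n d; rewrite /= !asks_ev. Qed.

Lemma move_stay rho : (fun r => move_head (dirs [::] [::] r) (rho r)) = rho.
Proof. by regs. Qed.

Lemma exec_emit_frac r x rho C H w (f := rfrac rho x) (tau := inl Output : tp)
  (w' := w ++ frac_word f.1.1 f.1.2 f.2) :
  rvars r x -> (r.+1 + rscratch x <= Rn)%N ->
  (forall i, (r <= i)%N -> rho i = 0%N) ->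
  exec (emit_frac r x)
    (conc rho (tset C tau (word_tape W w)) (tset H tau (size w)))
    (conc rho (tset C tau (word_tape W w')) (tset H tau (size w'))).
Proof.
rewrite {}/w' {}/f; case: x => p n d /and3P /= [vp vn vd].
rewrite /rscratch /= => le z.
have vS := vars_below_leq (leqnSn r).
have z1 v i : (r.+1 <= i)%N -> upd rho r v i = 0%N.
  by move=> h; have := z i (ltnW h); regs.
have nv e : vars_below r e -> forall v, nval (upd rho r v) e = nval rho e.
  by move=> ve v; apply: (nval_ext ve) => i ir; regs.
have uu v v' : upd (upd rho r v) r v' = upd rho r v' by regs.
have u0 : upd rho r 0 = rho by have z0 := z r (leqnn _); regs.
apply: ExecSeq; first by apply: exec_assign => //=; rewrite ?vS //=; [lia|];
  move=> i h; apply: z; exact: ltnW.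
apply: ExecSeq; first by apply: exec_emit; lia.
rewrite uu u0 /=.
apply: ExecSeq; first by apply: exec_assign => //=; rewrite ?vS //=; [lia|];
  move=> i h; apply: z; exact: ltnW.
apply: ExecSeq; first by apply: exec_emit; lia.
rewrite uu u0 /=.
apply: ExecSeq; first exact: exec_write_word.
rewrite move_stay.
apply: ExecSeq; first by apply: exec_assign => //=; rewrite ?vS //=; [lia|];
  move=> i h; apply: z; exact: ltnW.
apply: ExecSeq; first by apply: exec_emit; lia.
rewrite uu u0 /=.
set P := nval rho p; set N := nval rho n; set D := nval rho d.
set w1 := (w1 in word_tape W w1); set w2 := (w2 in conc _ _ (tset H tau (size w2))).
have ew : w2 = rcons w1 Comma.
  have e0 : (1 - (1 - (N - P)))%N = (P < N)%N by lia.
  by rewrite /w1 /w2 /frac_word /upd !eqxx -!cats1 -!catA /= ?e0.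
have := exec_write_word (dirs [::] [::]) tau Comma rho C H w1.
by rewrite move_stay -ew.
Qed.

Fixpoint emit_fracs (r : nat) (xs : seq rexpr) : com :=
  if xs is x :: xs' then Seq (emit_frac r x) (emit_fracs r xs') else skip.

Lemma asks_emit_fracs r xs : asks (emit_fracs r xs) = 0%N.
Proof. by elim: xs => //= x xs IH; rewrite asks_emit_frac IH. Qed.

Lemma exec_emit_fracs r xs rho C H w (tau := inl Output : tp)
  (w' := w ++ frac_words (map (rfrac rho) xs)) :
  all (rvars r) xs -> all (fun x => r.+1 + rscratch x <= Rn)%N xs ->
  (forall i, (r <= i)%N -> rho i = 0%N) ->
  exec (emit_fracs r xs)
    (conc rho (tset C tau (word_tape W w)) (tset H tau (size w)))
    (conc rho (tset C tau (word_tape W w')) (tset H tau (size w'))).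
Proof.
rewrite {}/w' => + + z; elim: xs w => [|x xs IH] w /=.
  by rewrite cats0 => _ _; exact: exec_skip.
move=> /andP[vx vs] /andP[lx ls]; apply: ExecSeq.
  exact: exec_emit_frac.
by rewrite /frac_words /= catA; exact: IH.
Qed.

(** Work tapes start blank; a single transition marks all counters while every head is still on cell
    0. *)
Definition mark_registers : action W K :=
  fun rd i => (if register i is Some _ then marker else rd i, Stay).

Definition blank_cells (inp : seq letter) : tp -> nat -> sym :=
  fun i => if i is inl Input then word_tape W inp else fun=> None.

Lemma exec_mark_registers inp : exec (Act mark_registers)
  (init_memory W K inp) (conc (fun=> 0%N) (blank_cells inp) (fun=> 0%N)).
Proof.
set m' := conc _ _ _.
have -> : m' = perform mark_registers (init_memory W K inp).
  apply: mem_eq => [i p|i] /=; last by case: register.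
  rewrite /mark_registers /scan /=; case E: (register i) => //=.
    by case: p => //=; case: i E => [[]|].
  by case: p => [|p] //=; case: i E => [[]|].
exact: ExecAct.
Qed.

Definition pow_loop (r q t : nat) : com :=
  While (nonzero r) (Seq (nudge (dirs [::] [:: r]))
                         (assign t q (NAdd (NVar q) (NVar q)))).

Lemma exec_pow_loop r q t rho C H : r <> q -> (r < t)%N -> (q < t)%N ->
  (t + 8 <= Rn)%N -> (forall i, (t <= i)%N -> rho i = 0%N) ->
  exec (pow_loop r q t) (conc rho C H)
    (conc (upd (upd rho r 0) q (rho q * 2 ^ rho r)%N) C H).
Proof.
move=> rq rt qt tR; have [n en] : exists n, n = rho r by exists (rho r).
have rR : (r < Rn)%N by lia.
elim: n rho en => [|n IH] rho en z.
  rewrite -en muln1; have -> : upd (upd rho r 0) q (rho q) = rho by regs.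
  by apply: ExecWhileF; rewrite nonzeroE // -en.
apply: ExecWhileT; first by rewrite nonzeroE // -en.
  apply: ExecSeq; first exact: exec_nudge.
  apply: exec_assign => //=; rewrite ?qt //.
  by move=> i h; have := z i h; regs.
set rho' := upd _ _ _.
have e i : rho' i = if i == q then (rho q + rho q)%N else
    if i == r then n else rho i.
  have qr : (q == r) = false by apply/eqP => /esym.
  rewrite /rho' /upd /dirs !inE /= !inE qr /=.
  by repeat (case: eqP => ? //=; subst => //=); lia.
clearbody rho'.
have -> : upd (upd rho r 0) q (rho q * 2 ^ rho r)%N =
    upd (upd rho' r 0) q (rho' q * 2 ^ rho' r)%N.
  have rq' : (r == q) = false by apply/eqP.
  apply/funext=> i; rewrite /upd !e !eqxx rq' -en expnS.
  case: (i =P q) => _; first by rewrite mulnA muln2 addnn.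
  by case: eqP.
apply: IH; first by rewrite e eqxx; case: eqP.
move=> i h; rewrite e; case: eqP => [|_]; first lia.
by case: eqP => [|_]; [lia|exact: z].
Qed.

Lemma exec_ask rho C H k : exec Ask
  (conc rho (tset C (inl Query) (word_tape W (nseq k One))) H)
  (conc rho (tset (tset C (inl Query) (word_tape W (nseq k One)))
              (inl Answer) (word_tape W (O k))) (tset H (inl Answer) 0%N)).
Proof.
set m := conc _ _ H; set m' := conc _ _ _.
have -> : m' = put_answer (O k) m.
  apply: mem_eq => [i p|i] /=; case: i => [[]|i] //=;
  first [by rewrite tset_eq | by rewrite tset_neq
        | by case: ifP => // _; rewrite tset_neq].
by apply: ExecAsk => p /=; rewrite tset_eq.
Qed.

(** * Unbounded search over the precision of the oracle *)

Section Search.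
Variables (m : nat) (test : nexpr) (outs : seq rexpr).
Let r := (4 + 3 * m)%N.
Hypotheses (test_vars : vars_below r test) (outs_vars : all (rvars r) outs).
Hypotheses (test_room : (r.+1 + scratch test + 20 <= Rn)%N)
  (outs_room : all (fun x => r.+1 + rscratch x <= Rn)%N outs).

(* Register 0 counts the input, 1 holds 2^j, 2 holds 2^k, 3 is the loop flag and
   the k-th oracle answer is read into the registers from 4 on. *)
Definition search_body : com :=
  Seq (xfer [::] [:: 3] 3)
  (Seq (assign r.+1 2 (NAdd (NVar 2) (NVar 2)))
  (Seq (write (dirs [::] [::]) (inl Query) (Some (inl One)) GoRight)
  (Seq Ask
  (Seq (parse_fracs (inl Answer) 4 m)
       (assign r.+1 3 (NSub (NConst 1) test)))))).

Definition search : com :=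
  Seq (Act mark_registers)
  (Seq (scan_word 0 (inl Input) One)
  (Seq (assign r.+1 1 (NConst 1))
  (Seq (pow_loop 0 1 r.+1)
  (Seq (assign r.+1 2 (NConst 1))
  (Seq (nudge (dirs [:: 3] [::]))
  (Seq (While (nonzero 3) search_body)
       (emit_fracs r outs))))))).

Lemma asks_search : asks search = 1%N.
Proof. by rewrite /= !asks_ev asks_parse_fracs asks_emit_fracs. Qed.

Variable l : nat -> seq frac.
Hypotheses (size_l : forall k, size (l k) = m)
  (O_l : forall k, O k = frac_words (l k)).

(** The answer tape is left arbitrary, because the next query overwrites both its content and its
    head position. The query head rests at the end of the numeral, ready to lengthen it by one
    letter. *)
Definition asked (C : tp -> nat -> sym) k a : tp -> nat -> sym :=
  tset (tset C (inl Answer) a) (inl Query) (word_tape W (nseq k One)).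
Definition asked_head (H : tp -> nat) k b : tp -> nat :=
  tset (tset H (inl Answer) b) (inl Query) (size (nseq k One)).

Lemma exec_search_body j k rho C H a b :
  [/\ rho 0%N = 0%N, rho 1%N = (2 ^ j)%N & rho 2%N = (2 ^ k)%N] ->
  (forall i, (r <= i)%N -> rho i = 0%N) -> exists a' b', exec search_body
    (conc rho (asked C k a) (asked_head H k b))
    (conc (upd (env j k.+1 (l k.+1)) 3 (1 - nval (env j k.+1 (l k.+1)) test))
          (asked C k.+1 a') (asked_head H k.+1 b')).
Proof.
move=> [e0 e1 e2] z; have r3 : (3 < r)%N by rewrite /r; lia.
set w := O k.+1; exists (word_tape W w), (size (frac_words (l k.+1))).
apply: ExecSeq; first by apply: exec_xfer; [lia|rewrite inE].
set rho1 := fun i => _.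
have e i : rho1 i = if i == 3 then 0%N else rho i by rewrite /rho1; regs.
clearbody rho1; apply: ExecSeq.
  apply: exec_assign => /=; [lia|lia|lia|].
  by move=> i h; rewrite e; have := z i (ltnW h); case: eqP => //; lia.
apply: ExecSeq; first exact: exec_write_word.
rewrite move_stay.
have en : rcons (nseq k One) One = nseq k.+1 One.
  by elim: (k) => //= k' ->.
rewrite en; apply: ExecSeq; first exact: exec_ask.
rewrite -/w.
apply: ExecSeq.
  rewrite -(size_l k.+1); apply: (@exec_parse_fracs _ _ _ w [::]) => //.
  - by rewrite size_l; lia.
  - by rewrite tset_eq.
  - by rewrite tset_eq drop0 cats0 /w O_l.
rewrite tset_eq add0n tset_tset.
set rho2 := load 4 _ _.
have <- : rho2 = env j k.+1 (l k.+1).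
  apply: load_ext => i; rewrite size_l -/r => h.
  rewrite /upd /= !e /= e2 expnS; case: (i =P 2) => [|n2]; first lia.
  case: (i =P 1) => [->|n1]; first by rewrite e1.
  case: (i =P 3) => // n3; case: (i =P 0%N) => [->|] //.
  by move=> n0; apply: z; lia.
have tsetQA (T : Type) (F : tp -> T) v v1 v2 :
    tset (tset (tset F (inl Answer) v) (inl Query) v1) (inl Answer) v2 =
    tset (tset F (inl Answer) v2) (inl Query) v1.
  by rewrite tset_comm // tset_tset.
rewrite !tsetQA -/(asked C k.+1 _) -/(asked_head H k.+1 _).
apply: exec_assign; first lia.
- by rewrite /=; apply: vars_below_leq test_vars.
- by rewrite /=; lia.
move=> i h; rewrite /rho2 load_out ?size_l; last by rewrite -/r; lia.
rewrite /upd e; case: eqP => [|_]; first lia.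
by case: eqP => [|_]; [lia|apply: z; lia].
Qed.

Lemma env_out j k l' i : (size l' = m)%N -> (i == 0) || (i == 3) || (r <= i)%N ->
  env j k l' i = 0%N.
Proof.
move=> sl h; rewrite /env load_out; last by rewrite sl -/r; lia.
by rewrite /upd !ifN //; apply/eqP; move: h; rewrite /r; lia.
Qed.

Lemma exec_search_loop j d k rho C H a b :
  [/\ rho 0%N = 0%N, rho 1%N = (2 ^ j)%N, rho 2%N = (2 ^ k)%N & rho 3%N = 1%N] ->
  (forall i, (r <= i)%N -> rho i = 0%N) ->
  (forall k', (k < k' <= k + d)%N -> nval (env j k' (l k')) test = 0%N) ->
  nval (env j (k + d.+1) (l (k + d.+1)%N)) test <> 0%N ->
  exists a' b', exec (While (nonzero 3) search_body)
    (conc rho (asked C k a) (asked_head H k b))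
    (conc (env j (k + d.+1) (l (k + d.+1)%N)) (asked C (k + d.+1) a')
          (asked_head H (k + d.+1) b')).
Proof.
have r3 : (3 < r)%N by rewrite /r; lia.
elim: d k rho a b => [|d IH] k rho a b [e0 e1 e2 e3] z t0 t1;
  have [a1 [b1 ex]] := @exec_search_body j k rho C H a b (And3 e0 e1 e2) z.
  exists a1, b1; apply: (ExecWhileT _ ex); first by rewrite nonzeroE ?e3; lia.
  rewrite addn1 in t1 *; set rho1 := upd _ _ _.
  have -> : rho1 = env j k.+1 (l k.+1).
    rewrite /rho1; apply/funext=> i; rewrite /upd; case: eqP => // ->.
    by rewrite env_out //; lia.
  by apply: ExecWhileF; rewrite nonzeroE ?env_out //; lia.
have tk := t0 k.+1 _; rewrite tk in ex; last by lia.
have [h1 h2] := env12 j k.+1 (l k.+1).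
have [|i h|k' h||a2 [b2 ex2]] := IH k.+1 (upd (env j k.+1 (l k.+1)) 3 1) a1 b1.
- by rewrite /upd /= h1 h2 env_out.
- by rewrite /upd; case: eqP => [|_]; [lia|rewrite env_out // h orbT].
- by apply: t0; lia.
- by rewrite addSnnS.
rewrite addSnnS in ex2; exists a2, b2; apply: (ExecWhileT _ ex) ex2.
by rewrite nonzeroE ?e3; lia.
Qed.

(** The body raises the precision before it asks, so precision 0 is never tested; this is the reason
    for [0 < k]. The loop stops at the least successful positive [k]. *)
Lemma search_runs j : (exists2 k, (0 < k)%N & nval (env j k (l k)) test <> 0%N) ->
  exists k, [/\ (0 < k)%N, nval (env j k (l k)) test <> 0%N
    & runs (code_machine (compile 0 search)) O (nseq j One)
        (frac_words (map (rfrac (env j k (l k))) outs))].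
Proof.
move=> [k0 k0_gt0 tk0].
pose p k := (0 < k)%N && (nval (env j k (l k)) test != 0%N).
have ep : exists k, p k by exists k0; rewrite /p k0_gt0; apply/eqP.
case: (ex_minnP ep) => K0 /andP[K_gt0 /eqP tK] Kmin.
exists K0; split=> //; have r3 : (3 < r)%N by rewrite /r; lia.
set C0 := blank_cells (nseq j One).
(* The registers on entering the loop: [2 ^ j], [2 ^ 0], and the flag raised. *)
set rho1 : nat -> nat := upd (upd (upd (fun=> 0%N) 1 (2 ^ j)) 2 1) 3 1.
have [|i h|k' h||a [b ex]] := @exec_search_loop j K0.-1 0 rho1 C0
    (tset (fun=> 0%N) (inl Input) j) (fun=> None) 0%N.
- by rewrite /rho1 /upd.
- by rewrite /rho1; regs.
- apply/eqP; rewrite -[_ == _]negbK; apply/negP => h2.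
  by have := Kmin k'; rewrite /p h2; lia.
- by rewrite add0n prednK.
rewrite add0n prednK // in ex.
set f := frac_words _.
(* A blank output tape is the tape of the empty word, the form needed to start emitting. *)
have C0o T : asked C0 K0 T = tset (asked C0 K0 T) (inl Output) (word_tape W [::]).
  rewrite tset_id // /asked !tset_neq //.
  by apply/funext=> -[].
have H0o h : asked_head (tset (fun=> 0%N) (inl Input) j) K0 h =
   tset (asked_head (tset (fun=> 0%N) (inl Input) j) K0 h) (inl Output)
     (size ([::] : seq letter)).
  by rewrite [RHS]tset_id // /asked_head !tset_neq.
have exo := @exec_emit_fracs r outs (env j K0 (l K0)) (asked C0 K0 a)
  (asked_head (tset (fun=> 0%N) (inl Input) j) K0 b) [::] outs_vars outs_room _.
rewrite -C0o -H0o /= in exo.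
apply: (@exec_runs _ _ _ _ _ f); first by rewrite asks_search.
  apply: ExecSeq; first exact: exec_mark_registers.
  apply: ExecSeq.
    apply: (@exec_scan_word _ _ _ j [::] (nseq j One)) => //.
    by rewrite drop0 cats0.
  rewrite add0n; set rho2 := upd _ _ _.
  have z2 i : (0 < i)%N -> rho2 i = 0%N by rewrite /rho2; regs.
  apply: ExecSeq.
    by apply: exec_assign => /=; [lia|lia|lia|move=> i h; apply: z2; lia].
  apply: ExecSeq.
    apply: exec_pow_loop; [lia|lia|lia|lia|].
    move=> i h; have i1 : (i == 1%N) = false by lia.
    by rewrite /upd i1 z2 //; lia.
  apply: ExecSeq.
    apply: exec_assign => /=; [lia|lia|lia|].
    move=> i h; have i1 : (i == 1%N) = false by lia.
    have i0 : (i == 0%N) = false by lia.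
    by rewrite /upd i0 i1 z2 //; lia.
  apply: ExecSeq; first exact: exec_nudge.
  apply: ExecSeq.
    have C0Q : C0 (inl Query) = word_tape W (nseq 0 One).
      by apply/funext=> -[].
    have H0A : asked_head (tset (fun=> 0%N) (inl Input) j) 0 0 =
        tset (fun=> 0%N) (inl Input) j.
      rewrite /asked_head [X in tset X _ _]tset_id ?tset_neq //.
      by rewrite [LHS]tset_id ?tset_neq.
    set M1 := conc _ _ _.
    have -> : M1 = conc rho1 (asked C0 0 (fun=> None))
        (asked_head (tset (fun=> 0%N) (inl Input) j) 0 0).
      have -> : asked C0 0 (fun=> None) = C0 by rewrite /asked !tset_id.
      rewrite H0A /M1.
      congr conc; apply/funext=> i; rewrite /rho1 /rho2 /upd /dirs !inE /=.
      by repeat (case: eqP => ? //=; subst => //=); rewrite ?mul1n.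
    exact: ex.
  by apply: exo => i h; rewrite env_out // h orbT.
by move=> p0 /=; rewrite tset_eq.
Qed.

End Search.

(** Cell 0 of an ordinary tape carries no mark, so a counter has to remember how far the head must
    go back. *)
Definition rewind (r : nat) (tau : tp) : com :=
  While (nonzero r) (walk (dirs [::] [:: r]) tau GoLeft).

Lemma exec_rewind r tau rho C H : (r < Rn)%N -> exec (rewind r tau)
  (conc rho C H) (conc (upd rho r 0) C (tset H tau (H tau - rho r)%N)).
Proof.
move=> lt; have [n en] : exists n, n = rho r by exists (rho r).
elim: n rho H en => [|n IH] rho H en; rewrite -en.
  have -> : upd rho r 0 = rho by regs.
  by rewrite subn0 tset_id //; apply: ExecWhileF; rewrite nonzeroE // -en.
apply: ExecWhileT; [by rewrite nonzeroE // -en|exact: exec_walk|].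
set rho' := fun r0 => _.
have e' : n = rho' r by rewrite /rho' /dirs /= inE eqxx -en.
have := IH _ (tset H tau (H tau).-1) e'; rewrite -e' tset_tset tset_eq.
have -> : upd rho' r 0 = upd rho r 0 by rewrite /rho'; regs.
by have -> : ((H tau).-1 - n = H tau - n.+1)%N by lia.
Qed.

Definition erase (r : nat) (tau : tp) : com :=
  Seq (While (fun rd => ~~ `[< rd tau = None >])
         (write (dirs [:: r] [::]) tau None GoRight))
      (rewind r tau).

Lemma exec_erase r tau w rho C H : (r < Rn)%N -> register tau = None ->
  rho r = 0%N -> C tau = word_tape W w -> H tau = 0%N ->
  exec (erase r tau) (conc rho C H) (conc rho (tset C tau (fun=> None)) H).
Proof.
move=> lt tN r0 cw h0.
(* Generalized to a word whose first [h] cells are already blank, with [n] letters left. *)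
suff ex n : forall h rho C H, (h + n = size w)%N -> rho r = h -> H tau = h ->
    C tau = (fun p => if (p < h)%N then None else word_tape W w p) ->
    exec (While (fun rd => ~~ `[< rd tau = None >])
         (write (dirs [:: r] [::]) tau None GoRight)) (conc rho C H)
      (conc (upd rho r (size w)) (tset C tau (fun=> None))
            (tset H tau (size w))).
  apply: ExecSeq; first by apply: (ex (size w) 0%N).
  have := exec_rewind tau (upd rho r (size w)) (tset C tau (fun=> None))
    (tset H tau (size w)) lt.
  rewrite tset_tset tset_eq /upd eqxx subnn.
  have -> : (fun i => if i == r then 0%N else if i == r then size w else rho i)
     = rho by regs.
  by rewrite (tset_id h0).
elim: n => [|n IH] h {}rho {}C {}H eh {}r0 {}h0 {}cw.
  rewrite addn0 in eh; rewrite -eh.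
  have -> : upd rho r h = rho by regs.
  have cN : C tau = fun=> None.
    rewrite cw; apply/funext=> p; case: ltnP => // hp.
    by rewrite /word_tape onth_drop drop_oversize // -eh.
  rewrite (tset_id cN) (tset_id h0).
  by apply: ExecWhileF; rewrite /scan /= tN cN negbK; apply/asboolP.
have sc : scan (conc rho C H) tau <> None.
  rewrite /scan /= tN cw h0 ltnn /word_tape onth_drop.
  by case E: (drop h w) => //; have := size_drop h w; rewrite E /=; lia.
apply: (ExecWhileT _ (exec_write _ _ _ _ _ _ _)); first by case: asboolP.
rewrite h0; set rho' := (rho' in conc rho' _ _).
set C' := (C' in conc _ C' _); set H' := (H' in conc _ _ H').
have e1 : rho' r = h.+1 by rewrite /rho' /dirs !inE eqxx /= r0.
have e2 : H' tau = h.+1 by rewrite /H' tset_eq.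
have e3 : C' tau = (fun p => if (p < h.+1)%N then None else word_tape W w p).
  rewrite /C' tset_eq cw; apply/funext=> p; rewrite ltnS.
  by case: ltngtP.
have := IH h.+1 rho' C' H' _ e1 e2 e3; rewrite addSnnS => /(_ eh).
rewrite /C' /H' !tset_tset.
by have -> : upd rho' r (size w) = upd rho r (size w) by rewrite /rho'; regs.
Qed.

End Counters.

Arguments marker {W}.
Arguments nudge {W K}.
Arguments skip {W K}.
Arguments nonzero {W K}.
Arguments xfer {W K}.
Arguments ev {W K}.
Arguments assign {W K}.
Arguments scan_word {W K}.
Arguments walk {W K}.
Arguments parse_frac {W K}.
Arguments parse_fracs {W K}.
Arguments emit {W K}.
Arguments emit_frac {W K}.
Arguments emit_fracs {W K}.
Arguments pow_loop {W K}.
Arguments rewind {W K}.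
Arguments erase {W K}.

(** * Simulating a machine *)

Section Simulation.
Variables (M : machine) (Rn : nat) (O : nat -> seq letter).
Variables (erased out_pos : nat).

Let mt := work_tapes M.
Definition sim_tapes : nat := (Rn + 3 + work_tapes M)%N.
Definition sim_letter : finType := (work_letter M + state M)%type.
Local Notation K := sim_tapes.
Local Notation W := sim_letter.

Lemma Rn_sim : (Rn <= K)%N. Proof. by rewrite /K; lia. Qed.

Definition sim_ord (d : nat) (h : (d < 3 + mt)%N) : 'I_K.
Proof. by refine (@Ordinal _ (Rn + d) _); rewrite /sim_tapes; lia. Defined.

Lemma work_lt (j : 'I_mt) : (3 + j < 3 + mt)%N.
Proof. by rewrite ltn_add2l. Qed.

(* The simulated machine runs on the real query and answer tapes; its other
   tapes, and its state, are kept on work tapes of the simulating machine. *)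
Definition sim_input : tape K := inr (@sim_ord 0 isT).
Definition sim_output : tape K := inr (@sim_ord 1 isT).
Definition sim_state : tape K := inr (@sim_ord 2 isT).

Definition host (t : tape mt) : tape K :=
  match t with
  | inl Input => sim_input
  | inl Output => sim_output
  | inl Query => inl Query
  | inl Answer => inl Answer
  | inr j => inr (sim_ord (work_lt j))
  end.

(** A partial inverse of [host]: the counters, the state tape and the real input and output tapes
    have no guest. *)
Definition guest (i : tape K) : option (tape mt) :=
  match i with
  | inl Query => Some (inl Query)
  | inl Answer => Some (inl Answer)
  | inl _ => None
  | inr j =>
      if (j == Rn :> nat) then Some (inl Input)
      else if (j == Rn.+1 :> nat) then Some (inl Output)
      else if (Rn + 3 <= j)%N then omap inr (insub (j - (Rn + 3))%N) else None
  end.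

Lemma host_guest t : guest (host t) = Some t.
Proof.
case: t => [[]|j] //=.
- by rewrite addn0 eqxx.
- by rewrite addn1 ifN ?eqxx //; lia.
- rewrite ifN; last by lia.
  rewrite ifN; last by lia.
  have -> : (Rn + 3 <= Rn + (3 + j))%N by lia.
  have -> : (Rn + (3 + j) - (Rn + 3) = j)%N by lia.
  by rewrite valK.
Qed.

Lemma guest_host i t : guest i = Some t -> host t = i.
Proof.
case: i => [[]|j] //=; [by case=> <-|by case=> <-|].
case: eqP => [e [<-]|_]; first by congr inr; apply: val_inj; rewrite /= e; lia.
case: eqP => [e [<-]|_]; first by congr inr; apply: val_inj; rewrite /= e; lia.
case: ifP => // h; case: insubP => //= k _ ek [<-].
by congr inr; apply: val_inj; rewrite /= ek; lia.
Qed.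

Lemma guest_state : guest sim_state = None.
Proof. by rewrite /= !ifN //; lia. Qed.

Lemma host_register t : register Rn (host t) = None.
Proof. by case: t => [[]|j] //=; rewrite ifN //; lia. Qed.

Lemma state_register : register Rn sim_state = None.
Proof. by rewrite /= ifN //; lia. Qed.

Definition up (s : symbol (work_letter M)) : symbol W :=
  match s with
  | None => None
  | Some (inl l) => Some (inl l)
  | Some (inr w) => Some (inr (inl w))
  end.

Definition down (s : symbol W) : symbol (work_letter M) :=
  match s with
  | Some (inl l) => Some (inl l)
  | Some (inr (inl w)) => Some (inr w)
  | _ => None
  end.

Lemma upK : cancel up down.
Proof. by case=> [[]|]. Qed.

Lemma up_word w p : up (word_tape _ w p) = word_tape _ w p.
Proof. by rewrite /word_tape; case: onth. Qed.

Definition state_symbol (q : state M) : symbol W := Some (inr (inr q)).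

Section Host.
Variables (rho0 : nat -> nat) (C0 : tape K -> nat -> symbol W)
  (H0 : tape K -> nat).

Definition host_cell (c : config M) : tape K -> nat -> symbol W :=
  fun i => if guest i is Some t then fun p => up (cell c t p)
    else if `[< i = sim_state >] then
      fun p => if p == 0%N then state_symbol (cur c) else None
    else C0 i.

Definition host_head (c : config M) : tape K -> nat :=
  fun i => if guest i is Some t then Defs.head c t
    else if `[< i = sim_state >] then 0%N else H0 i.

Definition host_memory (c : config M) : memory W K :=
  conc Rn (upd rho0 out_pos (Defs.head c (inl Output))) (host_cell c) (host_head c).

Lemma scan_host c t : scan (host_memory c) (host t) = up (cell c t (Defs.head c t)).
Proof.
by rewrite /scan /= host_register /host_cell /host_head host_guest.
Qed.

Lemma scan_host_state c : scan (host_memory c) sim_state = state_symbol (cur c).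
Proof.
rewrite /scan /host_memory /conc /mcell /mhead state_register.
by rewrite /host_cell /host_head guest_state; case: asboolP.
Qed.

(** The state is read from its tape like any other symbol, so one transition of [M] is a function of
    the symbols under the heads, hence a single action. *)
Definition sim_delta (rd : reading W K) :=
  if rd sim_state is Some (inr (inr q)) then
    Some (delta q (fun t => down (rd (host t))))
  else None.

Definition sim_action : action W K := fun rd i =>
  if sim_delta rd is Some d then
    if guest i is Some t then (up (d.2 t).1, (d.2 t).2)
    else if `[< i = sim_state >] then (state_symbol d.1, Stay) else (rd i, Stay)
  else (rd i, Stay).

(** The register [out_pos] follows the simulated output head, so that the output can be rewound
    after the simulation. *)
Definition sim_bump (rd : reading W K) (r : nat) : direction :=
  if sim_delta rd is Some d then
    if r == out_pos then (d.2 (inl Output)).2 else Stay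
  else Stay.

Definition sim_step : com W K := Act (go Rn sim_bump sim_action).

Lemma sim_deltaE c : sim_delta (scan (host_memory c)) =
  Some (delta (cur c) (fun t => cell c t (Defs.head c t))).
Proof.
have e : (fun t => down (scan (host_memory c) (host t))) =
    (fun t => cell c t (Defs.head c t)).
  by apply/funext=> t; rewrite scan_host upK.
by rewrite /sim_delta scan_host_state e.
Qed.

Lemma exec_sim_step c : exec O sim_step (host_memory c)
  (host_memory (ordinary_step c)).
Proof.
have := exec_go Rn O sim_bump sim_action (upd rho0 out_pos (Defs.head c (inl Output)))
  (host_cell c) (host_head c).
set rd := scan _; have dE : sim_delta rd = _ := sim_deltaE c.
have rdE i : register Rn i = None -> guest i = None -> i <> sim_state ->
    rd i = C0 i (H0 i).
  rewrite /rd /scan /= => -> E ne; rewrite /host_cell /host_head E.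
  by case: asboolP.
clearbody rd; congr exec.
apply: conc_eq => [r _|i iN p|i iN].
- by rewrite /sim_bump dE /upd; case: eqP.
- rewrite /sim_action dE /host_cell /host_head.
  case E: (guest i) => [t|] /=; first by case: eqP.
  case: asboolP => [_|ne] /=; first by case: eqP.
  by rewrite rdE //; case: eqP => // ->.
- rewrite /sim_action dE /host_head.
  by case: (guest i) => [t|] //=; case: asboolP.
Qed.

Definition at_state (q : state M) : reading W K -> bool :=
  fun rd => `[< rd sim_state = state_symbol q >].

Lemma at_stateE c q : at_state q (scan (host_memory c)) = (cur c == q).
Proof.
rewrite /at_state scan_host_state; apply/asboolP/eqP => [[]//|->//].
Qed.

Hypotheses (erased_lt : (erased < Rn)%N) (erased_out_pos : erased <> out_pos).

(** The real oracle answers [O k], whereas the simulated machine must see the empty word; erasing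
    the answer turns one into the other. *)
Definition sim_ask : com W K :=
  Seq Ask (Seq (erase Rn erased (inl Answer))
    (write Rn (dirs [::] [::]) sim_state (state_symbol (q_answer M)) Stay)).

Lemma exec_sim_ask c k : rho0 erased = 0%N ->
  cell c (inl Query) =1 word_tape _ (nseq k One) ->
  exec O sim_ask (host_memory c) (host_memory (query_step (no_oracle k) c)).
Proof.
move=> r0 eq; set rho := upd rho0 out_pos (Defs.head c (inl Output)).
have put : put_answer (O k) (host_memory c) = conc Rn rho
    (tset (host_cell c) (inl Answer) (word_tape _ (O k)))
    (tset (host_head c) (inl Answer) 0%N).
  apply: mem_eq => [i p|i]; case: i => [[]|i] //=;
  first [by rewrite tset_eq | by rewrite tset_neq
        | by case: ifP => // _; rewrite tset_neq].
apply: ExecSeq.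
  apply: (@ExecAsk _ _ O _ k) => p.
  by rewrite /host_memory /= /host_cell /= eq up_word.
rewrite put; apply: ExecSeq.
  apply: (exec_erase O Rn_sim (w := O k)) => //; rewrite ?tset_eq //.
  by rewrite /rho /upd; case: eqP.
rewrite tset_tset.
set C1 := tset _ _ _; set H1 := tset _ _ _.
have := exec_write Rn O (dirs [::] [::]) sim_state (state_symbol (q_answer M))
  Stay rho C1 H1.
congr exec; apply: conc_eq => [r _|i iN p|i iN] //.
- rewrite /C1 /H1 /host_cell /=; case: (asboolP (i = sim_state)) => [->|ne].
    rewrite tset_eq !tset_neq // guest_state /host_head guest_state.
    case: (asboolP (sim_state = sim_state)) => // _.
    by case: eqP.
  rewrite tset_neq //; case: (asboolP (i = inl Answer)) => [->|ne2].
    by rewrite tset_eq /= /word_tape onth_drop drop_oversize.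
  rewrite tset_neq // /host_cell; case E: (guest i) => [[[]|]|] //=.
  + by move/guest_host: E ne2 => <-.
  + by case: asboolP.
- rewrite /H1 /=; case: (asboolP (i = sim_state)) => [->|ne].
    rewrite tset_eq /= tset_neq // /host_head guest_state.
    by case: asboolP.
  rewrite tset_neq //; case: (asboolP (i = inl Answer)) => [->|ne2].
    by rewrite tset_eq.
  rewrite tset_neq // /host_head; case E: (guest i) => [[[]|]|] //=.
  by move/guest_host: E ne2 => <-.
Qed.

Definition sim : com W K :=
  While (fun rd => ~~ at_state (q_halt M) rd)
        (If (at_state (q_query M)) sim_ask sim_step).

Lemma exec_sim c c' : rho0 erased = 0%N ->
  clos_refl_trans _ (@step M no_oracle) c c' -> cur c' = q_halt M ->
  exec O sim (host_memory c) (host_memory c').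
Proof.
(* Peeling steps off the front matches them with the rounds of the loop. *)
move=> r0 hh; have {hh}: clos_refl_trans_1n _ (@step M no_oracle) c c'.
  exact: clos_rt_rt1n.
elim=> {c c'} [c|c c1 c2 st _ IH] hc.
  by apply: ExecWhileF; rewrite at_stateE hc negbK.
apply: ExecWhileT (IH hc); case: st => [{}c|{}c k].
- by move=> _ nh; rewrite at_stateE; apply/eqP.
- by move=> _ nh _; rewrite at_stateE; apply/eqP.
- move=> nq nh; apply: ExecIfF; first by rewrite at_stateE; apply/eqP.
  exact: exec_sim_step.
- move=> q nh eq; apply: ExecIfT; first by rewrite at_stateE q.
  exact: exec_sim_ask.
Qed.

End Host.
End Simulation.

(** * One call of a machine, followed by an integer square root *)

Section Once.
Variables (M : machine) (Rn : nat) (O : nat -> seq letter) (c : nat).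
Variables (target : nexpr) (outs : seq rexpr).
Hypotheses (target_vars : vars_below 10 target) (outs_vars : all (rvars 10) outs).
Hypotheses (target_room : (40 + scratch target <= Rn)%N)
  (outs_room : all (fun x => 11 + rscratch x <= Rn)%N outs).
Hypothesis target_free : forall rho u v,
  nval (upd (upd rho 3 u) 7 v) target = nval rho target.

Local Notation K := (sim_tapes M Rn).
Local Notation W := (sim_letter M).

Let RnK : (Rn <= K)%N := Rn_sim M Rn.
Let erased_lt : (8 < Rn)%N. Proof. lia. Qed.

Definition mark_sim : action W K := fun rd i =>
  (if register Rn i is Some _ then marker
   else if `[< i = sim_state M Rn >] then state_symbol (q_start M) else rd i,
   Stay).

Definition start_cells (inp : seq letter) : tape K -> nat -> symbol W :=
  tset (blank_cells W inp) (sim_state M Rn)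
    (fun p => if p == 0%N then state_symbol (q_start M) else None).

Lemma exec_mark_sim inp : exec O (Act mark_sim) (init_memory W K inp)
  (conc Rn (fun=> 0%N) (start_cells inp) (fun=> 0%N)).
Proof.
set m' := conc _ _ _ _.
have -> : m' = perform mark_sim (init_memory W K inp).
  apply: mem_eq => [i p|i]; last by rewrite /=; case: register.
  have -> : mcell m' i p = if register Rn i is Some _ then
    if p == 0%N then marker else None else start_cells inp i p by [].
  have -> : mcell (perform mark_sim (init_memory W K inp)) i p =
     if p == 0%N then (if register Rn i is Some _ then marker
     else if `[< i = sim_state M Rn >] then state_symbol (q_start M)
     else blank_cells W inp i 0%N) else blank_cells W inp i p by [].
  case E: (register Rn i) => [r|].
    by case: eqP => // _; move: E; case: i => [[]|].
  by rewrite /start_cells /tset; case: asboolP => [->|ne]; case: eqP => // ->.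
exact: ExecAct.
Qed.

(* Register 7 runs up to the least square root of [target] from above. *)
Definition root_body : com W K :=
  Seq (xfer Rn [::] [:: 3] 3)
  (Seq (nudge Rn (dirs [:: 7] [::]))
       (assign Rn 11 3 (NSub target (NMul (NVar 7) (NVar 7))))).

Lemma exec_root_body rho C H : (forall i, (11 <= i)%N -> rho i = 0%N) ->
  exec O root_body (conc Rn rho C H)
    (conc Rn (upd (upd rho 7 (rho 7).+1) 3
       (nval rho target - (rho 7).+1 * (rho 7).+1)) C H).
Proof.
move=> z; apply: ExecSeq; first by apply: exec_xfer => //; lia.
apply: ExecSeq; first exact: exec_nudge.
set rho1 := fun i => move_head _ _.
have e : rho1 = upd (upd rho 3 0) 7 (rho 7).+1 by rewrite /rho1; regs.
have -> : upd (upd rho 7 (rho 7).+1) 3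
    (nval rho target - (rho 7).+1 * (rho 7).+1)%N =
    upd rho1 3 (nval rho1 (NSub target (NMul (NVar 7) (NVar 7)))).
  by rewrite /= e target_free; regs.
apply: exec_assign => //=.
- by rewrite andbT; apply: vars_below_leq target_vars.
- by lia.
by move=> i h; rewrite e /upd !ifN ?z //; lia.
Qed.

(** Minimality of [s] will bound the rounding error of the root by 1. It gives no information when
    [s] is 1, whence the alternative. *)
Lemma exec_root rho C H : (forall i, (11 <= i)%N -> rho i = 0%N) ->
  rho 3 = 1%N -> rho 7 = 0%N ->
  exists s, [/\ (0 < s)%N, (nval rho target <= s * s)%N,
    (s == 1%N) || (s.-1 * s.-1 < nval rho target)%N
   & exec O (While (nonzero 3) root_body) (conc Rn rho C H)
       (conc Rn (upd (upd rho 3 0) 7 s) C H)].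
Proof.
move=> z r3 r7; set T := nval rho target.
have ep : exists s, (0 < s)%N && (T <= s * s)%N.
  by exists T.+1; rewrite mulSn; lia.
case: (ex_minnP ep) => s /andP[s0 Ts] smin; exists s; split=> //.
  case: (ltnP s 2) => [|h]; first by move: s0; case: (s) => [|[]].
  rewrite orbC ltnNge; case: leqP => // h2.
  have := smin s.-1; rewrite h2 andbT; lia.
have R3 : (3 < Rn)%N by lia.
(* [d] counts the increments still to come after the next one; the equation says that only the flag
   3 and the candidate 7 have changed. *)
suff loop d : forall rho1, (rho1 7 + d.+1 = s)%N -> rho1 3 <> 0%N ->
    upd (upd rho1 3 0) 7 0 = upd (upd rho 3 0) 7 0 ->
    exec O (While (nonzero 3) root_body) (conc Rn rho1 C H)
     (conc Rn (upd (upd rho 3 0) 7 s) C H).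
  by apply: (loop s.-1); rewrite ?r7 ?r3 //; lia.
elim: d => [|d IH] rho1 es nz e; (apply: ExecWhileT;
    [by rewrite nonzeroE //; apply/eqP|apply: exec_root_body|]).
- move=> i h; have /(congr1 (@^~ i)) := e.
  by rewrite /upd !ifN ?z //; lia.
- have eT : nval rho1 target = T.
    by rewrite -(target_free rho1 0 0) e target_free.
  have es1 : (rho1 7).+1 = s by lia.
  set rho2 := upd _ _ _.
  have -> : upd (upd rho 3 0) 7 s = rho2.
    rewrite /rho2 eT es1; have -> : (T - s * s = 0)%N by lia.
    apply/funext=> i; have /(congr1 (@^~ i)) := e.
    by regs.
  apply: ExecWhileF; rewrite nonzeroE // negbK /rho2 /upd /= eT es1.
  by apply/eqP; lia.
- move=> i h; have /(congr1 (@^~ i)) := e.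
  by rewrite /upd !ifN ?z //; lia.
- have eT : nval rho1 target = T.
    by rewrite -(target_free rho1 0 0) e target_free.
  apply: IH.
  + by rewrite /upd /=; lia.
  + rewrite /upd /= eT => h; have := smin (rho1 7).+1; lia.
  + by rewrite -e; regs.
Qed.

(** [M] is asked for precision [j + c]. Register 8 is spent in writing its input, and 7 keeps the
    length for the rewind; during the simulation 8 serves erasing and 9 follows the output head.
    Afterwards 4 to 6 hold the fraction, 1 holds [2 ^ j], and 7 is free for the root. *)
Definition once : com W K :=
  Seq (Act mark_sim)
  (Seq (scan_word Rn 0 (inl Input) One)
  (Seq (assign Rn 11 7 (NAdd (NVar 0) (NConst c)))
  (Seq (assign Rn 11 8 (NVar 7))
  (Seq (emit Rn 8 (sim_input M Rn) One)
  (Seq (rewind Rn 7 (sim_input M Rn))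
  (Seq (sim M Rn 8 9)
  (Seq (rewind Rn 9 (sim_output M Rn))
  (Seq (parse_frac Rn (sim_output M Rn) 4)
  (Seq (assign Rn 11 1 (NConst 1))
  (Seq (pow_loop Rn 0 1 11)
  (Seq (nudge Rn (dirs [:: 3] [::]))
  (Seq (While (nonzero 3) root_body)
       (emit_fracs Rn 10 outs))))))))))))).

Lemma asks_once : asks once = 1%N.
Proof.
by cbn [asks once root_body pow_loop]; rewrite !asks_assign asks_emit_fracs.
Qed.

Definition once_env (j : nat) (s : bool) (p d v : nat) : nat -> nat :=
  upd (upd (upd (upd (upd (fun=> 0%N) 1 (2 ^ j)) 4 s) 5 p) 6 d) 7 v.

Lemma once_runs j s p d :
  runs M no_oracle (nseq (j + c) One) (frac_word s p d) ->
  exists v (rho := once_env j s p d v),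
   [/\ (0 < v)%N, (nval rho target <= v * v)%N,
       (v == 1%N) || (v.-1 * v.-1 < nval rho target)%N
     & runs (code_machine (compile 0 once)) O (nseq j One)
        (frac_words (map (rfrac rho) outs))].
Proof.
move=> [cf [cfsteps cfhalt cfout]].
set inp := nseq j One; set X := sim_input M Rn; set Y := sim_output M Rn.
have gX : guest X = Some (inl Input) := host_guest Rn (inl Input).
have gY : guest Y = Some (inl Output) := host_guest Rn (inl Output).
have XN : register Rn X = None := host_register Rn (inl Input).
have YN : register Rn Y = None := host_register Rn (inl Output).
set C0 := start_cells inp; set H0 : tape K -> nat := tset (fun=> 0%N) (inl Input) j.
set rho0 := upd (fun=> 0%N) 0 j.
set cf0 := initial M (nseq (j + c) One).
have blank : word_tape W [::] = fun=> None by apply/funext=> -[].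
have XS : X <> sim_state M Rn.
  by move=> e; have := guest_state M Rn; rewrite -e gX.
have C0X : C0 X = word_tape W [::].
  by rewrite /C0 /start_cells tset_neq.
have H0X : H0 X = size ([::] : seq letter) by rewrite /H0 tset_neq.
have guestC i t : guest i = Some t -> C0 i = fun=> None.
  move=> E; rewrite /C0 /start_cells tset_neq.
    by move/guest_host: E => <-; case: (t) => [[]|].
  by move=> e; move: E; rewrite e guest_state.
have guestH i t : guest i = Some t -> H0 i = 0%N.
  by move=> E; rewrite /H0 tset_neq //; move/guest_host: E => <-; case: (t) => [[]|].
(* With the input written and rewound, the memory is the image of the initial configuration of
   [M]. *)
have eh : conc Rn rho0 (tset C0 X (word_tape W (nseq (j + c) One)))
   (tset H0 X 0%N) = host_memory 9 rho0 C0 H0 cf0.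
  apply: conc_eq => [r _|i iN q|i iN].
  - by rewrite /rho0; regs.
  - rewrite /host_cell /tset; case: asboolP => [->|ne].
      by rewrite gX /= up_word.
    case E: (guest i) => [t|].
      rewrite (guestC _ _ E); case: t E => [[]|w] //= /guest_host E.
      by case: ne.
    by rewrite /C0 /start_cells /tset; case: asboolP.
  - rewrite /host_head /tset; case: asboolP => [->|ne]; first by rewrite gX.
    case E: (guest i) => [t|]; first by rewrite (guestH _ _ E).
    by case: asboolP => // ->; rewrite /H0 tset_neq.
set C1 := host_cell C0 cf; set H1 := tset (host_head H0 cf) Y 0%N.
have C1Y : C1 Y = word_tape W (frac_word s p d).
  by apply/funext=> q; rewrite /C1 /host_cell gY cfout up_word.
set rho2 := upd (upd (upd (upd (fun=> 0%N) 1 (2 ^ j)) 4 s) 5 p) 6 d.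
have [|||v [v0 vT vmin rootv]] := @exec_root (upd rho2 3 1) C1
    (tset H1 Y (H1 Y + size (frac_word s p d))%N).
- by move=> i h; rewrite /rho2; regs.
- by rewrite /rho2; regs.
- by rewrite /rho2; regs.
have eT u : nval (once_env j s p d u) target = nval (upd rho2 3 1) target.
  rewrite -(target_free (once_env j s p d u) 1 0).
  by rewrite -(target_free (upd rho2 3 1) 1 0); congr nval;
    rewrite /once_env /rho2; regs.
exists v; cbv zeta; rewrite eT; split=> //.
set rho := once_env j s p d v; set f := frac_words _.
set H2 := tset H1 Y _ in rootv.
have C1o : C1 = tset C1 (inl Output) (word_tape W [::]).
  rewrite tset_id // /C1 /host_cell /=; case: asboolP => // _.
  by rewrite blank /C0 /start_cells tset_neq.
have H2o : H2 = tset H2 (inl Output) (size ([::] : seq letter)).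
  rewrite tset_id // /H2 /H1 !tset_neq // /host_head /=.
  by case: asboolP => // _; rewrite /H0 tset_neq.
have exo := @exec_emit_fracs _ _ _ O RnK 10 outs rho C1 H2 [::] outs_vars
  outs_room _.
rewrite -C1o -H2o /= in exo.
apply: (@exec_runs _ _ _ _ _ f); first by rewrite asks_once.
  apply: ExecSeq; first exact: exec_mark_sim.
  apply: ExecSeq.
    apply: (@exec_scan_word _ _ _ O RnK _ _ _ j [::] inp) => //.
    - by rewrite /start_cells tset_neq.
    - by rewrite drop0 cats0.
  rewrite add0n -/H0 -/rho0 -/C0.
  apply: ExecSeq.
    by apply: exec_assign => //=; [lia|move=> i h; rewrite /rho0; regs].
  apply: ExecSeq.
    by apply: exec_assign => //=; [lia|move=> i h; rewrite /rho0; regs].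
  apply: ExecSeq.
    have := @exec_emit _ _ _ O RnK 8 X One
      (upd (upd rho0 7 (j + c)) 8 (j + c)) C0 H0 [::] _.
    rewrite (tset_id C0X) (tset_id H0X); apply; lia.
  apply: ExecSeq; first by apply: (exec_rewind O RnK); lia.
  rewrite /= tset_tset tset_eq size_nseq subnn.
  set M1 := conc _ _ _ _.
  have -> : M1 = host_memory 9 rho0 C0 H0 cf0.
    rewrite -eh /M1; congr conc.
    by rewrite /rho0; regs.
  apply: ExecSeq; first by apply: (exec_sim O C0 H0 erased_lt _ _ cfsteps cfhalt).
  apply: ExecSeq; first by apply: (exec_rewind O RnK); lia.
  have -> : (host_head H0 cf Y - upd rho0 9 (Defs.head cf (inl Output)) 9 = 0)%N.
    by rewrite /host_head gY /upd /= subnn.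
  rewrite -/H1 -/C1.
  apply: ExecSeq.
    apply: (@exec_parse_frac _ _ _ O RnK Y 4 s p d _ [::] _ _ _ _ _ C1Y) => //.
      by lia.
    by rewrite /H1 tset_eq drop0 cats0.
  rewrite -/H2.
  apply: ExecSeq.
    by apply: exec_assign => //=; [lia|move=> i h; rewrite /rho0; regs].
  apply: ExecSeq.
    by apply: exec_pow_loop => //=; [lia|move=> i h; rewrite /rho0; regs].
  apply: ExecSeq; first exact: exec_nudge.
  apply: ExecSeq.
    set M2 := conc _ _ _ _.
    have -> : M2 = conc Rn (upd rho2 3 1) C1 H2.
      rewrite /M2; congr conc; rewrite /rho2 /rho0.
      by regs; rewrite mul1n.
    exact: rootv.
  have -> : upd (upd (upd rho2 3 1) 3 0) 7 v = rho.
    by rewrite /rho /once_env /rho2; regs.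
  by apply: exo => i h; rewrite /rho /once_env; regs.
by move=> q /=; rewrite tset_eq.
Qed.

End Once.


Local Open Scope classical_set_scope.
Local Open Scope ring_scope.

(** * Rational arithmetic on counters *)

Section RationalExpressions.

(** The field is a parameter because an output is denoted in [rat] but estimated in the reals. *)
Definition rval (F : realFieldType) (rho : nat -> nat) (x : rexpr) : F :=
  ((nval rho (rP x))%:R - (nval rho (rN x))%:R) / (nval rho (rD x))%:R.

Definition rdef (rho : nat -> nat) (x : rexpr) : bool := (0 < nval rho (rD x))%N.

Definition rnat (e : nexpr) : rexpr := RExpr e (NConst 0) (NConst 1).

(** A sign bit [s] and a numerator [p] give [p (1 - s) - p s], of which one term is zero. *)
Definition rcoord (r : nat) : rexpr :=
  RExpr (NMul (NVar r.+1) (NSub (NConst 1) (NVar r)))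
        (NMul (NVar r.+1) (NVar r)) (NVar r.+2).

Definition radd (x y : rexpr) : rexpr :=
  RExpr (NAdd (NMul (rP x) (rD y)) (NMul (rP y) (rD x)))
        (NAdd (NMul (rN x) (rD y)) (NMul (rN y) (rD x))) (NMul (rD x) (rD y)).

Definition ropp (x : rexpr) : rexpr := RExpr (rN x) (rP x) (rD x).

Definition rmul (x y : rexpr) : rexpr :=
  RExpr (NAdd (NMul (rP x) (rP y)) (NMul (rN x) (rN y)))
        (NAdd (NMul (rP x) (rN y)) (NMul (rN x) (rP y))) (NMul (rD x) (rD y)).

Definition rpos (x : rexpr) : rexpr :=
  RExpr (NSub (rP x) (rN x)) (NConst 0) (rD x).

(** Denominators are natural numbers, so the divisor has to be positive; its truncated numerator is
    then the true one. *)
Definition rdiv (x y : rexpr) : rexpr :=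
  RExpr (NMul (rP x) (rD y)) (NMul (rN x) (rD y))
        (NMul (rD x) (NSub (rP y) (rN y))).

Definition rsum (xs : seq rexpr) : rexpr := foldr radd (rnat (NConst 0)) xs.

Variables (F : realFieldType) (rho : nat -> nat).
Local Notation val_of := (@rval F rho).
Local Notation ok := (rdef rho).

Lemma rdef_neq0 x : ok x -> (nval rho (rD x))%:R != 0 :> F.
Proof. by rewrite /rdef pnatr_eq0 lt0n. Qed.

Lemma rval_nat e : val_of (rnat e) = (nval rho e)%:R.
Proof. by rewrite /rval /= subr0 divr1. Qed.

Lemma rval_coord r (s : bool) p d : rho r = s -> rho r.+1 = p -> rho r.+2 = d ->
  val_of (rcoord r) = (-1) ^+ s * p%:R / d%:R.
Proof.
rewrite /rval /= => -> -> ->; case: s => /=.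
  by rewrite subnn muln0 muln1 sub0r expr1 mulN1r.
by rewrite subn0 muln0 muln1 subr0 expr0 mul1r.
Qed.

Lemma rval_add x y : ok x -> ok y -> val_of (radd x y) = val_of x + val_of y.
Proof.
move=> /rdef_neq0 dx /rdef_neq0 dy; rewrite /rval /= !natrD !natrM; field.
by rewrite dx dy.
Qed.

Lemma rdef_add x y : ok x -> ok y -> ok (radd x y).
Proof. by rewrite /rdef /= muln_gt0 => -> ->. Qed.

Lemma rval_opp x : val_of (ropp x) = - val_of x.
Proof. by rewrite /rval /= -mulNr opprB. Qed.

Lemma rval_mul x y : ok x -> ok y -> val_of (rmul x y) = val_of x * val_of y.
Proof.
move=> /rdef_neq0 dx /rdef_neq0 dy; rewrite /rval /= !natrD !natrM; field.
by rewrite dx dy.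
Qed.

Lemma rdef_mul x y : ok x -> ok y -> ok (rmul x y).
Proof. by rewrite /rdef /= muln_gt0 => -> ->. Qed.

Lemma rval_gt0 x : ok x -> (0 < val_of x) = (nval rho (rN x) < nval rho (rP x))%N.
Proof.
move=> dx; rewrite /rval pmulr_lgt0; last by rewrite invr_gt0 ltr0n.
by rewrite subr_gt0 ltr_nat.
Qed.

Lemma natr_subn (m n : nat) : (m - n)%N%:R = Num.max (m%:R - n%:R) 0 :> F.
Proof.
case: (leqP n m) => h.
  by rewrite natrB // max_l // subr_ge0 ler_nat.
rewrite max_r; last by rewrite subr_le0 ler_nat ltnW.
by have /eqP -> : (m - n == 0)%N by rewrite subn_eq0 ltnW.
Qed.

Lemma rval_pos x : ok x -> val_of (rpos x) = Num.max (val_of x) 0.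
Proof.
move=> dx; rewrite /rval /= subr0 natr_subn.
by rewrite maxr_pMl ?mul0r // invr_ge0 ler0n.
Qed.

Lemma rval_div x y : ok x -> ok y -> 0 < val_of y ->
  val_of (rdiv x y) = val_of x / val_of y.
Proof.
move=> dx dy; rewrite rval_gt0 // => h; have dx0 := rdef_neq0 dx.
have dy0 := rdef_neq0 dy; rewrite /rval /= !natrM natrB; last exact: ltnW.
have nz : (nval rho (rP y))%:R - (nval rho (rN y))%:R != 0 :> F.
  by rewrite subr_eq0 eqr_nat; apply/eqP => e; rewrite e ltnn in h.
by field; rewrite dx0 dy0 nz.
Qed.

Lemma rdef_div x y : ok x -> ok y -> 0 < val_of y -> ok (rdiv x y).
Proof.
by move=> dx dy; rewrite rval_gt0 // /rdef /= muln_gt0 subn_gt0 => ->; rewrite andbT.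
Qed.

Lemma rval_sum xs : all ok xs ->
  val_of (rsum xs) = \sum_(x <- xs) val_of x /\ ok (rsum xs).
Proof.
elim: xs => [|x xs IH] /=; first by rewrite big_nil rval_nat.
move=> /andP[dx /IH[e d]]; rewrite big_cons rval_add // e; split=> //.
exact: rdef_add.
Qed.

Lemma rval_frac x (f := rfrac rho x) :
  val_of x = (-1) ^+ f.1.1 * f.1.2%:R / f.2%:R.
Proof.
rewrite /rval /f /=; congr (_ / _).
case: ltnP => h.
  by have /eqP -> : (nval rho (rP x) - nval rho (rN x) == 0)%N;
    [rewrite subn_eq0 ltnW|rewrite add0n natrB ?(ltnW h)// mulN1r opprB].
have /eqP -> : (nval rho (rN x) - nval rho (rP x) == 0)%N by rewrite subn_eq0.
by rewrite addn0 natrB // mul1r.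
Qed.

End RationalExpressions.

Lemma ratr_rval (R : realFieldType) rho x : ratr (rval rat rho x) = rval R rho x.
Proof. by rewrite /rval fmorph_div rmorphB /= !ratr_nat. Qed.

Lemma denotes_frac_words n rho (u : 'I_n -> rexpr) :
  (forall i, rdef rho (u i)) ->
  denotes (frac_words (map (rfrac rho) [seq u i | i <- enum 'I_n]))
    (\row_i rval rat rho (u i)).
Proof.
move=> d; exists (fun i => (rfrac rho (u i)).1.1), (fun i => (rfrac rho (u i)).1.2).
exists (fun i => (rfrac rho (u i)).2); split.
  by rewrite /frac_words -!map_comp.
by move=> i; split; [exact: d|rewrite mxE rval_frac].
Qed.

Definition point_fracs (m : nat) (q : 'rV[rat]_m) : seq frac :=
  [seq (q 0 i < 0, `|numq (q 0%R i)|%N, `|denq (q 0%R i)|%N) | i <- enum 'I_m].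

Lemma encode_fracs m (q : 'rV[rat]_m) : encode q = frac_words (point_fracs q).
Proof. by rewrite /encode /frac_words /point_fracs -map_comp. Qed.

Lemma size_point_fracs m (q : 'rV[rat]_m) : size (point_fracs q) = m.
Proof. by rewrite size_map size_enum_ord. Qed.

Lemma rat_fracE (x : rat) :
  (-1) ^+ (x < 0)%R * (`|numq x|%N)%:R / (`|denq x|%N)%:R = x.
Proof.
rewrite -[RHS]divq_num_den -numq_lt0 {3}(intEsign (numq x)).
by rewrite rmorphM rmorph_sign /= !pmulrn absz_denq.
Qed.

Lemma rval_env_coord (R : realFieldType) m (q : 'rV[rat]_m) j k (i : 'I_m) :
  let rho := env j k (point_fracs q) in
  rval R rho (rcoord (4 + 3 * i)) = ratr (q 0 i) /\ rdef rho (rcoord (4 + 3 * i)).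
Proof.
move=> rho; have si : (i < size (point_fracs q))%N by rewrite size_point_fracs.
have [] := @load_nth 4 (point_fracs q) (upd (upd (fun=> 0%N) 1 (2 ^ j)) 2 (2 ^ k))
  i (false, 0%N, 0%N) si.
rewrite -/(env j k (point_fracs q)) -/rho.
have -> : nth (false, 0%N, 0%N) (point_fracs q) i =
    (q 0 i < 0, `|numq (q 0%R i)|%N, `|denq (q 0%R i)|%N).
  by rewrite (nth_map i) ?size_enum_ord // nth_ord_enum.
move=> /= e1 e2 e3; split.
  rewrite (rval_coord R e1 e2 e3) -{4}[q 0 i]rat_fracE.
  by rewrite fmorph_div rmorphM rmorph_sign /= !ratr_nat.
by rewrite /rdef /= e3 absz_gt0 denq_neq0.
Qed.

(** * The chasing control *)

Section Euclidean.
Variables (R : realType) (n : nat).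
Local Notation V := 'rV[R]_n.
Implicit Types (u v w : V) (a : R).

Lemma dotC u v : dot u v = dot v u.
Proof. by apply: eq_bigr => i _; rewrite mulrC. Qed.

Lemma dotDr u v w : dot u (v + w) = dot u v + dot u w.
Proof. by rewrite /dot -big_split; apply: eq_bigr => i _; rewrite mxE mulrDr. Qed.

Lemma dotZr a u v : dot u (a *: v) = a * dot u v.
Proof. by rewrite /dot mulr_sumr; apply: eq_bigr => i _; rewrite mxE mulrCA. Qed.

Lemma dotNr u v : dot u (- v) = - dot u v.
Proof. by rewrite -scaleN1r dotZr mulN1r. Qed.

Lemma dotBr u v w : dot u (v - w) = dot u v - dot u w.
Proof. by rewrite dotDr dotNr. Qed.

Lemma dotDl u v w : dot (v + w) u = dot v u + dot w u.
Proof. by rewrite -!(dotC u) dotDr. Qed.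

Lemma dotZl a u v : dot (a *: v) u = a * dot v u.
Proof. by rewrite -!(dotC u) dotZr. Qed.

Lemma dotBl u v w : dot (v - w) u = dot v u - dot w u.
Proof. by rewrite -!(dotC u) dotBr. Qed.

Lemma dot0r u : dot u 0 = 0.
Proof. by rewrite -(scale0r 0) dotZr mul0r. Qed.

Lemma dot_ge0 u : 0 <= dot u u.
Proof. by apply: sumr_ge0 => i _; rewrite -expr2 sqr_ge0. Qed.

Lemma dot_eq0 u : dot u u = 0 -> u = 0.
Proof.
move=> /eqP; rewrite psumr_eq0 => [|i _]; last by rewrite -expr2 sqr_ge0.
move=> /allP h; apply/rowP => i; rewrite mxE; apply/eqP.
by have := h i (mem_index_enum _); rewrite /= mulf_eq0 orbb.
Qed.

Lemma dot_gt0 u : u <> 0 -> 0 < dot u u.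
Proof.
by move=> nz; rewrite lt_def dot_ge0 andbT; apply/eqP => /dot_eq0.
Qed.

Lemma enormE u : enorm u = Num.sqrt (dot u u).
Proof. by congr Num.sqrt; apply: eq_bigr => i _; rewrite expr2. Qed.

Lemma enorm_ge0 u : 0 <= enorm u.
Proof. exact: sqrtr_ge0. Qed.

Lemma enorm_sqr u : enorm u ^+ 2 = dot u u.
Proof. by rewrite enormE sqr_sqrtr // dot_ge0. Qed.

Lemma enorm_gt0 u : u <> 0 -> 0 < enorm u.
Proof. by move=> /dot_gt0; rewrite enormE sqrtr_gt0. Qed.

Lemma enormZ a u : enorm (a *: u) = `|a| * enorm u.
Proof.
by rewrite !enormE dotZl dotZr mulrA -expr2 sqrtrM ?sqr_ge0 // sqrtr_sqr.
Qed.

Lemma enormN u : enorm (- u) = enorm u.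
Proof. by rewrite -scaleN1r enormZ normrN1 mul1r. Qed.

Lemma enorm0 : enorm (0 : V) = 0.
Proof. by rewrite enormE dot0r sqrtr0. Qed.

Lemma dot_enorm u v : dot u v <= enorm u * enorm v.
Proof.
apply: le_trans (ler_norm _) _.
rewrite -(@ler_pXn2r _ 2) ?nnegrE ?mulr_ge0 ?enorm_ge0 //.
rewrite real_normK ?num_real // exprMn !enorm_sqr.
have [-> | /eqP/dot_gt0 v0] := eqVneq v 0; first by rewrite !dot0r expr0n mulr0.
have := dot_ge0 (dot v v *: u - dot u v *: v).
rewrite dotBl !dotBr !dotZl !dotZr (dotC v u).
have -> : dot v v * (dot v v * dot u u) - dot v v * (dot u v * dot u v) -
  (dot u v * (dot v v * dot u v) - dot u v * (dot u v * dot v v)) =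
  dot v v * (dot u u * dot v v - dot u v ^+ 2) by ring.
by rewrite pmulr_rge0 // subr_ge0.
Qed.

Lemma enormD u v : enorm (u + v) <= enorm u + enorm v.
Proof.
rewrite -(@ler_pXn2r _ 2) ?nnegrE ?addr_ge0 ?enorm_ge0 //.
rewrite enorm_sqr dotDl !dotDr sqrrD !enorm_sqr (dotC v u).
by have := dot_enorm u v; lra.
Qed.

Lemma enormB u v : enorm (u - v) <= enorm u + enorm v.
Proof. by rewrite -(enormN v) enormD. Qed.

Lemma enorm_dist u v : `|enorm u - enorm v| <= enorm (u - v).
Proof.
rewrite ler_norml lerBrDl lerBlDr; apply/andP; split.
  by have := enormB u (u - v); rewrite opprB addrC subrK; lra.
by have := enormD (u - v) v; rewrite subrK; lra.
Qed.

End Euclidean.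

Lemma enorm_lsub (R : realType) m1 m2 (z : 'rV[R]_(m1 + m2)) :
  enorm (lsubmx z) <= enorm z.
Proof.
rewrite /enorm ler_wsqrtr // big_split_ord /=.
rewrite (eq_bigr (fun i => z 0 (lshift m2 i) ^+ 2)).
  by rewrite lerDl sumr_ge0 // => i _; rewrite sqr_ge0.
by move=> i _; rewrite mxE.
Qed.

Lemma enorm_rsub (R : realType) m1 m2 (z : 'rV[R]_(m1 + m2)) :
  enorm (rsubmx z) <= enorm z.
Proof.
rewrite /enorm ler_wsqrtr // big_split_ord /=.
rewrite (eq_bigr (fun i => z 0 (rshift m1 i) ^+ 2)).
  by rewrite lerDr sumr_ge0 // => i _; rewrite sqr_ge0.
by move=> i _; rewrite mxE.
Qed.

Lemma enorm1 (R : realType) (v : 'rV[R]_1) : enorm v = `|v 0 0|.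
Proof. by rewrite /enorm big_ord1 sqrtr_sqr. Qed.

Section Direction.
Variables (R : realType) (n : nat).
Local Notation V := 'rV[R]_n.

(* The product of Z / r and w / r for r = max Z |w|: both factors have norm at
   most 1, which makes it Lipschitz at scale r. *)
Definition blend (Z : R) (w : V) : V := (Z / Num.max Z (enorm w) ^+ 2) *: w.

(** Only the scale of the second point enters the bound. That point will be the rational
    approximation, whose scale a machine can compute. *)
Lemma blend_dist (Z Z' : R) (w w' : V) (r := Num.max Z' (enorm w')) :
  0 <= Z -> 0 <= Z' -> 0 < Num.max Z (enorm w) -> 0 < r ->
  enorm (blend Z w - blend Z' w') <=
    3 * (`|Z - Z'| + enorm (w - w')) / r.
Proof.
rewrite /r /blend; set s := Num.max Z _; set r' := Num.max Z' _ => Z0 Z'0 s0 r0.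
have Zs : Z <= s by rewrite le_max lexx.
have ws : enorm w <= s by rewrite le_max lexx orbT.
have Z'r : Z' <= r' by rewrite le_max lexx.
have wr : enorm w' <= r' by rewrite le_max lexx orbT.
have sr : `|s - r'| <= `|Z - Z'| + enorm (w - w').
  have := enorm_dist w w'; have := enorm_ge0 (w - w'); have := normr_ge0 (Z - Z').
  rewrite !ler_norml /s /r'; case: (leP Z (enorm w)) => h1;
    case: (leP Z' (enorm w')) => h2 => n1 n2 /andP[h3 h4]; apply/andP;
    have h5 := ler_norm (Z - Z'); have := ler_norm (Z' - Z); rewrite distrC => h6;
    split; lra.
(* Telescoping: [w'], one factor [1 / r'], then [Z'], then the other factor [1 / r'] are replaced in
   turn. The change of scale occurs twice and is at most the sum of the other two changes, which
   gives the constant 3. *)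
have e : (Z / s ^+ 2) *: w - (Z' / r' ^+ 2) *: w' =
   (Z' / r' ^+ 2) *: (w - w') + (Z' / r' * (r' - s) / (r' * s)) *: w +
   ((Z - Z') / (r' * s)) *: w + (Z / s * (r' - s) / (r' * s)) *: w.
  by apply/rowP => i; rewrite !mxE; field; rewrite !gt_eqF.
rewrite e.
apply: le_trans (enormD _ _) _; apply: le_trans (lerD (enormD _ _) (lexx _)) _.
apply: le_trans (lerD (lerD (enormD _ _) (lexx _)) (lexx _)) _.
rewrite !enormZ !(normrM, normrV) ?unitfE ?gt_eqF ?mulr_gt0 ?exprn_gt0 //.
rewrite !(gtr0_norm s0) !(gtr0_norm r0) !(ger0_norm Z0) !(ger0_norm Z'0).
rewrite (distrC r').
set E := enorm (w - w'); set N := enorm w; set D := `|Z - Z'|; set S := `|s - r'|.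
have E0 : 0 <= E := enorm_ge0 _; have N0 : 0 <= N := enorm_ge0 _.
have D0 : 0 <= D := normr_ge0 _; have S0 : 0 <= S := normr_ge0 _.
have unit_prod (c d X : R) : 0 <= c <= 1 -> 0 <= d <= 1 -> 0 <= X ->
    c * d * (X / r') <= X / r'.
  move=> /andP[c0 c1] /andP[d0 d1] X0; rewrite ler_piMl //.
    by rewrite divr_ge0 // ltW.
  by rewrite -(mulr1 1) ler_pM.
have a1 : 0 <= Z' / r' <= 1 by rewrite divr_ge0 ?(ltW r0) //= ler_pdivrMr ?mul1r.
have a2 : 0 <= N / s <= 1 by rewrite divr_ge0 ?(ltW s0) //= ler_pdivrMr ?mul1r.
have a3 : 0 <= Z / s <= 1 by rewrite divr_ge0 ?(ltW s0) //= ler_pdivrMr ?mul1r.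
have a4 : 0 <= (1 : R) <= 1 by rewrite ler01 lexx.
have t1 := unit_prod _ _ _ a1 a4 E0; have t2 := unit_prod _ _ _ a1 a2 S0.
have t3 := unit_prod _ _ _ a4 a2 D0; have t4 := unit_prod _ _ _ a3 a2 S0.
have -> : Z' / (r' * r') * E + Z' / r' * S / (r' * s) * N + D / (r' * s) * N +
    Z / s * S / (r' * s) * N =
  Z' / r' * 1 * (E / r') + Z' / r' * (N / s) * (S / r') +
  1 * (N / s) * (D / r') + Z / s * (N / s) * (S / r').
  by field; rewrite !gt_eqF.
have sr2 : S / r' <= (D + E) / r' by rewrite ler_pM2r ?invr_gt0.
have -> : 3 * (D + E) / r' = (D + E) / r' + (D + E) / r' + (E / r' + D / r').
  by field; rewrite gt_eqF.
by lra.
Qed.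

End Direction.

Section Chase.
Variables (R : realType) (n kappa B T : nat).
Hypothesis B_gt0 : (0 < B)%N.
Local Notation V := 'rV[R]_n.
Local Notation state := 'rV[R]_(1 + (n + n)).

Definition gap (t : R) : R := Num.max (T%:R - t) 0.

Definition clock (z : state) : R := lsubmx z 0 0.
Definition sight (z : state) : V := rsubmx (rsubmx z) - lsubmx (rsubmx z).

(** The square avoids all roots: at a rational state the scale and the control are rational. *)
Definition scale_sqr (z : state) : R :=
  Num.max (gap (clock z) ^+ 2) (B%:R ^+ 2 * dot (sight z) (sight z)).

Definition chase (z : state) : V :=
  (kappa%:R * gap (clock z) / scale_sqr z) *: sight z.

Lemma gap_ge0 t : 0 <= gap t.
Proof. by rewrite le_max lexx orbT. Qed.

Lemma BR_gt0 : 0 < B%:R :> R. Proof. by rewrite ltr0n. Qed.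

Lemma scale_sqrE z :
  scale_sqr z = Num.max (gap (clock z)) (enorm (B%:R *: sight z)) ^+ 2.
Proof.
rewrite /scale_sqr enormZ gtr0_norm ?BR_gt0 // -enorm_sqr -exprMn.
have g0 := gap_ge0 (clock z).
have w0 : 0 <= B%:R * enorm (sight z) by rewrite mulr_ge0 ?enorm_ge0.
case: (leP (gap (clock z)) (B%:R * enorm (sight z))) => h.
  by rewrite max_r // ler_pXn2r.
by rewrite max_l // ler_pXn2r // ltW.
Qed.

(** Multiplying the sight by [B] makes it comparable with the gap and leaves the factor [kappa / B],
    which bounds the speed. *)
Lemma chase_blend z :
  chase z = (kappa%:R / B%:R) *: blend (gap (clock z)) (B%:R *: sight z).
Proof.
rewrite /chase /blend -scale_sqrE !scalerA; congr (_ *: _).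
rewrite -!mulrA; congr (_ * _); rewrite mulrCA; congr (_ * _).
by rewrite mulrCA mulVf ?mulr1 // gt_eqF ?BR_gt0.
Qed.

Lemma scale_sqr_gt0 z : 0 < scale_sqr z ->
  0 < Num.max (gap (clock z)) (enorm (B%:R *: sight z)).
Proof.
rewrite scale_sqrE => h.
rewrite lt_def le_max gap_ge0 andbT; apply/eqP => e.
by move: h; rewrite e expr0n ltxx.
Qed.

Lemma clock_dist z z' : `|clock z - clock z'| <= enorm (z - z').
Proof.
have -> : clock z - clock z' = lsubmx (z - z') 0 0 by rewrite /clock !mxE.
by rewrite -enorm1 enorm_lsub.
Qed.

Lemma gap_dist t t' : `|gap t - gap t'| <= `|t - t'|.
Proof.
have h5 := ler_norm (t - t'); have := ler_norm (t' - t); rewrite distrC => h6.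
rewrite /gap ler_norml; case: (leP (T%:R - t) 0) => h1;
  case: (leP (T%:R - t') 0) => h2; apply/andP; split; lra.
Qed.

Lemma sight_dist z z' : enorm (sight z - sight z') <= 2 * enorm (z - z').
Proof.
have -> : sight z - sight z' = rsubmx (rsubmx (z - z')) - lsubmx (rsubmx (z - z')).
  by apply/rowP => i; rewrite /sight !mxE; ring.
apply: le_trans (enormB _ _) _; rewrite mulr2n mulrDl mul1r lerD //.
  exact: le_trans (enorm_rsub _) (enorm_rsub _).
exact: le_trans (enorm_lsub _) (enorm_rsub _).
Qed.

(** The 3 comes from [blend_dist]. A displacement of the state by d moves the gap by at most d and
    [B] times the sight by at most 2 B d; the factor 1 / B is estimated by 1. *)
Definition chase_lip : nat := (3 * kappa * (1 + 2 * B))%N.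

Lemma chase_dist z z' (r := Num.max (gap (clock z')) (enorm (B%:R *: sight z'))) :
  0 < scale_sqr z -> 0 < scale_sqr z' ->
  enorm (chase z - chase z') <= chase_lip%:R * enorm (z - z') / r.
Proof.
move=> s0 s0'; rewrite !chase_blend -scalerBr enormZ.
have r0 : 0 < r := scale_sqr_gt0 s0'.
have := blend_dist (gap_ge0 (clock z)) (gap_ge0 (clock z')) (scale_sqr_gt0 s0) r0.
have -> : enorm (B%:R *: sight z - B%:R *: sight z') =
    B%:R * enorm (sight z - sight z').
  by rewrite -[_ - _]scalerBr enormZ [`|B%:R|]gtr0_norm ?BR_gt0.
move=> h.
rewrite ger0_norm ?divr_ge0 ?ler0n //.
apply: (@le_trans _ _ (kappa%:R * (3 * ((1 + 2 * B%:R) * enorm (z - z')) / r))).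
  apply: (@le_trans _ _
    (kappa%:R / B%:R * (3 * ((1 + 2 * B%:R) * enorm (z - z')) / r))).
    apply: ler_wpM2l; first by rewrite divr_ge0 ?ler0n.
    apply: le_trans h _; rewrite ler_pM2r ?invr_gt0 // ler_pM2l ?ltr0n //.
    rewrite mulrDl mul1r; apply: lerD.
      exact: le_trans (gap_dist _ _) (clock_dist _ _).
    apply: le_trans (ler_wpM2l (ler0n _ B) (sight_dist z z')) _.
    by rewrite mulrA (mulrC B%:R).
  apply: ler_wpM2r.
    by rewrite divr_ge0 ?(ltW r0) // !mulr_ge0 ?addr_ge0 ?mulr_ge0 ?enorm_ge0 ?ler0n.
  by rewrite ler_pdivrMr ?BR_gt0 // ler_peMr ?ler0n // ler1n.
rewrite /chase_lip !natrM natrD natrM le_eqVlt; apply/orP; left; apply/eqP.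
by ring.
Qed.

End Chase.

(** * The chasing control as a rational expression *)

Lemma rvars_nat t e : vars_below t e -> rvars t (rnat e).
Proof. by rewrite /rvars /= => ->. Qed.

Lemma rvars_coord t r : (r.+2 < t)%N -> rvars t (rcoord r).
Proof. by rewrite /rvars /= => h; lia. Qed.

Lemma rvars_add t x y : rvars t x -> rvars t y -> rvars t (radd x y).
Proof. by rewrite /rvars /= => /and3P[-> -> ->] /and3P[-> -> ->]. Qed.

Lemma rvars_opp t x : rvars t x -> rvars t (ropp x).
Proof. by rewrite /rvars /= => /and3P[-> -> ->]. Qed.

Lemma rvars_mul t x y : rvars t x -> rvars t y -> rvars t (rmul x y).
Proof. by rewrite /rvars /= => /and3P[-> -> ->] /and3P[-> -> ->]. Qed.

Lemma rvars_pos t x : rvars t x -> rvars t (rpos x).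
Proof. by rewrite /rvars /= => /and3P[-> -> ->]. Qed.

Lemma rvars_div t x y : rvars t x -> rvars t y -> rvars t (rdiv x y).
Proof. by rewrite /rvars /= => /and3P[-> -> ->] /and3P[-> -> ->]. Qed.

Lemma rvars_sum t xs : all (rvars t) xs -> rvars t (rsum xs).
Proof. by elim: xs => //= x xs IH /andP[h /IH]; exact: rvars_add. Qed.

Section ChaseProgram.
Variables (n kappa B T : nat).

Definition x_expr (i : 'I_n) : rexpr := rcoord (4 + 3 * (1 + i)).
Definition y_expr (i : 'I_n) : rexpr := rcoord (4 + 3 * (1 + (n + i))).
Definition sight_expr (i : 'I_n) : rexpr := radd (y_expr i) (ropp (x_expr i)).
Definition gap_expr : rexpr :=
  rpos (radd (rnat (NConst T)) (ropp (rcoord (4 + 3 * 0)))).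
Definition sqr_expr : rexpr :=
  rmul (rnat (NConst (B ^ 2)))
    (rsum [seq rmul (sight_expr i) (sight_expr i) | i <- enum 'I_n]).
(** A maximum as v + max (u - v) 0, positive parts being available. *)
Definition scale_expr : rexpr :=
  radd sqr_expr (rpos (radd (rmul gap_expr gap_expr) (ropp sqr_expr))).
Definition chase_expr (i : 'I_n) : rexpr :=
  rdiv (rmul (rmul (rnat (NConst kappa)) gap_expr) (sight_expr i)) scale_expr.
(** The stopping inequality, squared so as to stay rational. [enough] is the truncated difference of
    the two numerators, non-zero exactly when the inequality holds. *)
Definition enough_expr : rexpr :=
  radd (rmul (rnat (NMul (NVar 2) (NVar 2))) scale_expr)
       (ropp (rnat (NMul (NConst (chase_lip kappa B ^ 2))
                         (NMul (NVar 1) (NVar 1))))).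
Definition enough : nexpr := NSub (rP enough_expr) (rN enough_expr).

Let m := (1 + (n + n))%N.
Let room := (4 + 3 * m)%N.

Lemma sight_vars i : rvars room (sight_expr i).
Proof.
have := ltn_ord i => h.
by apply: rvars_add; [|apply: rvars_opp]; apply: rvars_coord; rewrite /room /m; lia.
Qed.

Lemma gap_vars : rvars room gap_expr.
Proof.
apply/rvars_pos/rvars_add; first exact: rvars_nat.
by apply/rvars_opp/rvars_coord; rewrite /room /m; lia.
Qed.

Lemma scale_vars : rvars room scale_expr.
Proof.
have s : rvars room sqr_expr.
  apply: rvars_mul; first exact: rvars_nat.
  apply: rvars_sum; rewrite all_map; apply/allP => i _ /=.
  exact: rvars_mul (sight_vars i) (sight_vars i).
apply: rvars_add => //; apply/rvars_pos/rvars_add; last exact: rvars_opp.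
exact: rvars_mul gap_vars gap_vars.
Qed.

Lemma chase_vars i : rvars room (chase_expr i).
Proof.
apply: rvars_div scale_vars; apply: rvars_mul (sight_vars i).
by apply: rvars_mul gap_vars; exact: rvars_nat.
Qed.

Lemma enough_vars : vars_below room enough.
Proof.
have : rvars room enough_expr.
  apply: rvars_add.
    by apply: rvars_mul scale_vars; apply: rvars_nat.
  by apply/rvars_opp/rvars_nat.
by rewrite /enough /= => /and3P[/= -> -> _].
Qed.

Section Values.
Variables (R : realType) (q : 'rV[rat]_m) (j k : nat).
Let rho := env j k (point_fracs q).
Let z : 'rV[R]_m := ratpt R q.
Local Notation val x := (rval R rho x).
Local Notation ok x := (rdef rho x).

Lemma val_coord (c : nat) (i : 'I_m) : c = i ->
  val (rcoord (4 + 3 * c)) = z 0 i /\ ok (rcoord (4 + 3 * c)).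
Proof. by move=> ->; rewrite /z mxE; exact: rval_env_coord. Qed.

Lemma val_sight i : val (sight_expr i) = sight z 0 i /\ ok (sight_expr i).
Proof.
have [e1 d1] := @val_coord (1 + i) (rshift 1 (lshift n i)) erefl.
have [e2 d2] := @val_coord (1 + (n + i)) (rshift 1 (rshift n i)) erefl.
split; last exact: rdef_add.
by rewrite rval_add ?rval_opp // e1 e2 /sight !mxE.
Qed.

Lemma val_gap : val gap_expr = gap T (clock z) /\ ok gap_expr.
Proof.
have [e d] := @val_coord 0 (lshift (n + n) ord0) erefl.
have d1 : ok (radd (rnat (NConst T)) (ropp (rcoord (4 + 3 * 0)))) by apply: rdef_add.
split=> //; rewrite rval_pos // rval_add // rval_nat rval_opp e.
by rewrite /gap /clock !mxE.
Qed.

Lemma val_scale : val scale_expr = scale_sqr B T z /\ ok scale_expr.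
Proof.
have [|es ds] := @rval_sum R rho
    [seq rmul (sight_expr i) (sight_expr i) | i <- enum 'I_n].
  rewrite all_map; apply/allP => i _ /=.
  by have [_ d] := val_sight i; exact: rdef_mul.
have [eg dg] := val_gap.
have d1 : ok sqr_expr by exact: rdef_mul.
have e1 : val sqr_expr = B%:R ^+ 2 * dot (sight z) (sight z).
  rewrite rval_mul // rval_nat /= natrX es big_map enumT; congr (_ * _).
  apply: eq_bigr => i _; have [e d] := val_sight i.
  by rewrite rval_mul // e.
have d2 : ok (radd (rmul gap_expr gap_expr) (ropp sqr_expr)).
  by apply: rdef_add => //; exact: rdef_mul.
split; last exact: rdef_add.
rewrite rval_add // rval_pos // rval_add //; last exact: rdef_mul.
rewrite rval_opp rval_mul // eg e1 -expr2 /scale_sqr.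
rewrite addr_maxr addr0 addrC subrK //.
Qed.

Lemma val_chase i : 0 < scale_sqr B T z ->
  val (chase_expr i) = chase kappa B T z 0 i /\ ok (chase_expr i).
Proof.
have [em dm] := val_scale; have [eg dg] := val_gap; have [es ds] := val_sight i.
rewrite -em => m0.
have d1 : ok (rmul (rnat (NConst kappa)) gap_expr) by exact: rdef_mul.
have d2 : ok (rmul (rmul (rnat (NConst kappa)) gap_expr) (sight_expr i)).
  exact: rdef_mul.
split; last exact: rdef_div dm m0.
rewrite rval_div // rval_mul // rval_mul // rval_nat em eg es /chase.
by rewrite [RHS]mxE mulrAC.
Qed.

Lemma val_enough : (nval rho enough <> 0%N) <->
  (chase_lip kappa B)%:R ^+ 2 * (2 ^+ j) ^+ 2 < (2 ^+ k) ^+ 2 * scale_sqr B T z.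
Proof.
have [em dm] := val_scale.
have [r1 r2] : rho 1 = (2 ^ j)%N /\ rho 2 = (2 ^ k)%N := env12 _ _ _.
have d1 : ok (rmul (rnat (NMul (NVar 2) (NVar 2))) scale_expr) by exact: rdef_mul.
have d : ok enough_expr by exact: rdef_add.
have : (0 < val enough_expr) = (nval rho enough != 0%N).
  by rewrite rval_gt0 // /enough /= -lt0n subn_gt0.
rewrite rval_add // rval_opp rval_mul // !rval_nat em /= r1 r2 subr_gt0.
rewrite !natrM !natrX !expr2 => ->; split; [by move/eqP|by move/eqP].
Qed.

End Values.

End ChaseProgram.

Section Scale.
Variables (R : realType) (n B T : nat).
Hypothesis B_gt0 : (0 < B)%N.
Implicit Types z : 'rV[R]_(1 + (n + n)).

Definition scale z : R := Num.max (gap T (clock z)) (enorm (B%:R *: sight z)).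

Lemma scale_ge0 z : 0 <= scale z.
Proof. by rewrite le_max gap_ge0. Qed.

Lemma scale_sqr_scale z : scale_sqr B T z = scale z ^+ 2.
Proof. exact: scale_sqrE. Qed.

(** This makes the search end: the scales of good approximations stay away from 0. *)
Lemma scale_dist z z' : scale z <= scale z' + (1 + 2 * B%:R) * enorm (z - z').
Proof.
have g := le_trans (gap_dist T (clock z) (clock z')) (clock_dist z z').
have s := sight_dist z z'; have e0 := enorm_ge0 (z - z').
have B0 : 0 <= B%:R :> R := ler0n _ _.
rewrite /scale ge_max mulrDl mul1r; apply/andP; split.
  have := ler_norm (gap T (clock z) - gap T (clock z')).
  have : gap T (clock z') <= Num.max (gap T (clock z')) (enorm (B%:R *: sight z')).
    by rewrite le_max lexx.
  have : 0 <= 2 * B%:R * enorm (z - z') by rewrite !mulr_ge0.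
  by lra.
have : enorm (B%:R *: sight z') <=
    Num.max (gap T (clock z')) (enorm (B%:R *: sight z')).
  by rewrite le_max lexx orbT.
have := ler_wpM2l B0 s.
rewrite !enormZ normr_nat mulrA [B%:R * 2]mulrC => h.
have := enormD (sight z - sight z') (sight z'); rewrite subrK.
move=> /(ler_wpM2l B0); rewrite mulrDr; lra.
Qed.

End Scale.

Lemma scratch_room (n : nat) (t : nat) (u : 'I_n -> rexpr) (base : nat) :
  all (fun x => t + rscratch x <= t + base + \sum_(i < n) rscratch (u i))%N
    [seq u i | i <- enum 'I_n].
Proof.
by rewrite all_map; apply/allP => i _ /=; rewrite (bigD1 i) //=; lia.
Qed.

Lemma chase_computable (R : realType) (n kappa B T : nat)
    (X : set 'rV[R]_(1 + (n + n))) : (0 < B)%N ->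
  (forall z, X z -> sight z <> 0) -> computable_on X (@chase R n kappa B T).
Proof.
move=> B_gt0 nz; set m := (1 + (n + n))%N; set t := (4 + 3 * m).+1.
set test := enough n kappa B T.
set Rn := (t + (scratch test + 20) +
  \sum_(i < n) rscratch (chase_expr kappa B T i))%N.
set outs := [seq chase_expr kappa B T i | i <- enum 'I_n].
have test_room : (t + scratch test + 20 <= Rn)%N by rewrite /Rn; lia.
have outs_room : all (fun x => t + rscratch x <= Rn)%N outs by exact: scratch_room.
have outs_vars : all (rvars (4 + 3 * m)) outs.
  by rewrite all_map; apply/allP => i _ /=; exact: chase_vars.
exists (code_machine (compile 0 (search (void : finType) Rn Rn m test outs))).
move=> z Xz phi rep j; set l := fun k => point_fracs (phi k).
pose zk k : 'rV[R]_m := ratpt R (phi k).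
have enoughE k : (nval (env j k (l k)) test <> 0%N) <->
    (chase_lip kappa B)%:R * 2 ^+ j < 2 ^+ k * scale B T (zk k).
  rewrite (val_enough kappa B T R) -/(zk k) scale_sqr_scale // -!exprMn.
  rewrite ltr_pXn2r // nnegrE mulr_ge0 ?ler0n ?exprn_ge0 //.
  by rewrite scale_ge0.
have s0 : 0 < scale B T z.
  rewrite lt_max; apply/orP; right; rewrite enormZ normr_nat mulr_gt0 ?ltr0n //.
  exact: enorm_gt0 (nz _ Xz).
have [k k_gt0 /enoughE ek] : exists2 k, (0 < k)%N &
    (chase_lip kappa B)%:R * 2 ^+ j < 2 ^+ k * scale B T (zk k).
  set A := (chase_lip kappa B)%:R * 2 ^+ j : R.
  (* Precision [N.+1] suffices: 2^(N+1) times the true scale exceeds A + (1 + 2B), and passing to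
     the approximation costs at most 1 + 2B. *)
  have [N AN] : exists N : nat, (A + (1 + 2 * B%:R)) / scale B T z < N%:R.
    by exists (Num.truncn ((A + (1 + 2 * B%:R)) / scale B T z)).+1; exact: truncnS_gt.
  exists N.+1 => //.
  have p0 : 0 < 2 ^+ N.+1 :> R by rewrite exprn_gt0.
  have NN : N%:R <= 2 ^+ N.+1 :> R.
    by rewrite -natrX ler_nat ltnW // (ltn_trans (ltnSn N)) // ltn_expl.
  have h := scale_dist B T z (zk N.+1).
  have := ler_wpM2l (ltW p0) h; rewrite mulrDr.
  have hr : 2 ^+ N.+1 * ((1 + 2 * B%:R) * enorm (z - zk N.+1)) <= 1 + 2 * B%:R.
    rewrite mulrCA ler_piMr ?addr_ge0 ?mulr_ge0 // -ler_pdivlMl // mulr1.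
    exact: rep.
  move: AN; rewrite ltr_pdivrMr // => AN.
  have := ler_wpM2r (ltW s0) NN; lra.
have [k' [k'_gt0 /enoughE ek' run]] := @search_runs (void : finType) Rn Rn
  (fun i => encode (phi i)) (leqnn _) m test outs (enough_vars _ _ _ _) outs_vars
  test_room outs_room l (fun k => size_point_fracs _)
  (fun k => encode_fracs _) j (ex_intro2 _ _ k k_gt0 ek).
(* The test at [k'] also shows that the scale of the approximation is positive, so no division by
   zero is met. *)
have p0 : 0 < 2 ^+ k' :> R by rewrite exprn_gt0.
have r0 : 0 < scale B T (zk k').
  rewrite -(pmulr_rgt0 _ p0); apply: le_lt_trans ek'.
  by rewrite mulr_ge0 // exprn_ge0.
have q0 : 0 < scale_sqr B T (zk k') by rewrite scale_sqr_scale // exprn_gt0.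
set rho := env j k' (l k') in run.
exists (frac_words (map (rfrac rho) outs)),
  (\row_i rval rat rho (chase_expr kappa B T i)); split=> //.
  by apply: denotes_frac_words => i; have [_] := val_chase kappa j k' i q0.
have -> : ratpt R (\row_i rval rat rho (chase_expr kappa B T i)) =
    chase kappa B T (zk k').
  apply/rowP => i; rewrite [LHS]mxE mxE ratr_rval.
  by have [-> _] := val_chase kappa j k' i q0.
have z0 : 0 < scale_sqr B T z by rewrite scale_sqr_scale // exprn_gt0.
(* The error is at most [chase_lip] 2^-k' over the scale of [zk k'], and the successful test puts
   this below 2^-j. *)
have hd := chase_dist kappa B_gt0 z0 q0. apply: le_lt_trans hd _.
rewrite -/(scale B T (zk k')) ltr_pdivrMr //.
apply: (@le_lt_trans _ _ ((chase_lip kappa B)%:R * 2 ^- k')).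
  by apply: ler_wpM2l => //; exact: rep.
rewrite ltr_pdivrMr // -mulrA ltr_pdivlMl ?exprn_gt0 //.
by rewrite mulrC [X in _ < X]mulrC.
Qed.

(** * Multiples of a rational direction *)

Definition rconst (x : rat) : rexpr :=
  RExpr (NConst (if x < 0 then 0%N else `|numq x|%N))
        (NConst (if x < 0 then `|numq x|%N else 0%N)) (NConst `|denq x|%N).

Lemma rdef_const rho x : rdef rho (rconst x).
Proof. by rewrite /rdef /= absz_gt0 denq_neq0. Qed.

Lemma rval_const (R : realFieldType) rho x : rval R rho (rconst x) = ratr x.
Proof.
rewrite -[x in RHS]rat_fracE fmorph_div rmorphM rmorph_sign /= !ratr_nat.
rewrite /rval /=; congr (_ / _).
by case: ifP => _; rewrite ?sub0r ?subr0 ?mulN1r ?mul1r.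
Qed.

Section Direction.
Variables (n c N den : nat) (q : 'rV[rat]_n).

Definition precision_expr : nexpr := NMul (NConst (2 ^ c)) (NVar 1).
(** If v is the least integer with v^2 at least this value, then v / 2^(j + c) approximates the root
    of [N] from above within 2^-(j + c), provided [N] is positive. *)
Definition root_target : nexpr :=
  NMul (NConst N) (NMul precision_expr precision_expr).
Definition direction_expr (i : 'I_n) : rexpr :=
  rdiv (rmul (rmul (rcoord 4) (rconst (q 0 i * den%:R))) (rnat precision_expr))
       (rnat (NVar 7)).

Lemma direction_vars i : rvars 10 (direction_expr i).
Proof.
apply: rvars_div; last exact: rvars_nat.
apply: rvars_mul; last exact: rvars_nat.
by apply: rvars_mul; [exact: rvars_coord|rewrite /rvars /=].
Qed.

Lemma val_direction (R : realFieldType) j (s : bool) p d v i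
    (rho := once_env j s p d v) : (0 < d)%N -> (0 < v)%N ->
  rval R rho (direction_expr i) =
    (-1) ^+ s * p%:R / d%:R * (ratr (q 0 i) * den%:R) * 2 ^+ (j + c) / v%:R
  /\ rdef rho (direction_expr i).
Proof.
move=> d0 v0.
have k1 : rdef rho (rcoord 4) by [].
have k2 := rdef_const rho (q 0 i * den%:R).
have k3 : rdef rho (rmul (rcoord 4) (rconst (q 0 i * den%:R))) by exact: rdef_mul.
have k4 : 0 < rval R rho (rnat (NVar 7)) by rewrite rval_nat ltr0n.
have k5 : rdef rho (rmul (rmul (rcoord 4) (rconst (q 0 i * den%:R)))
  (rnat precision_expr)) by exact: rdef_mul.
split; last by apply: (rdef_div k5 _ k4).
rewrite rval_div // rval_mul // rval_mul // rval_const !rval_nat /=.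
rewrite (@rval_coord R rho 4 s p d) //.
by rewrite rmorphM /= ratr_nat natrM !natrX exprD (mulrC (2 ^+ c)).
Qed.

End Direction.

Lemma denotes1 w (q : 'rV[rat]_1) : denotes w q -> exists (s : bool) p d,
  [/\ w = frac_word s p d, (0 < d)%N & q 0 0 = (-1) ^+ s * p%:R / d%:R].
Proof.
move=> [s [p [d [-> h]]]]; exists (s 0), (p 0), (d 0).
have [d0 e] := h 0; split=> //.
by rewrite enum_ordSl /= enum_ord0 /= cats0.
Qed.

(** The function is constant, so the oracle for its argument is ignored; the program calls the
    machine that computes [b]. *)
Lemma direction_computable (R : realType) (n : nat) (b : R) (q : 'rV[rat]_n)
    (k : nat) (X : set 'rV[R]_k) : computable_real b -> 0 <= b -> q != 0 ->
  computable_on X (fun=> (b / enorm (ratpt R q)) *: ratpt R q).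
Proof.
move=> [phi [[M hM] rep]] b0 q0.
set S : rat := \sum_(i < n) q 0 i ^+ 2.
have S0 : 0 < S.
  rewrite lt_def sumr_ge0 ?andbT; last by move=> i _; rewrite sqr_ge0.
  rewrite psumr_eq0; last by move=> i _; rewrite sqr_ge0.
  apply/negP => /allP h; case/eqP: q0; apply/rowP => i; rewrite mxE.
  by have := h i (mem_index_enum _); rewrite /= sqrf_eq0 => /eqP.
(* Clearing the denominator of S = |q|^2: the norm of [q] times [den] is the root of the integer
   [N]. *)
set den := `|denq S|%N; set N := (`|numq S| * den)%N.
have den0 : (0 < den)%N by rewrite /den absz_gt0 denq_neq0.
have N0 : (0 < N)%N by rewrite /N muln_gt0 den0 andbT absz_gt0 numq_eq0 gt_eqF.
have SN : S * den%:R ^+ 2 = N%:R.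
  have := rat_fracE S; rewrite ltNge (ltW S0) mul1r => e.
  rewrite -[S]e /N natrM -/den; field.
  by rewrite pnatr_eq0 -lt0n.
have qN : enorm (ratpt R q) * den%:R = Num.sqrt N%:R.
  rewrite -[den%:R](@ger0_norm R) // -sqrtr_sqr -sqrtrM.
    congr Num.sqrt; rewrite -[N%:R](ratr_nat R) -SN rmorphM rmorphXn /= ratr_nat.
    congr (_ * _); rewrite /S rmorph_sum /=; apply: eq_bigr => i _.
    by rewrite mxE rmorphXn.
  by apply: sumr_ge0 => i _; rewrite sqr_ge0.
set root := Num.sqrt N%:R in qN.
have root1 : 1 <= root by rewrite -sqrtr1 ler_wsqrtr // ler1n.
(* The final error is at most (1 + b) / 2^(j + c); [c] extra digits absorb the factor 1 + b. *)
have [c bc] : exists c : nat, 1 + b < 2 ^+ c.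
  exists (Num.truncn (1 + b)).+1.
  apply: lt_le_trans (truncnS_gt _) _.
  by rewrite -natrX ler_nat ltnW // ltn_expl.
set outs := [seq direction_expr c den q i | i <- enum 'I_n].
set Rn := (11 + (40 + scratch (root_target c N)) +
  \sum_(i < n) rscratch (direction_expr c den q i))%N.
have outs_vars : all (rvars 10) outs.
  by rewrite all_map; apply/allP => i _ /=; exact: direction_vars.
have outs_room : all (fun x => 11 + rscratch x <= Rn)%N outs by exact: scratch_room.
exists (code_machine (compile 0 (once M Rn c (root_target c N) outs))).
move=> z _ psi _ j; have [w [run /denotes1[s [p [d [ew d0 ephi]]]]]] := hM (j + c)%N.
rewrite ew in run.
have tv : vars_below 10 (root_target c N) by [].
have tr : (40 + scratch (root_target c N) <= Rn)%N by rewrite /Rn; lia.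
have tf rho u v : nval (upd (upd rho 3 u) 7 v) (root_target c N) =
    nval rho (root_target c N) by [].
have [v [v0 vT vmin runv]] := @once_runs M Rn (fun i => encode (psi i)) c
  (root_target c N) outs tv outs_vars tr outs_room tf j s p d run.
set rho := once_env j s p d v in vT vmin runv.
set K2 : R := 2 ^+ (j + c).
have K0 : 0 < K2 by rewrite exprn_gt0.
have eT : (nval rho (root_target c N))%:R = root ^+ 2 * K2 ^+ 2 :> R.
  rewrite /= !natrM !natrX /root sqr_sqrtr ?ler0n // /K2 exprD.
  by rewrite /N natrM; ring.
have root0 : 0 < root := lt_le_trans ltr01 root1.
have v0R : 0 < v%:R :> R by rewrite ltr0n.
have v_ge : root * K2 <= v%:R.
  rewrite -(@ler_pXn2r _ 2) ?nnegrE ?mulr_ge0 ?(ltW root0) ?(ltW K0) ?ler0n //.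
  by rewrite exprMn -eT expr2 -natrM ler_nat.
have v_le : v%:R <= root * K2 + 1.
  have /orP[/eqP ->|h] := vmin.
    by rewrite lerDr mulr_ge0 ?(ltW root0) ?(ltW K0).
  have : v.-1%:R <= root * K2.
    rewrite -(@ler_pXn2r _ 2) ?nnegrE ?mulr_ge0 ?(ltW root0) ?(ltW K0) ?ler0n //.
    by rewrite exprMn -eT expr2 -natrM ler_nat ltnW.
  by rewrite -[in X in _ -> X](prednK v0) -natr1 lerD2r.
exists (frac_words (map (rfrac rho) outs)),
  (\row_i rval rat rho (direction_expr c den q i)); split=> //.
  apply: denotes_frac_words => i.
  by have [_] := val_direction c den q rat j s p i d0 v0.
set r := ratr (phi (j + c)%N 0 0) : R.
have rb : `|b - r| <= K2^-1.
  have := rep (j + c)%N; rewrite enorm1 !mxE.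
  exact.
have -> : ratpt R (\row_i rval rat rho (direction_expr c den q i)) =
    (r * den%:R * K2 / v%:R) *: ratpt R q.
  apply/rowP => i; rewrite [LHS]mxE mxE ratr_rval.
  have [-> _] := val_direction c den q R j s p i d0 v0.
  rewrite /r ephi fmorph_div rmorphM rmorph_sign /= !ratr_nat !mxE.
  by rewrite -/K2; ring.
have e0 : 0 < enorm (ratpt R q).
  by rewrite -(pmulr_lgt0 _ (_ : 0 < den%:R)) ?ltr0n // qN.
rewrite -scalerBl enormZ.
rewrite -[enorm (ratpt R q) in X in _ * X](gtr0_norm e0) -normrM.
rewrite mulrBl divfK ?gt_eqF //.
have -> : r * den%:R * K2 / v%:R * enorm (ratpt R q) = r * (root * K2 / v%:R).
  by rewrite -qN; ring.
set w' := root * K2 / v%:R.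
have w0 : 0 <= w' by rewrite divr_ge0 ?(ltW v0R) // mulr_ge0 ?(ltW root0) ?(ltW K0).
have w1 : w' <= 1 by rewrite ler_pdivrMr // mul1r.
have w2 : 1 - w' <= K2^-1.
  have -> : 1 - w' = (v%:R - root * K2) / v%:R by rewrite /w'; field; rewrite gt_eqF.
  rewrite ler_pdivrMr //; apply: (@le_trans _ _ 1); first by rewrite lerBlDl.
  by rewrite ler_pdivlMl // mulr1; apply: le_trans v_ge; rewrite ler_peMl ?(ltW K0).
(* The errors in [b] and in the root are separated; each factor, [b - r] and [1 - w'], is at most
   2^-(j + c). *)
clearbody w'; have -> : b - r * w' = (b - r) * w' + b * (1 - w') by ring.
apply: le_lt_trans (ler_normD _ _) _; rewrite !normrM.
rewrite (ger0_norm w0) (ger0_norm b0) (@ger0_norm _ (1 - w')) ?subr_ge0 //.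
have t1 : `|b - r| * w' <= K2^-1 by rewrite -[K2^-1]mulr1 ler_pM.
have t2 : b * (1 - w') <= b * K2^-1 by rewrite ler_wpM2l.
apply: le_lt_trans (lerD t1 t2) _.
have -> : K2^-1 + b * K2^-1 = (1 + b) / K2 by ring.
rewrite ltr_pdivrMr // /K2 exprD mulKf ?expf_neq0 //.
Qed.

(** * Paths and their derivatives *)

Section Paths.
Variable R : realType.

Lemma is_derive_rowP n (p : R -> 'rV[R]_n) (d : 'rV[R]_n) (t : R) :
  is_derive t (1 : R) p d <->
  forall i, is_derive t (1 : R) (fun s => p s 0 i) (d 0 i).
Proof.
split=> [[dp dv] i|h].
  have dpi := (derivable_mxP p t 1).1 dp 0 i.
  apply: DeriveDef => //; move/rowP: dv => /(_ i) <-.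
  by rewrite derive_mx // mxE.
have dp : derivable p t 1.
  by apply/derivable_mxP => i j; rewrite ord1; exact: (@ex_derive _ _ _ _ _ _ _ (h j)).
apply: DeriveDef => //; rewrite derive_mx //; apply/rowP => i.
by rewrite mxE; exact: (@derive_val _ _ _ _ _ _ _ (h i)).
Qed.

Lemma is_derive_dot n (p q : R -> 'rV[R]_n) (dp dq : 'rV[R]_n) (t : R) :
  is_derive t (1 : R) p dp -> is_derive t (1 : R) q dq ->
  is_derive t (1 : R) (fun s => dot (p s) (q s)) (dot (p t) dq + dot (q t) dp).
Proof.
move=> /is_derive_rowP hp /is_derive_rowP hq.
have -> : (fun s => dot (p s) (q s)) =
    \sum_(i < n) ((fun s => p s 0 i) * (fun s => q s 0 i)).
  by rewrite fct_sumE.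
rewrite /dot -big_split /=; apply: is_derive_sum => i.
exact: is_deriveM.
Qed.

Lemma is_derive_dotl n (e : 'rV[R]_n) (p : R -> 'rV[R]_n) (dp : 'rV[R]_n) (t : R) :
  is_derive t (1 : R) p dp -> is_derive t (1 : R) (fun s => dot e (p s)) (dot e dp).
Proof.
move=> h; have := is_derive_dot (is_derive_cst e t 1) h.
by rewrite dot0r addr0.
Qed.

Lemma row_continuousP (T : topologicalType) n (p : T -> 'rV[R]_n) (t : T) :
  {for t, continuous p} <-> forall i, {for t, continuous (fun s => p s 0 i)}.
Proof.
split=> [cp i|h].
  exact: (continuous_comp cp (@coord_continuous _ _ _ 0 i _)).
apply/cvgrPdist_le => /= e e0; near=> x.
rewrite /Num.Def.normr/= mx_normrE (bigmax_le _ (ltW e0))//= => i _.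
rewrite !mxE/=; move: i; near: x; apply: filter_forall => /= i.
have /cvgrPdist_le /(_ e e0) := h i.2.
by apply: filterS => x; rewrite ord1.
Unshelve. all: by end_near. Qed.

Lemma dot_continuous (T : topologicalType) n (p q : T -> 'rV[R]_n) (t : T) :
  {for t, continuous p} -> {for t, continuous q} ->
  {for t, continuous (fun s => dot (p s) (q s) : R)}.
Proof.
move=> /row_continuousP hp /row_continuousP hq.
have ac : continuous (fun z : R * R => z.1 + z.2) by exact: add_continuous.
rewrite /continuous_at /dot.
apply: (@cvg_big R 'I_n _ 0 predT ac T (nbhs t) (index_enum _)
  (fun i s => p s 0 i * q s 0 i) (fun i => p t 0 i * q t 0 i)) => i _.
exact: (cvgM (hp i) (hq i)).
Qed.

(** Paths are constrained on [[0, +oo[] only. Freezing them before time 0 gives continuity on the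
    whole line without changing any value that matters. *)
Lemma clamp_continuous (U : topologicalType) (f : R -> U) :
  {within `[0, +oo[, continuous f} -> continuous (fun s : R => f (Num.max 0 s)).
Proof.
move=> /subspace_continuousP cf t.
have m0 (s : R) : `[0, +oo[%classic (Num.max 0 s).
  by rewrite /= in_itv /= andbT le_max lexx.
apply: cvg_comp (cf _ (m0 t)) => A /= hA.
have cm : {for t, continuous (fun s : R => Num.max 0 s)}.
  by apply: (@continuous_max R R (cst 0) id) => //; exact: cvg_cst.
by apply: (@filterS _ (nbhs t) _ _ _ _ (cm _ hA)) => s; apply; exact: m0.
Qed.

Lemma clamp_is_derive (V : normedModType R) (f : R -> V) (t : R) (d : V) : 0 < t ->
  is_derive t (1 : R) f d <-> is_derive t (1 : R) (fun s : R => f (Num.max 0 s)) d.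
Proof.
move=> t0; have e : \near t, f t = f (Num.max 0 t).
  by near=> s; rewrite max_r //; apply: ltW; near: s; exact: lt_nbhsr.
by split; apply: near_eq_is_derive => //; near do apply/esym.
Unshelve. all: by end_near. Qed.

(** It dates the first meeting or the first contact with the cone, before which the hypotheses of
    the game are available. *)
Lemma first_zero (g : R -> R) (t : R) : 0 <= t ->
  (forall s, 0 <= s <= t -> {for s, continuous g}) -> 0 < g 0 -> g t <= 0 ->
  exists t0, [/\ 0 < t0 <= t, g t0 = 0 & forall s, 0 <= s < t0 -> 0 < g s].
Proof.
move=> t_ge0 cg g0 gt.
pose S := [set s | 0 <= s <= t /\ g s <= 0].
have St : S t by rewrite /S /= t_ge0 lexx.
have lbS : lbound S 0 by move=> s [/andP[]].
have iS : has_inf S by split; [exists t|exists 0].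
set t0 := inf S.
have t0_ge0 : 0 <= t0 by apply: lb_le_inf => //; exists t.
have t0t : t0 <= t by apply: ge_inf => //; exists 0.
have below s : 0 <= s < t0 -> 0 < g s.
  move=> /andP[s0 st]; rewrite ltNge; apply/negP => gs.
  have : t0 <= s; last by rewrite leNgt st.
  apply: ge_inf; first by exists 0.
  by split=> //; rewrite s0 (le_trans (ltW st)).
have ct0 := cg t0 (introT andP (conj t0_ge0 t0t)).
have g_le : g t0 <= 0.
  rewrite leNgt; apply/negP => gpos.
  have /cvgrPdist_lt /(_ _ gpos) := ct0.
  rewrite near_simpl -nbhs_nearE /= => -[e /= e0 he].
  have [s Ss st] := inf_adherent e0 iS.
  have ts : t0 <= s by apply: ge_inf => //; exists 0.
  have := he s; rewrite /ball_ /= distrC ger0_norm ?subr_ge0 // ltrBlDl.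
  move=> /(_ st); rewrite ltr_norml => /andP[_]; case: Ss => _.
  by lra.
have t0_gt0 : 0 < t0.
  rewrite lt_def t0_ge0 andbT; apply/eqP => e.
  by move: g_le; rewrite e leNgt g0.
exists t0; split=> //; first by rewrite t0_gt0.
apply/eqP; rewrite eq_le g_le /= leNgt; apply/negP => gneg.
have ng : 0 < - g t0 by rewrite oppr_gt0.
have /cvgrPdist_lt /(_ _ ng) := ct0.
rewrite near_simpl -nbhs_nearE /= => -[e /= e0 he].
(* A time just before [t0] at which [g] would already be negative, against [below]. *)
set s := Num.max 0 (t0 - e / 2).
have sb : 0 <= s < t0.
  by rewrite le_max lexx /= gt_max t0_gt0 /= ltrBlDr ltrDl divr_gt0.
have := below s sb; have := he s.
have st : t0 - s < e.
  have : t0 - e / 2 <= s by rewrite le_max lexx orbT.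
  by lra.
case/andP: sb => _ sb.
rewrite /ball_ /= ger0_norm ?subr_ge0 ?(ltW sb) // => /(_ st).
by rewrite ltr_norml => /andP[h _]; lra.
Qed.

(** Only the past of [t0] is known, so the difference quotients are taken at negative increments,
    where they are nonpositive. *)
Lemma is_derive_le0 (g : R -> R) (t0 d : R) : 0 < t0 ->
  is_derive t0 (1 : R) g d -> (forall s, 0 <= s < t0 -> g t0 <= g s) -> d <= 0.
Proof.
move=> t00 [dg <-] h; rewrite leNgt; apply/negP => d0.
have /cvgrPdist_lt /(_ _ d0) [e /= e0 he] := dg.
(* The increment [- c] lies within the radius [e] and does not reach below time 0. *)
set c := Num.min (e / 2) t0.
have c0 : 0 < c by rewrite lt_min t00 divr_gt0.
have ce : c < e.
  by apply: (@le_lt_trans _ _ (e / 2)); [rewrite ge_min lexx|lra].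
have := he (- c); rewrite /ball_ /= sub0r opprK gtr0_norm // => /(_ ce).
rewrite oppr_eq0 gt_eqF // => /(_ isT).
have : g t0 <= g (- c *: 1 + t0).
  apply: h; rewrite /GRing.scale /= mulr1 addrC subr_ge0 ltrBlDr ltrDl c0 andbT.
  by rewrite ge_min lexx orbT.
set G := g (- c *: 1 + t0) => hG.
rewrite -/('D_1 g t0) ltr_norml => /andP[_].
have : (- c)^-1 *: (G - g t0) <= 0.
  by rewrite /GRing.scale /= mulr_le0_ge0 ?invr_le0 ?oppr_le0 ?(ltW c0) // subr_ge0.
by lra.
Qed.

End Paths.

(** * The two strategies *)

Section Displacement.
Variables (R : realType) (n : nat).
Local Notation V := 'rV[R]_n.

(** The mean value theorem fails for vector paths, so it is applied to the projection on [e]. Taking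
    for [e] the very vector to be estimated recovers bounds on norms. *)
Lemma displacement (p d : R -> V) (t : R) (e : V) : 0 < t ->
  {within `[0, +oo[, continuous p} ->
  (forall s, 0 < s < t -> is_derive s (1 : R) p (d s)) ->
  exists2 s, 0 < s < t & dot e (p t - p 0) = dot e (d s) * t.
Proof.
move=> t0 cp dp; pose f (s : R) := dot e (p (Num.max 0 s)).
have df s : s \in `]0, t[ -> is_derive s (1 : R) f (dot e (d s)).
  rewrite in_itv /= => /andP[s0 st]; apply: is_derive_dotl.
  by apply: (clamp_is_derive _ _ s0).1; apply: dp; rewrite s0 st.
have cf : {within `[0, t], continuous f}.
  apply: continuous_subspaceT => s; apply: dot_continuous; first exact: cvg_cst.
  exact: clamp_continuous.
have [s] := MVT t0 df cf; rewrite in_itv /= => st.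
rewrite /f maxxx max_r ?(ltW t0) // subr0 -dotBr => e1.
by exists s.
Qed.

End Displacement.

(** * The escape of Evader *)

Section Evader.
Variables (R : realType) (n : nat) (a b : R) (H : set 'rV[R]_n).
Variables (x0 y0 vv : 'rV[R]_n).
Let G := Game a b H x0 y0.
Local Notation V := 'rV[R]_n.

Hypotheses (a_ge0 : 0 <= a) (ab : a <= b) (x0y0 : x0 <> y0).
Hypotheses (speed : enorm vv = b) (away : 0 <= dot (y0 - x0) vv).

Lemma escape (u : strategy R n) (x y : R -> V) : CP G u ->
  play G u (fun=> vv) x y -> forall t : R, 0 <= t -> x t <> y t.
Proof.
move=> [_ ub] [[ex ey] [cx cy] HH dxy] t t_ge0 xy.
pose z (s : R) := x (Num.max 0 s) - y (Num.max 0 s).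
pose g (s : R) := dot (z s) (z s).
have cz : continuous z.
  move=> s; apply: cvgB; exact: clamp_continuous.
have cg s : 0 <= s <= t -> {for s, continuous g}.
  by move=> _; apply: dot_continuous; exact: cz.
have g0 : 0 < g 0.
  by rewrite /g /z maxxx ex ey; apply: dot_gt0 => /eqP; rewrite subr_eq0 => /eqP.
have gt : g t <= 0 by rewrite /g /z max_r // xy subrr dot0r.
have [t0 [/andP[t00 _] gt0 gpos]] := first_zero t_ge0 cg g0 gt.
have xyt0 : x t0 = y t0.
  by have /eqP := dot_eq0 gt0; rewrite /z max_r ?(ltW t00) // subr_eq0 => /eqP.
have apart s : 0 <= s < t0 -> x s <> y s.
  move=> st; have := gpos s st; rewrite /g /z max_r; last by case/andP: st.
  by move=> h e; move: h; rewrite e subrr dot0r ltxx.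
have dx s : 0 < s < t0 -> is_derive s (1 : R) x (u (status s (x s) (y s))) /\
    is_derive s (1 : R) y vv.
  move=> /andP[s0 st]; apply: dxy => // r /andP[r0 rs]; apply: apart.
  by rewrite r0 (le_lt_trans rs).
have yt0 : y t0 = y0 + t0 *: vv.
  (* Projecting on the deviation from uniform motion shows that this deviation is orthogonal to
     itself. *)
  have [s _] := @displacement R n y (fun=> vv) t0 (y t0 - y 0 - t0 *: vv) t00 cy
    (fun s h => (dx s h).2).
  set e := _ - _ - _ => h; have : dot e e = 0.
    by rewrite {2}/e dotBr h dotZr mulrC subrr.
  move/dot_eq0/eqP; rewrite subr_eq0 subr_eq => /eqP ->.
  by rewrite ey addrC.
have xt0 : enorm (x t0 - x0) <= a * t0.
  (* Projecting on the displacement itself bounds its norm by the speed times the time. *)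
  have [s st h] := @displacement R n x (fun s => u (status s (x s) (y s))) t0
    (x t0 - x0) t00 cx (fun s h => (dx s h).1).
  have us : enorm (u (status s (x s) (y s))) <= a.
    case/andP: (st) => s0 st0; apply: ub; exists s, (x s), (y s).
    have [hx hy] := HH s (ltW s0).
    by split=> //; [exact: ltW|apply: apart; rewrite (ltW s0)].
  rewrite ex in h; set e := x t0 - x0 in h *.
  have [->|/eqP/enorm_gt0 e0] := eqVneq e 0.
    by rewrite enorm0 mulr_ge0 // ltW.
  rewrite -(ler_pM2l e0) -expr2 enorm_sqr h mulrA ler_pM2r //.
  by apply: le_trans (dot_enorm _ _) _; rewrite ler_pM2l.
have e : x t0 - x0 = (y0 - x0) + t0 *: vv by rewrite xyt0 yt0 addrAC.
(* On expanding the square, the cross term is nonnegative by [away], and |y0 - x0|^2 makes the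
   inequality strict even when a = b. *)
have : (a * t0) ^+ 2 < enorm (x t0 - x0) ^+ 2.
  have w0 : 0 < dot (y0 - x0) (y0 - x0).
    by apply: dot_gt0 => /eqP; rewrite subr_eq0 => /eqP /esym.
  have aw : 0 <= t0 * dot (y0 - x0) vv by rewrite mulr_ge0 // ltW.
  rewrite enorm_sqr e; move: w0 aw; move: (y0 - x0) => w w0 aw.
  rewrite dotDl !dotDr !dotZl !dotZr (dotC vv) -(enorm_sqr vv) speed.
  have : (a * t0) ^+ 2 <= (b * t0) ^+ 2.
    have at0 : 0 <= a * t0 by rewrite mulr_ge0 // ltW.
    have abt : a * t0 <= b * t0 by rewrite ler_pM2r.
    by rewrite ler_pXn2r // nnegrE // (le_trans at0).
  by rewrite exprMn [X in _ <= X]exprMn; lra.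
rewrite ltNge => /negP; apply.
by rewrite ler_pXn2r // nnegrE ?enorm_ge0 // mulr_ge0 // ltW.
Qed.

Variables (nu : V) (c : R).
Hypothesis (half : H = [set x | c <= dot nu x] \/ H = [set x | c < dot nu x]).
Hypotheses (Hy0 : H y0) (along : dot nu vv = 0).
Hypothesis comp : forall k (X : set 'rV[R]_k), computable_on X (fun=> vv).

Lemma run_is_derive (t : R) : is_derive t (1 : R) (fun s : R => y0 + s *: vv) vv.
Proof.
apply/is_derive_rowP => i.
have -> : (fun s => (y0 + s *: vv) 0 i) = cst (y0 0 i) + (vv 0 i *: @id R).
  by apply/funext => s; rewrite !mxE mulrC.
rewrite [X in is_derive _ _ _ X](_ : _ = 0 + vv 0 i *: (1 : R)).
  exact: is_deriveD.
by rewrite add0r /GRing.scale /= mulr1.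
Qed.

(** Computability is assumed on every domain because the same constant serves as a positional
    control and as a function of time. *)
Lemma evader_wins :
  exists v, [/\ CE G v, open_loop G b v & winningE G v].
Proof.
have stay (t : R) : H (y0 + t *: vv).
  by case: half Hy0 => -> /=; rewrite dotDr dotZr along mulr0 addr0.
exists (fun=> vv); split.
- by split; [exact: comp|move=> z _; rewrite speed].
- exists (fun=> vv); split; last by [].
  by split; [exact: comp|move=> t _; rewrite speed].
split; last by move=> u Cu x y; exact: escape.
move=> w x [_ wa] [x_0 cx Hx dx]; exists (fun s => y0 + s *: vv); split.
- by rewrite x_0 scale0r addr0.
- split=> //; apply: continuous_subspaceT => s.
  by apply: differentiable_continuous; apply/derivable1_diffP; 
    have [] := run_is_derive s.
- by move=> t t0; split; [exact: Hx|exact: stay].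
move=> t t0 _; split; last exact: run_is_derive.
by rewrite /lift_control /status row_mxKl; exact: dx.
Qed.

End Evader.

Section Antiderivative.
Variable R : realType.

(** The integral starts at -1 so that time 0 is interior and the derivative there is two-sided.
    Nothing is asked at [T], where the integrand will be singular. *)
Lemma antiderivative (f : R -> R) (T : R) :
  (forall s, s < T -> {for s, continuous f}) ->
  exists F : R -> R, forall s, -1 < s < T -> is_derive s (1 : R) F (f s).
Proof.
move=> cf; exists (fun x => \int[lebesgue_measure]_(t in `[(-1), x]) f t).
move=> s /andP[s1 sT].
(* The midpoint provides a compact interval around [s] that avoids the singularity. *)
have [h1 h2] : s < (s + T) / 2 /\ (s + T) / 2 < T by lra.
have fi : lebesgue_measure.-integrable `[(-1), (s + T) / 2] (EFin \o f).
  apply: continuous_compact_integrable; first exact: segment_compact.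
  apply: continuous_in_subspaceT => x; rewrite inE /= in_itv /= => /andP[_ xl].
  by apply: cf; exact: le_lt_trans h2.
have [d e] := continuous_FTC1_closed h1 fi s1 (cf s sT).
by apply: (DeriveDef d); rewrite -derive1E; exact: e.
Qed.

End Antiderivative.

Lemma coord_enorm (R : realType) n (v : 'rV[R]_n) i : `|v 0 i| <= enorm v.
Proof.
rewrite -sqrtr_sqr /enorm ler_wsqrtr // (bigD1 i) //= lerDl.
by apply: sumr_ge0 => j _; rewrite sqr_ge0.
Qed.

(** * Pursuit inside a shrinking cone *)

Section Pursuer.
Variables (R : realType) (n k B T : nat) (b : R).
Local Notation V := 'rV[R]_n.
Local Notation kappa := k.+1.
Hypotheses (B_gt0 : (0 < B)%N) (bB : b * B%:R + 1 < kappa%:R).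

(** Before time T it is positive exactly inside the cone. Squares keep it differentiable where the
    norm is not. *)
Definition slack (x y : R -> V) (s : R) : R :=
  (T%:R - s) ^+ 2 - B%:R ^+ 2 * dot (y s - x s) (y s - x s).

Lemma slack_is_derive (x y : R -> V) (t : R) (u v : V) :
  is_derive t (1 : R) x u -> is_derive t (1 : R) y v ->
  is_derive t (1 : R) (slack x y)
    (- (2 * (T%:R - t)) - B%:R ^+ 2 * (2 * dot (y t - x t) (v - u))).
Proof.
move=> hx hy; have hz := is_deriveB hy hx.
have hd := is_derive_dot hz hz.
have hT : is_derive t (1 : R) (fun s => T%:R - s) (- 1).
  by have := is_deriveB (is_derive_cst (T%:R : R) t (1 : R)) (is_derive_id t (1 : R));
    rewrite sub0r.
have hT2 := is_deriveM hT hT.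
have h := is_deriveB hT2 (is_deriveZ (B%:R ^+ 2) hd).
rewrite [slack x y](_ : _ = (((fun s => T%:R - s) * (fun s => T%:R - s)) -
  (B%:R ^+ 2 *: (fun s => dot ((y - x) s) ((y - x) s)))) :> (R -> R)); last first.
  by apply/funext => s; rewrite /slack expr2.
apply: is_derive_eq h _; rewrite /GRing.scale /=.
rewrite -[(y - x) t]/(y t - x t); ring.
Qed.

Lemma slack_continuous (x y : R -> V) (t : R) : {for t, continuous x} ->
  {for t, continuous y} -> {for t, continuous (slack x y)}.
Proof.
move=> cx cy; have cz : {for t, continuous (fun s => y s - x s)} by exact: cvgB.
have cT : {for t, continuous (fun s : R => T%:R - s)}.
  by apply: cvgB; [exact: cvg_cst|exact: cvg_id].
apply: cvgB; first exact: (cvgM cT cT).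
exact: (cvgM (cvg_cst _) (dot_continuous cz cz)).
Qed.

(** At a contact, with Z = T - t, the derivative of the slack is at least 2 Z (kappa - 1 - bB) > 0,
    whereas a first contact reached from positive values forces it to be nonpositive. *)
Lemma no_touch (x y : R -> V) (t : R) (v : V) : 0 < t < T%:R ->
  is_derive t (1 : R) x ((kappa%:R / (T%:R - t)) *: (y t - x t)) ->
  is_derive t (1 : R) y v -> enorm v <= b -> slack x y t = 0 ->
  (forall s, 0 <= s < t -> 0 < slack x y s) -> False.
Proof.
move=> /andP[t0 tT] hx hy vb s0 spos.
have := is_derive_le0 t0 (slack_is_derive hx hy).
rewrite s0 => /(_ (fun s h => ltW (spos s h))).
have Z0 : 0 < T%:R - t by rewrite subr_gt0.
set Z := T%:R - t in s0 Z0 *; set z := y t - x t in s0 *.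
have eZ : Z ^+ 2 = B%:R ^+ 2 * dot z z.
  by move/eqP: s0; rewrite /slack -/z -/Z subr_eq0 => /eqP.
have B0 : 0 < B%:R :> R by rewrite ltr0n.
have nz : B%:R * enorm z = Z.
  apply/eqP; rewrite -(@eqrXn2 _ 2) ?mulr_ge0 ?enorm_ge0 ?(ltW Z0) ?ltW //.
  by rewrite exprMn enorm_sqr eZ.
have zv : dot z v <= enorm z * b.
  by apply: le_trans (dot_enorm _ _) _; rewrite ler_wpM2l // enorm_ge0.
rewrite dotBr dotZr.
have -> : B%:R ^+ 2 * (2 * (dot z v - kappa%:R / Z * dot z z)) =
    2 * (B%:R ^+ 2 * dot z v) - 2 * kappa%:R * (B%:R ^+ 2 * dot z z) / Z.
  by field; rewrite gt_eqF.
rewrite -eZ; have -> : 2 * kappa%:R * Z ^+ 2 / Z = 2 * kappa%:R * Z.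
  by field; rewrite gt_eqF.
have : B%:R ^+ 2 * dot z v <= Z * (b * B%:R).
  apply: le_trans (ler_wpM2l (exprn_ge0 2 (ltW B0)) zv) _.
  by rewrite -nz expr2 le_eqVlt; apply/orP; left; apply/eqP; ring.
have : Z * (b * B%:R + 1) < Z * kappa%:R by rewrite ltr_pM2l.
by lra.
Qed.

(** The inequality is not strict because the formula is also needed at the instant of a supposed
    contact. *)
Lemma chase_status (t : R) (x y : V) : t < T%:R ->
  B%:R ^+ 2 * dot (y - x) (y - x) <= (T%:R - t) ^+ 2 ->
  chase kappa B T (status t x y) = (kappa%:R / (T%:R - t)) *: (y - x).
Proof.
move=> tT h; have Z0 : 0 < T%:R - t by rewrite subr_gt0.
have ec : clock (status t x y) = t by rewrite /clock /status row_mxKl mxE.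
have es : sight (status t x y) = y - x.
  by rewrite /sight /status !row_mxKr row_mxKl.
rewrite /chase /scale_sqr ec es /gap max_l ?(ltW Z0) // max_l //.
by congr (_ *: _); field; rewrite gt_eqF.
Qed.

Variables (a : R) (H : set V) (x0 y0 : V) (nu : V) (c : R).
Hypothesis half : H = [set x | c <= dot nu x] \/ H = [set x | c < dot nu x].
Hypotheses (reach : B%:R * enorm (y0 - x0) < T%:R) (Hx0 : H x0).
Let G := Game a b H x0 y0.

Lemma T_gt0 : 0 < T%:R :> R.
Proof. by apply: le_lt_trans reach; rewrite mulr_ge0 ?enorm_ge0. Qed.

Lemma slack0 (x y : R -> V) : x 0 = x0 -> y 0 = y0 -> 0 < slack x y 0.
Proof.
move=> ex ey; rewrite /slack ex ey subr0 -enorm_sqr -exprMn subr_gt0 ltr_pXn2r //.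
  by rewrite nnegrE mulr_ge0 ?enorm_ge0.
by rewrite nnegrE ler0n.
Qed.

(** Without a catch the equations hold at all times. The slack is nonpositive at [T], so it has a
    first zero; [no_touch] excludes one before [T], and at [T] it means coincidence. *)
Lemma chase_catches (v : strategy R n) (x y : R -> V) : CE G v ->
  play G (chase kappa B T) v x y -> exists t : R, 0 <= t /\ x t = y t.
Proof.
move=> [_ vb] [[ex ey] [cx cy] HH dxy]; apply: contrapT => nocatch.
have apart s : 0 <= s -> x s <> y s by move=> s0 e; apply: nocatch; exists s.
pose xm (s : R) := x (Num.max 0 s); pose ym (s : R) := y (Num.max 0 s).
have T0 := T_gt0.
have sm0 : 0 < slack xm ym 0 by apply: slack0; rewrite /xm /ym maxxx.
have smT : slack xm ym T%:R <= 0.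
  by rewrite /slack subrr expr0n sub0r oppr_le0 mulr_ge0 ?exprn_ge0 ?dot_ge0.
have cs s : 0 <= s <= T%:R -> {for s, continuous (slack xm ym)}.
  by move=> _; apply: slack_continuous; exact: clamp_continuous.
have [t [/andP[t0 tT] st spos]] := first_zero (ltW T0) cs sm0 smT.
have [xt yt] : xm t = x t /\ ym t = y t by rewrite /xm /ym max_r ?ltW.
have [dx dy] := dxy t t0 (fun s h => apart s (proj1 (andP h))).
move: tT; rewrite le_eqVlt => /orP[/eqP tT|tT].
  apply: (apart t (ltW t0)); move/eqP: st.
  rewrite /slack -tT subrr expr0n sub0r oppr_eq0 mulf_eq0 => /orP[/eqP e|/eqP e].
    by have := exprn_gt0 2 (_ : 0 < B%:R :> R); rewrite e ltxx ltr0n => /(_ B_gt0).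
  by have /eqP := dot_eq0 e; rewrite xt yt subr_eq0 => /eqP ->.
have [hx hy] := HH t (ltW t0).
apply: (@no_touch xm ym t (v (status t (x t) (y t))) _ _ _ _ st spos).
- by rewrite t0.
- apply: (clamp_is_derive _ _ t0).1; rewrite xt yt -chase_status //.
  by move/eqP: (st); rewrite /slack xt yt subr_eq0 => /eqP ->.
- exact: (clamp_is_derive _ _ t0).1.
apply: vb; exists t, (x t), (y t); split=> //; first exact: ltW.
by apply: apart; exact: ltW.
Qed.

(** With exponent [kappa] it solves the homogeneous equation X' = - kappa X / (T - s), so it is the
    integrating factor of the linear law. *)
Definition horizon_pow (m : nat) (s : R) : R := (T%:R - s) ^+ m.

Lemma horizon_pow_is_derive m s : is_derive s (1 : R) (horizon_pow m.+1)
  (- (m.+1%:R * (T%:R - s) ^+ m)).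
Proof.
have hT : is_derive s (1 : R) (fun s => T%:R - s) (- 1).
  by have := is_deriveB (is_derive_cst (T%:R : R) s (1 : R)) (is_derive_id s (1 : R));
    rewrite sub0r.
have := is_deriveX m.+1 hT; rewrite [_ ^+ _](_ : _ = horizon_pow m.+1).
  by move=> h; apply: is_derive_eq h _; rewrite /GRing.scale /= mulrN1 -mulr_natl.
by apply/funext => r; rewrite /horizon_pow exprfctE.
Qed.

Lemma is_derive_continuous (V' : normedModType R) (g : R -> V') s d :
  is_derive s (1 : R) g d -> {for s, continuous g}.
Proof. by move=> [h _]; apply: differentiable_continuous; exact/derivable1_diffP. Qed.

(** Variation of constants: X is (T - s)^kappa times a function whose derivative is kappa Y / (T -
    s)^(kappa + 1). *)
Lemma pursuit_ode (Y : R -> V) : continuous Y -> exists X : R -> V,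
  X 0 = x0 /\ forall s : R, -1 < s < T%:R ->
    is_derive s (1 : R) X ((kappa%:R / (T%:R - s)) *: (Y s - X s)).
Proof.
move=> cY; have Z_neq0 (s : R) m : s < T%:R -> horizon_pow m s != 0.
  by move=> sT; rewrite expf_neq0 // subr_eq0 gt_eqF.
pose f (i : 'I_n) (s : R) := Y s 0 i * (horizon_pow kappa.+1 s)^-1.
have cf i (s : R) : s < T%:R -> {for s, continuous (f i)}.
  move=> sT; apply: cvgM; first by have /row_continuousP := cY s; exact.
  apply: cvgV; first exact: Z_neq0.
  exact: is_derive_continuous (horizon_pow_is_derive _ _).
pose F i : R -> R := sval (cid (antiderivative (cf i))).
have dF i (s : R) : -1 < s < T%:R -> is_derive s (1 : R) (F i) (f i s).
  exact: (svalP (cid (antiderivative (cf i)))).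
(* The constant of integration that gives [X 0 = x0]. *)
pose C i : R := x0 0 i / T%:R ^+ kappa - kappa%:R * F i 0.
pose X (s : R) : V := \row_i (horizon_pow kappa s * (C i + kappa%:R * F i s)).
have T0 := T_gt0.
have X0 : X 0 = x0.
  apply/rowP => i; rewrite mxE /C subrK /horizon_pow subr0.
  by rewrite mulrC divfK // expf_neq0 // gt_eqF.
exists X; split=> // s hs; have sT : s < T%:R by case/andP: hs.
apply/is_derive_rowP => i.
have h1 := is_deriveD (is_derive_cst (C i) s (1 : R))
  (is_deriveZ kappa%:R (dF i s hs)).
have h := is_deriveM (horizon_pow_is_derive k s) h1.
rewrite [X in is_derive _ _ X _](_ : _ = horizon_pow kappa *
    (cst (C i) + kappa%:R *: F i)); last first.
  by apply/funext => r; rewrite mxE.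
apply: is_derive_eq h _; rewrite /GRing.scale /= !mxE /f add0r.
rewrite -[(cst (C i) + _) s]/(C i + kappa%:R * F i s) /horizon_pow.
have Z0 : T%:R - s != 0 by rewrite subr_eq0 gt_eqF.
rewrite !exprS; have P0 : (T%:R - s) ^+ k != 0 by rewrite expf_neq0.
move: Z0 P0; set Z := T%:R - s; set P := Z ^+ k => Z0 P0.
by field; rewrite Z0 P0.
Qed.

(** Dividing by the integrating factor makes X cancel from the derivative, which is left with kappa
    (nu.Y - c) / (T - s)^(kappa + 1). The sign of nu.X - c at time 0 is thus kept, strict or not,
    which serves both kinds of half-space. *)
Lemma pursuit_stays (X Y : R -> V) (t : R) : X 0 = x0 ->
  (forall s : R, -1 < s < T%:R ->
    is_derive s (1 : R) X ((kappa%:R / (T%:R - s)) *: (Y s - X s))) ->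
  (forall s : R, 0 <= s -> H (Y s)) -> 0 <= t < T%:R -> H (X t).
Proof.
move=> X0 dX HY /andP[]; rewrite le_eqVlt => /orP[/eqP <- _|t0 tT].
  by rewrite X0.
pose h (s : R) := (dot nu (X s) - c) * (horizon_pow kappa s)^-1.
have Zs (s : R) : s < T%:R -> 0 < T%:R - s by rewrite subr_gt0.
have dh (s : R) : -1 < s < T%:R ->
    is_derive s (1 : R) h (kappa%:R * (dot nu (Y s) - c) / (T%:R - s) ^+ kappa.+1).
  move=> hs; have Z0 : 0 < T%:R - s by apply: Zs; case/andP: hs.
  have nz : horizon_pow kappa s != 0 by rewrite expf_neq0 // gt_eqF.
  have h1 := is_deriveB (is_derive_dotl nu (dX s hs)) (is_derive_cst c s (1 : R)).
  have h2 := is_deriveV nz (horizon_pow_is_derive k s).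
  apply: is_derive_eq (is_deriveM h1 h2) _.
  rewrite /GRing.scale /= dotZr dotBr subr0 -[(_ - cst c) s]/(dot nu (X s) - c).
  have P0 : (T%:R - s) ^+ k != 0 by rewrite expf_neq0 // gt_eqF.
  rewrite /horizon_pow !exprS expr0 mulr1; move: Z0 P0.
  set Z := T%:R - s; set P := Z ^+ k => Z0 P0.
  by field; rewrite P0 gt_eqF.
have dh' (s : R) : s \in `]0, t[ ->
    is_derive s (1 : R) h (kappa%:R * (dot nu (Y s) - c) / (T%:R - s) ^+ kappa.+1).
  by rewrite in_itv /= => /andP[s0 st]; apply: dh; apply/andP; split; lra.
have ch : {within `[0, t], continuous h}.
  apply: continuous_in_subspaceT => s; rewrite inE /= in_itv /= => /andP[s0 st].
  have hs : -1 < s < T%:R by apply/andP; split; lra.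
  exact: is_derive_continuous (dh s hs).
have [s] := MVT t0 dh' ch; rewrite in_itv /= subr0 => /andP[s0 st] e.
have Yc : c <= dot nu (Y s).
  by have := HY s (ltW s0); case: half => -> //= /ltW.
have P0 : 0 < horizon_pow kappa 0 by apply: exprn_gt0; apply: Zs; lra.
have Pt : 0 < horizon_pow kappa t by apply: exprn_gt0; exact: Zs.
have h0t : h 0 <= h t.
  rewrite -subr_ge0 e mulr_ge0 ?(ltW t0) // divr_ge0 ?exprn_ge0 //.
    by rewrite mulr_ge0 // subr_ge0.
  by apply: ltW; apply: Zs; lra.
have ht : 0 <= h t -> c <= dot nu (X t).
  by rewrite /h pmulr_lge0 ?invr_gt0 // subr_ge0.
have ht' : 0 < h t -> c < dot nu (X t).
  by rewrite /h pmulr_lgt0 ?invr_gt0 // subr_gt0.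
case: half Hx0 => -> /=; rewrite -X0 => hx.
  by apply: ht; apply: le_trans h0t; rewrite /h mulr_ge0 ?invr_ge0 ?(ltW P0) ?subr_ge0.
by apply: ht'; apply: lt_le_trans h0t; rewrite /h mulr_gt0 ?invr_gt0 ?subr_gt0.
Qed.

(** The play follows the explicit solution until [T] and Evader's own motion afterwards. What has to
    be shown is that the linear law agrees with the control before [T] and that the two pieces join
    continuously. *)
Lemma chase_admissible : admissibleP G (chase kappa B T).
Proof.
move=> w y [_ wb] [y_0 cy Hy dy].
pose Y (s : R) := y (Num.max 0 s).
have cY : continuous Y by exact: clamp_continuous.
have yY (s : R) : 0 <= s -> Y s = y s by move=> s0; rewrite /Y max_r.
have HY (s : R) : 0 <= s -> H (Y s) by move=> s0; rewrite yY //; exact: Hy.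
have [X [X0 dX]] := pursuit_ode cY.
have T0 := T_gt0.
have dXc (s : R) : 0 <= s < T%:R ->
    is_derive s (1 : R) X ((kappa%:R / (T%:R - s)) *: (Y s - X s)).
  by move=> /andP[s0 sT]; apply: dX; apply/andP; split; lra.
have dY (s : R) : 0 < s -> is_derive s (1 : R) Y (w (\row_(i < 1) s)).
  by move=> s0; apply: (clamp_is_derive _ _ s0).1; exact: dy.
have inside (t : R) : 0 <= t < T%:R -> 0 < slack X Y t.
  move=> /andP[t0 tT]; rewrite ltNge; apply/negP => st.
  have cs s : 0 <= s <= t -> {for s, continuous (slack X Y)}.
    move=> /andP[s0 sle]; apply: slack_continuous; last exact: cY.
    apply: is_derive_continuous (dXc s _); rewrite s0 /=.
    exact: le_lt_trans tT.
  have s00 : 0 < slack X Y 0 by apply: slack0; rewrite // yY.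
  have [r [/andP[r0 rt] sr spos]] := first_zero t0 cs s00 st.
  have rT : r < T%:R by exact: le_lt_trans tT.
  apply: (@no_touch X Y r (w (\row_(i < 1) r)) _ _ _ _ sr spos).
  - by rewrite r0.
  - by apply: dXc; rewrite (ltW r0).
  - exact: dY.
  - by apply: wb; rewrite /times /= mxE ltW.
(* The cone closes at [T], which will give continuity there; B >= 1 allows the factor B to be
   dropped. *)
have close (t : R) : 0 <= t < T%:R -> enorm (Y t - X t) <= T%:R - t.
  move=> ht; have tT : t < T%:R by case/andP: ht.
  have := inside t ht; rewrite /slack subr_gt0 -enorm_sqr -exprMn.
  have Z0 : 0 <= T%:R - t by rewrite subr_ge0 ltW.
  rewrite ltr_pXn2r ?nnegrE ?mulr_ge0 ?enorm_ge0 // => /ltW.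
  apply: le_trans; rewrite ler_peMl ?enorm_ge0 //.
  by rewrite ler1n.
pose x (s : R) := if s < T%:R then X s else Y s.
have xX (s : R) : s < T%:R -> x s = X s by rewrite /x => ->.
have xY (s : R) : T%:R <= s -> x s = Y s by rewrite /x ltNge => ->.
have nearX (s : R) : s < T%:R -> \near s, X s = x s.
  by move=> sT; near=> r; rewrite xX //; near: r; exact: lt_nbhsl.
have dx (s : R) : 0 <= s < T%:R ->
    is_derive s (1 : R) x ((kappa%:R / (T%:R - s)) *: (Y s - X s)).
  by move=> hs; apply: near_eq_is_derive (dXc s hs); apply: nearX; case/andP: hs.
(* From [T] on, continuity of [x] is that of [Y] minus this difference, and the bound [Ds] treats
   the joint and all later times alike. *)
pose D (s : R) := Y s - x s.
have Ds (s r : R) : T%:R <= s -> 0 <= r -> enorm (D r) <= `|s - r|.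
  move=> Ts r0; rewrite /D; case: (ltP r T%:R) => rT.
    rewrite xX //; apply: le_trans (close r _) _; first by rewrite r0.
    by apply: le_trans (ler_norm _); rewrite lerB.
  by rewrite xY // subrr enorm0.
have cD (s : R) : T%:R <= s -> {for s, continuous D}.
  move=> Ts; apply/row_continuousP => i; apply/cvgrPdist_lt => e e0.
  have s0 : 0 < s by exact: lt_le_trans Ts.
  near=> r; rewrite /D xY // subrr mxE sub0r normrN.
  apply: le_lt_trans (coord_enorm _ _) _; apply: le_lt_trans (Ds s r Ts _) _.
    by apply: ltW; near: r; exact: lt_nbhsr.
  by near: r; apply: (cvgrPdist_lt _ _).1 => //; exact: cvg_id.
have cx (s : R) : 0 <= s -> {for s, continuous x}.
  move=> s0; case: (ltP s T%:R) => sT.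
    by apply: is_derive_continuous (dx s _); rewrite s0.
  rewrite [x](_ : _ = Y - D); last by apply/funext => r; rewrite /D !fctE subKr.
  by apply: cvgB; [exact: cY|exact: cD].
exists x; split.
- by rewrite xX.
- split=> //; apply: continuous_in_subspaceT => s.
  by rewrite inE /= in_itv /= andbT; exact: cx.
- move=> t t0; split; last exact: Hy.
  case: (ltP t T%:R) => tT; last by rewrite xY //; exact: HY.
  by rewrite xX //; apply: pursuit_stays dX HY _ => //; rewrite t0.
(* The players coincide at [T], so the equations are owed only before it. *)
move=> t t0 apart; have tT : t < T%:R.
  rewrite ltNge; apply/negP => Tt; apply: (apart T%:R); first by rewrite ltW.
  by rewrite xY // yY // ltW.
have ht : 0 <= t < T%:R by rewrite ltW.
split; last by rewrite /lift_control /status row_mxKl; exact: dy.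
have := dx t ht; rewrite -(xX t tT) -(yY t (ltW t0)) chase_status //.
by have := inside t ht; rewrite /slack xX // subr_gt0 => /ltW.
Unshelve. all: by end_near. Qed.

End Pursuer.

Lemma chase_speed (R : realType) (n kappa B T : nat) (z : 'rV[R]_(1 + (n + n))) :
  (0 < B)%N -> enorm (chase kappa B T z) <= kappa%:R / B%:R.
Proof.
move=> B0; rewrite chase_blend // enormZ ger0_norm ?divr_ge0 //.
rewrite -[leRHS]mulr1 ler_wpM2l ?divr_ge0 // /blend enormZ.
set Z := gap T _; set w := B%:R *: _; set r := Num.max Z _.
have Z0 : 0 <= Z by exact: gap_ge0.
have w0 := enorm_ge0 w.
have Zr : Z <= r by rewrite le_max lexx.
have wr : enorm w <= r by rewrite le_max lexx orbT.
rewrite ger0_norm ?divr_ge0 ?exprn_ge0 ?(le_trans Z0) //.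
(* If gap and sight both vanish, division by zero yields the zero control. *)
have [r0|r0] := eqVneq r 0.
  by rewrite r0 expr0n invr0 mulr0 mul0r.
have r_gt0 : 0 < r by rewrite lt_def r0 (le_trans Z0).
by rewrite mulrAC ler_pdivrMr ?exprn_gt0 // mul1r expr2 ler_pM.
Qed.

Lemma pursuer_wins (R : realType) (n : nat) (a b : R) (H : set 'rV[R]_n)
    (x0 y0 nu : 'rV[R]_n) (c : R) :
  H = [set x | c <= dot nu x] \/ H = [set x | c < dot nu x] ->
  0 <= b -> b < a -> H x0 ->
  let G := Game a b H x0 y0 in exists u, CP G u /\ winningP G u.
Proof.
move=> half b0 ab Hx0 G.
(* Since B (a - b) > 2, the integer part of aB exceeds aB - 1 > bB + 1, and it may serve as
   [kappa]. *)
have [B hB] : exists B : nat, 2 / (a - b) < B%:R.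
  by exists (Num.truncn (2 / (a - b))).+1; exact: truncnS_gt.
have hab : 0 < a - b by rewrite subr_gt0.
have B0R : 0 < B%:R :> R by apply: lt_trans hB; rewrite divr_gt0.
have B0 : (0 < B)%N by rewrite -(ltr0n R).
rewrite ltr_pdivrMr // in hB.
have a0 : 0 <= a * B%:R by rewrite mulr_ge0 // ltW // (le_lt_trans b0).
have /andP[k1 k2] := truncn_itv a0; set kap := Num.truncn _ in k1 k2.
have bk : b * B%:R + 1 < kap%:R by move: k2; rewrite -natr1; lra.
case: kap k1 k2 bk => [|k] k1 _ bk.
  by move: bk; rewrite ltNge addr_ge0 // mulr_ge0.
have [T hT] : exists T : nat, B%:R * enorm (y0 - x0) < T%:R.
  by exists (Num.truncn (B%:R * enorm (y0 - x0))).+1; exact: truncnS_gt.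
exists (chase k.+1 B T); split; last split.
- split=> [|z _]; last first.
    by apply: le_trans (chase_speed _ _ _ B0) _; rewrite ler_pdivrMr.
  apply: chase_computable => // z [t [x [y [-> _ _ _ xy]]]].
  rewrite /sight /status !row_mxKr row_mxKl => /eqP; rewrite subr_eq0 => /eqP e.
  by apply: xy; rewrite e.
- exact: (chase_admissible B0 bk half hT Hx0).
- by move=> v Cv x y; exact: (chase_catches B0 bk hT Cv).
Qed.

(** A dense subset with a single point would reduce P to that point, but from dimension 2 on a
    hyperplane has other points. The difference of two rational points of P is a rational direction
    parallel to P. *)
Lemma two_rational_points (R : realType) (n : nat) (P : set 'rV[R]_n)
    (nu : 'rV[R]_n) (c : R) : (1 < n)%N -> nu != 0 -> P = [set x | dot nu x = c] ->
  has_computable_dense_rational_subset P ->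
  exists q : 'rV[rat]_n, q != 0 /\ dot nu (ratpt R q) = 0.
Proof.
move=> n1 nu0 -> [D [_ DP PD]].
suff [q1 [q2 [D1 D2 ne]]] : exists q1 q2, [/\ D q1, D q2 & q1 != q2].
  exists (q1 - q2); rewrite subr_eq0 ne; split=> //.
  rewrite /ratpt map_mxB dotBr.
  have /= -> := DP (ratpt R q1) (ex_intro2 _ _ q1 D1 erefl).
  by have /= -> := DP (ratpt R q2) (ex_intro2 _ _ q2 D2 erefl); rewrite subrr.
have nn : 0 < dot nu nu by apply: dot_gt0; exact/eqP.
(* The foot of the perpendicular from the origin, a point certain to lie on the hyperplane. *)
set p0 := (c / dot nu nu) *: nu.
have Pp0 : dot nu p0 = c by rewrite dotZr divfK // gt_eqF.
have [q1 D1] : exists q1, D q1.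
  have [_ [[q Dq _] _]] := PD _ Pp0 setT (filterT).
  by exists q.
apply: contrapT => noq.
have S1 : [set ratpt R q | q in D] `<=` [set ratpt R q1].
  move=> _ [q Dq <-] /=; congr (ratpt R); apply/eqP; rewrite -[_ == _]negbK.
  by apply/negP => ne; apply: noq; exists q, q1.
have cl1 (p : 'rV[R]_n) : dot nu p = c -> p = ratpt R q1.
  move=> /PD /(closureS S1); rewrite -(closure_id _).1 //.
  exact: (accessible_closed_set1 (hausdorff_accessible (@norm_hausdorff _ _))).
have [i ni] : exists i, nu 0 i != 0.
  apply/existsP; rewrite -[[exists _, _]]negbK negb_exists; apply/negP => /forallP h.
  case/eqP: nu0; apply/rowP => i; rewrite mxE; apply/eqP.
  by rewrite -[_ == _]negbK.
have [j ji] : exists j : 'I_n, j != i.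
  case: (eqVneq i (Ordinal n1)) => [->|ne].
    by exists (Ordinal (ltnW n1)).
  by exists (Ordinal n1); rewrite eq_sym.
(* A vector orthogonal to [nu], non-zero because its coordinate [j] is - nu_i; so [p0 + d] is a
   second point. *)
pose d : 'rV[R]_n := nu 0 j *: delta_mx 0 i - nu 0 i *: delta_mx 0 j.
have dotd l : dot nu (delta_mx 0 l) = nu 0 l.
  rewrite /dot (bigD1 l) //= mxE !eqxx mulr1 big1 ?addr0 // => m ml.
  by rewrite mxE (negPf ml) andbF mulr0.
have Pp1 : dot nu (p0 + d) = c.
  by rewrite dotDr Pp0 /d dotBr !dotZr !dotd mulrC subrr addr0.
have := etrans (cl1 _ Pp1) (esym (cl1 _ Pp0)).
move=> /(congr1 (fun v => v - p0)); rewrite addrC addKr subrr => /rowP /(_ j).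
rewrite !mxE !eqxx (negPf ji) mulr0 sub0r mulr1 => /eqP.
by rewrite oppr_eq0 (negPf ni).
Qed.

Theorem theorem10 (R : realType) (n : nat) (a b : R)
    (P H : set 'rV[R]_n) (x0 y0 : 'rV[R]_n)
    (ha : computable_real a) (hb : computable_real b)
    (ha0 : 0 <= a) (hb0 : 0 <= b)
    (hP : is_hyperplane P)
    (hD : has_computable_dense_rational_subset P)
    (hH : half_space_of P H)
    (hx0 : computable_point x0) (hy0 : computable_point y0)
    (hHx0 : H x0) (hHy0 : H y0) (hxy : x0 <> y0) :
  let G := Game a b H x0 y0 in
  ((1 < n)%N -> a <= b ->
     exists v, [/\ CE G v, open_loop G b v & winningE G v]) /\
  (b < a -> exists u, CP G u /\ winningP G u).
Proof.
move=> G; have [nu [c [nu0 eP half]]] := hH; split; last first.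
  by move=> ab; exact: pursuer_wins half hb0 ab hHx0.
move=> n1 ab; have [q0 [q0_neq0 q0P]] := two_rational_points n1 nu0 eP hD.
have [q [q_neq0 qP away]] : exists q : 'rV[rat]_n,
    [/\ q != 0, dot nu (ratpt R q) = 0 & 0 <= dot (y0 - x0) (ratpt R q)].
  case: (lerP 0 (dot (y0 - x0) (ratpt R q0))) => h; first by exists q0.
  exists (- q0); rewrite oppr_eq0 /ratpt map_mxN !dotNr -/(ratpt R q0) q0P oppr0.
  by split=> //; rewrite oppr_ge0 ltW.
have q_gt0 : 0 < enorm (ratpt R q).
  apply: enorm_gt0 => /rowP h; case/eqP: q_neq0; apply/rowP => i.
  by have /eqP := h i; rewrite !mxE fmorph_eq0 => /eqP.
set vv := (b / enorm (ratpt R q)) *: ratpt R q.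
apply: (@evader_wins R n a b H x0 y0 vv ha0 ab hxy _ _ nu c half hHy0).
- by rewrite enormZ ger0_norm ?divr_ge0 ?(ltW q_gt0) // divfK // gt_eqF.
- by rewrite dotZr mulr_ge0 // divr_ge0 // ltW.
- by rewrite dotZr qP mulr0.
- by move=> k X; exact: direction_computable.
Qed.
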